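(* Let $\mathcal K$ be a simplicial complex on $[m]$ and let $\mathfrak h\subset\mathfrak t_{\mathbb C}\cong\mathbb C^m$ be a complex subspace satisfying conditions (a) and (b) of the context. Let $M=U(\mathcal K)/H$, $H=\exp\mathfrak h\subset T_{\mathbb C}=(\mathbb C^* )^m$, be the corresponding compact complex manifold with maximal torus action. Assume that (i) $U(\mathcal K)$ is simply connected; (ii) the only linear function $u\in N^*\subset\mathfrak t^*$ vanishing identically on $p(\mathfrak h)$ is zero, where $N^*\cong\mathbb Z^m$ is the character lattice of $T=(S^1)^m$. Then there are only finitely many analytic subsets of codimension one in $M$.
   Context: A simplicial complex on $[m]=\{1,\dots,m\}$ is a family $\mathcal K$ of subsets of $[m]$ closed under taking subsets and containing $\varnothing$ (it is not required that every singleton belongs to $\mathcal K$). A fan in a finite-dimensional real vector space is a finite set of strictly convex polyhedral cones, closed under taking faces, in which the intersection of any two cones is a face of each. It is complete if the union of its cones is the whole space. Let $T=(S^1)^m\subset T_{\mathbb C}=(\mathbb C^* )^m$, let $\mathfrak t\cong\mathbb R^m$ be the Lie algebra of $T$ with standard basis $e_1,\dots,e_m$, and let $\mathfrak t_{\mathbb C}=\mathfrak t\oplus i\mathfrak t\cong\mathbb C^m$ be the Lie algebra of $T_{\mathbb C}$, with exponential map $\exp:\mathfrak t_{\mathbb C}\to T_{\mathbb C}$. Let $p:\mathfrak t_{\mathbb C}\to\mathfrak t$ be the projection onto the real part. Let $\Sigma_{\mathcal K}$ be the fan in $\mathfrak t$ consisting of the cones $\{\sum_{i\in I}\mu_ie_i:\mu_i\ge0\}$,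 $I\in\mathcal K$, and let $$U(\mathcal K)=\mathbb C^m\setminus\bigcup_{J\notin\mathcal K}\{z\in\mathbb C^m: z_j=0\text{ for all }j\in J\},$$ on which $(\mathbb C^* )^m$ acts coordinatewise. The conditions on $\mathfrak h$ are: (a) the group $H=\exp\mathfrak h$ intersects trivially every coordinate subtorus $(\mathbb C^* )^I=\{t\in(\mathbb C^* )^m: t_j=1\text{ for }j\notin I\}$ with $I\in\mathcal K$; (b) the projection $q:\mathfrak t\to\mathfrak t/p(\mathfrak h)$ maps the fan $\Sigma_{\mathcal K}$ bijectively onto a complete fan, i.e. $q(\Sigma_{\mathcal K})=\{q(\sigma):\sigma\in\Sigma_{\mathcal K}\}$ is a complete fan in $\mathfrak t/p(\mathfrak h)$ and $q$ restricts to a bijection from the union of the cones of $\Sigma_{\mathcal K}$ onto $\mathfrak t/p(\mathfrak h)$. Under (a) and (b) the group $H$ acts freely and properly on $U(\mathcal K)$, and $U(\mathcal K)/H$ is a compact complex manifold with a maximal torus action. *)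

(* Defs.v *)
From HB Require Import structures.
From mathcomp Require Import all_boot all_order all_algebra.
From mathcomp Require Import generic_quotient ring_quotient complex.
From mathcomp Require Import all_classical all_reals all_analysis.

Set Implicit Arguments.
Unset Strict Implicit.
Unset Printing Implicit Defensive.

Import Order.TTheory GRing.Theory Num.Theory.
Import numFieldNormedType.Exports.

Local Open Scope classical_set_scope.
Local Open Scope complex_scope.
Local Open Scope ring_scope.
Local Open Scope quotient_scope.

(* Topology and norm of the complex numbers, given by the modulus. *)
HB.instance Definition _ (R : rcfType) := NormedModule.copy R[i] R[i]^o.

Section LinearQuotient.
Context {K : pzRingType} {V : lmodType K}.
Variable W : submodClosed V.

(* A submodClosed predicate over a ring is closed under opposite, but the
   hierarchy does not provide the zmodClosed structure that Quotient.quot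
   expects. *)
Definition submod_pred : {pred V} := W.

Lemma submod_pred_zmod_closed : zmod_closed submod_pred.
Proof.
split=> [|x y xW yW]; rewrite /submod_pred ?rpred0 //.
by rewrite -scaleN1r; apply: rpredD; rewrite // rpredZ.
Qed.

HB.instance Definition _ :=
  GRing.isZmodClosed.Build V submod_pred submod_pred_zmod_closed.

Definition lquot : Type := Quotient.quot submod_pred.

HB.instance Definition _ := GRing.Zmodule.on lquot.

Definition lquot_pi (v : V) : lquot := \pi_(Quotient.quot submod_pred) v.

Definition lquot_scale (a : K) (x : lquot) : lquot :=
  lquot_pi (a *: repr (x : (Quotient.quot submod_pred))).

Lemma lquot_piE x y : (lquot_pi x == lquot_pi y) = (x - y \in (W : {pred V})).
Proof. by rewrite /lquot_pi -Quotient.idealrBE. Qed.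

Lemma lquot_piK (x : lquot) : lquot_pi (repr (x : (Quotient.quot submod_pred))) = x.
Proof. exact: reprK. Qed.

Lemma lquot_piD : {morph lquot_pi : x y / x + y}.
Proof. by move=> x y; rewrite /lquot_pi pi_addr. Qed.

Lemma lquot_piZ a x : lquot_scale a (lquot_pi x) = lquot_pi (a *: x).
Proof.
apply/eqP; rewrite lquot_piE -scalerBr rpredZ // -lquot_piE.
by rewrite lquot_piK.
Qed.

Lemma lquot_scaleA a b v :
  lquot_scale a (lquot_scale b v) = lquot_scale (a * b) v.
Proof. by rewrite -[v]lquot_piK !lquot_piZ scalerA. Qed.

Lemma lquot_scale1 : left_id 1 lquot_scale.
Proof. by move=> v; rewrite -[v]lquot_piK lquot_piZ scale1r. Qed.

Lemma lquot_scaleDr : right_distributive lquot_scale +%R.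
Proof.
move=> a u v; rewrite -[u]lquot_piK -[v]lquot_piK.
by rewrite -lquot_piD !lquot_piZ scalerDr lquot_piD.
Qed.

Lemma lquot_scaleDl v : {morph lquot_scale^~ v : a b / a + b}.
Proof.
by move=> a b; rewrite -[v]lquot_piK !lquot_piZ scalerDl lquot_piD.
Qed.

HB.instance Definition _ := GRing.Zmodule_isLmodule.Build K lquot
  lquot_scaleA lquot_scale1 lquot_scaleDr lquot_scaleDl.

Lemma lquot_pi_linear : linear lquot_pi.
Proof. by move=> a u v; rewrite lquot_piD -lquot_piZ. Qed.

HB.instance Definition _ :=
  GRing.isLinear.Build K V lquot _ lquot_pi lquot_pi_linear.

End LinearQuotient.

Section Fans.
Context {R : realType} {V : lmodType R}.

Definition polyhedral_cone (s : set V) : Prop :=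
  exists g : seq V,
    s = [set x | exists2 mu : 'I_(size g) -> R, (forall i, 0 <= mu i) &
                 x = \sum_(i < size g) mu i *: g`_i].

Definition strictly_convex (s : set V) : Prop :=
  forall x, s x -> s (- x) -> x = 0.

Definition face (t s : set V) : Prop :=
  exists2 u : {scalar V}, (forall x, s x -> 0 <= u x) &
    t = s `&` [set x | u x = 0].

Definition is_fan (F : set (set V)) : Prop :=
  [/\ finite_set F,
      forall s, F s -> polyhedral_cone s /\ strictly_convex s,
      forall s t, F s -> face t s -> F t &
      forall s t, F s -> F t -> face (s `&` t) s /\ face (s `&` t) t].

Definition fan_support (F : set (set V)) : set V := \bigcup_(s in F) s.

Definition complete_fan (F : set (set V)) : Prop :=
  is_fan F /\ fan_support F = setT.

End Fans.

Definition simply_connected (R : realType) (T : topologicalType) : Prop :=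
  [/\ inhabited T,
      forall x y : T, exists p : R -> T,
        [/\ {within `[0, 1], continuous p}, p 0 = x & p 1 = y] &
      forall p : R -> T, {within `[0, 1], continuous p} -> p 0 = p 1 ->
        exists F : R * R -> T,
          [/\ {within `[0, 1] `*` `[0, 1], continuous F},
              forall t, t \in `[0, 1] -> F (t, 0) = p t,
              forall t, t \in `[0, 1] -> F (t, 1) = p 0 &
              forall s, s \in `[0, 1] -> F (0, s) = p 0 /\ F (1, s) = p 0]].

(* A complex manifold is given as a space X with, for each open D, the set
   O D of functions that are holomorphic on D (the values of a member of O D
   outside D are irrelevant). *)
Section AnalyticSubsets.
Context {R : realType}.

Definition holomorphic_on n (D : set 'rV[R[i]]_n) (g : 'rV[R[i]]_n -> R[i]) :
  Prop := forall z, D z -> differentiable g z.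

Context {X : topologicalType}.
Variable O : set X -> set (X -> R[i]).

(* phi restricts to an isomorphism, as ringed spaces, from D onto an open
   subset of C^n. *)
Definition holomorphic_chart n (D : set X) (phi : X -> 'rV[R[i]]_n) : Prop :=
  [/\ open D, set_inj D phi,
      forall W, W `<=` D -> (open W <-> open (phi @` W)) &
      forall W f, open W -> W `<=` D ->
        (O W f <-> exists2 g, holomorphic_on (phi @` W) g &
                              forall x, W x -> f x = g (phi x))].

Definition analytic_subset (A : set X) : Prop :=
  forall x, exists (D : set X) (k : nat) (f : 'I_k -> X -> R[i]),
    [/\ open D, D x, forall i, O D (f i) &
        forall y, D y -> (A y <-> forall i, f i y = 0)].

(* x is a point of A near which A is a complex submanifold of codimension k. *)
Definition regular_point (A : set X) (k : nat) (x : X) : Prop :=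
  A x /\ exists n (D : set X) (phi : X -> 'rV[R[i]]_n),
    [/\ holomorphic_chart D phi, D x, (k <= n)%N &
        forall y, D y -> (A y <-> forall i : 'I_n, (i < k)%N -> phi y 0 i = 0)].

(* The dimension of A at x is the upper limit of its dimensions at the regular
   points tending to x; the codimension is the corresponding lower limit. *)
Definition codim_at (A : set X) (x : X) (k : nat) : Prop :=
  (forall W, nbhs x W -> exists2 y, W y & regular_point A k y) /\
  (exists2 W, nbhs x W &
     forall y j, W y -> regular_point A j y -> (k <= j)%N).

(* Codimension one is required at every point: a union of a hypersurface with
   a set of smaller dimension does not count as a set of codimension one. *)
Definition analytic_subset_of_codim_one (A : set X) : Prop :=
  [/\ analytic_subset A, A !=set0 & forall x, A x -> codim_at A x 1].

End AnalyticSubsets.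

Section ComplexExponential.
Context {R : realType}.

Definition cexp (z : R[i]) : R[i] :=
  (expR (complex.Re z))%:C * (cos (complex.Im z) +i* sin (complex.Im z)).

Lemma cexp0 : cexp 0 = 1.
Proof. by rewrite /cexp /= expR0 cos0 sin0 mul1r. Qed.

Lemma cexpD z w : cexp (z + w) = cexp z * cexp w.
Proof.
case: z w => [a b] [c d]; rewrite /cexp /= expRD cosD sinD rmorphM /=.
rewrite mulrACA; congr (_ * _).
by apply/eqP; rewrite eq_complex /= eqxx addrC eqxx.
Qed.

Context {m : nat}.

(* The factor 2 pi i makes exp map R^m onto the compact torus, with kernel the
   lattice spanned by e_1, .., e_m, so that N^* is Z^m in the dual basis.
   Rescaling by a complex constant would not change exp h or p(h) for a complex
   subspace h. *)
Definition texp (z : 'rV[R[i]]_m) : 'rV[R[i]]_m :=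
  \row_j cexp ((0 +i* (2 * pi)) * z 0 j).

Definition torus_act (t z : 'rV[R[i]]_m) : 'rV[R[i]]_m :=
  \row_j (t 0 j * z 0 j).

Lemma torus_act0 z : torus_act (texp 0) z = z.
Proof. by apply/rowP => j; rewrite !mxE mulr0 cexp0 mul1r. Qed.

Lemma torus_actD x y z :
  torus_act (texp (x + y)) z = torus_act (texp x) (torus_act (texp y) z).
Proof. by apply/rowP => j; rewrite !mxE mulrDr cexpD mulrA. Qed.

End ComplexExponential.

Definition simplicial_complex (m : nat) (K : {set {set 'I_m}}) : Prop :=
  finset.set0 \in K /\
  forall I J : {set 'I_m}, I \in K -> J \subset I -> J \in K.

Section MomentAngle.
Context {R : realType} {m : nat}.
Variable K : {set {set 'I_m}}.
Variable h : {vspace 'rV[R[i]]_m}.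

Definition UK : set 'rV[R[i]]_m :=
  ~` \bigcup_(J in [set J : {set 'I_m} | J \notin K])
       [set z | forall j, j \in J -> z 0 j = 0].

Definition Hgroup : set 'rV[R[i]]_m := texp @` [set x | x \in h].

Definition coord_subtorus (I : {set 'I_m}) : set 'rV[R[i]]_m :=
  [set t | (forall j, t 0 j != 0) /\ forall j, j \notin I -> t 0 j = 1].

Definition meets_coord_subtori_trivially : Prop :=
  forall I : {set 'I_m}, I \in K ->
    Hgroup `&` coord_subtorus I = [set const_mx 1].

Definition real_part (z : 'rV[R[i]]_m) : 'rV[R]_m := map_mx (@complex.Re R) z.

Definition ph : {pred 'rV[R]_m} :=
  fun x => `[< exists2 z, z \in h & x = real_part z >].

Lemma ph_submod_closed : submod_closed ph.
Proof.
split=> [|a x y].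
  by apply/asboolP; exists 0; rewrite ?mem0v //; apply/rowP => j; rewrite !mxE.
move=> /asboolP[z zh ->] /asboolP[w wh ->]; apply/asboolP.
exists (a%:C *: z + w); first by rewrite rpredD // rpredZ.
apply/rowP => j; rewrite !mxE.
by case: (z 0 j) (w 0 j) => [b c] [d e] /=; rewrite mul0r subr0.
Qed.

HB.instance Definition _ :=
  GRing.isSubmodClosed.Build R 'rV[R]_m ph ph_submod_closed.

Definition SigmaK : set (set 'rV[R]_m) :=
  [set s | exists2 I : {set 'I_m}, I \in K &
     s = [set x | exists2 mu : 'I_m -> R, (forall i, 0 <= mu i) &
                  x = \sum_(i in I) mu i *: delta_mx 0 i]].

Definition quot_ph : 'rV[R]_m -> lquot ph := lquot_pi ph.

Definition maps_onto_complete_fan : Prop :=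
  complete_fan [set quot_ph @` s | s in SigmaK] /\
  set_bij (fan_support SigmaK) setT quot_ph.

Definition orbit_rel : rel UK :=
  fun u v => `[< exists2 t, Hgroup t & val v = torus_act t (val u) >].

Lemma orbit_rel_equiv : equiv_class_of orbit_rel.
Proof.
have actN x z : torus_act (texp (- x)) (torus_act (texp x) z) = z.
  by rewrite -torus_actD addNr torus_act0.
split=> [u|u v|v u w].
- apply/asboolP; exists (texp 0); last by rewrite torus_act0.
  by exists 0 => //=; exact: mem0v.
- by apply/asboolP/asboolP => -[_ [x xh <-] ->]; exists (texp (- x));
    rewrite ?actN //; exists (- x) => //=; rewrite memvN.
- move=> /asboolP[_ [x xh <-] uv] /asboolP[_ [y yh <-] vw].
  apply/asboolP; exists (texp (y + x)); last by rewrite torus_actD -uv.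
  by exists (y + x) => //=; exact: rpredD.
Qed.

Canonical orbit_equiv := EquivRelPack orbit_rel_equiv.

Definition UKH : topologicalType := quotient_topology {eq_quot orbit_equiv}.

Definition UKH_pi (u : UK) : UKH := \pi_{eq_quot orbit_equiv} u.

(* UK -> UKH is a holomorphic principal H-bundle, so that a function on an open
   subset D of UKH is holomorphic iff its pullback is. The preimage of D is open
   in C^m, so g is determined near each of its points. *)
Definition UKH_hol (D : set UKH) : set (UKH -> R[i]) :=
  [set f | exists g : 'rV[R[i]]_m -> R[i],
     forall u : UK, D (UKH_pi u) ->
       g (val u) = f (UKH_pi u) /\ differentiable g (val u)].

(* The character lattice N^* is Z^m inside the dual of R^m. *)
Definition no_character_vanishes : Prop :=
  forall u : 'rV[int]_m,
    (forall x, x \in ph -> \sum_(j < m) (u 0 j)%:~R * x 0 j = 0) -> u = 0.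

End MomentAngle.

(* Main.v *)
Require Import Defs.
From mathcomp Require Import all_boot all_order all_algebra.
From mathcomp Require Import generic_quotient complex.
From mathcomp Require Import all_classical all_reals all_analysis.
From mathcomp Require Import ring lra.

(* Let X be the H-invariant preimage in U(K) of an analytic set of codimension
   one. Condition (b) gives a vector in p(h) with positive coordinates, so some
   element of H contracts C^m to 0, and the coordinate loop around z_j = 0 being
   null-homotopic shows that every singleton lies in K, so U(K) contains all
   points with at most one zero coordinate.

   X does not meet (C^* )^m: fix b in (C^* )^m outside X. For small z off a proper
   analytic subset, the line z + C b avoids the points with two zero coordinates,
   and the product F(z) of the distinct s in a fixed disc with z + s b in X is
   holomorphic off a Hankel discriminant of power sums. It extends to a function
   holomorphic at 0, not identically zero, that vanishes on X. By (ii) one can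
   choose an element t of H, contracting, for which the lowest terms of the
   Taylor expansion of F along t^k a have distinct rates of decay, so F(t^k a) = 0
   for all large k is impossible when a has no zero coordinate.

   Hence X lies in the union of the coordinate hyperplanes. Near a hypersurface
   point X meets all lines in a given direction, so by a Baire argument X contains
   an open part of some hyperplane z_j = 0, and then, by the identity theorem along
   lines, all of it in U(K). So X is determined by a subset of [m]. *)

Set Implicit Arguments.
Unset Strict Implicit.
Unset Printing Implicit Defensive.
Import Order.TTheory GRing.Theory Num.Theory.
Import numFieldNormedType.Exports.
Local Open Scope classical_set_scope.
Local Open Scope ring_scope.

(** Locally X is only the common zero set of several functions, and the proof never asks for a
    single local equation at an arbitrary point. Projection along b supplies one: a line over a
    general z meets X in finitely many points of the disc, and the product of their parameters
    vanishes exactly when z itself is in X. A radius at most 1 bounds this product by 1, so it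
    extends across the bad set and even to 0, which need not lie in U(K). Multiplicities would be
    those of an auxiliary function and mean nothing for X, so distinct points are multiplied; their
    number jumps, which is why a discriminant enters. Codimension one is used as density of the
    points where X has one equation: there Hurwitz's theorem keeps X on neighbouring lines, so that
    a branch of zeros lies in X everywhere or nowhere.

    Two monomials decay at the same rate along a contraction exactly when the difference of their
    exponents, an integer vector, vanishes on the chosen vector of p(h). By (ii) no nonzero integer
    vector vanishes on all of p(h), so an arbitrarily small change of the vector separates finitely
    many exponents. *)

Section Modulus.
Variable R : realType.
Local Notation C := R[i].

(** The norm of [R[i]] takes values in [R[i]]; its real part brings all estimates into the ordered
    field [R], where [lra] works. *)
Definition cmod (z : C) : R := complex.Re `|z|.

Lemma cmodE z : `|z| = (cmod z)%:C%C.
Proof.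
rewrite /cmod; have := normr_ge0 z; case: (`|z|) => a b /ger0_Im /= ->; by [].
Qed.

Lemma cmod_ge0 z : 0 <= cmod z.
Proof. by rewrite -lecR -cmodE normr_ge0. Qed.

Lemma cmodD x y : cmod (x + y) <= cmod x + cmod y.
Proof. by rewrite -lecR rmorphD -!cmodE ler_normD. Qed.

Lemma cmodM x y : cmod (x * y) = cmod x * cmod y.
Proof. by apply: complexI; rewrite rmorphM -!cmodE normrM. Qed.

Lemma cmodN x : cmod (- x) = cmod x.
Proof. by rewrite /cmod normrN. Qed.

Lemma cmod_subC x y : cmod (x - y) = cmod (y - x).
Proof. by rewrite -cmodN opprB. Qed.

Lemma cmod0 : cmod 0 = 0.
Proof. by rewrite /cmod normr0. Qed.

Lemma cmod1 : cmod 1 = 1.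
Proof. by rewrite /cmod normr1. Qed.

Lemma cmod_eq0 x : (cmod x == 0) = (x == 0).
Proof. by rewrite -(inj_eq (@complexI R)) -cmodE normr_eq0. Qed.

Lemma cmod_gt0 x : (0 < cmod x) = (x != 0).
Proof. by rewrite lt_def cmod_ge0 andbT cmod_eq0. Qed.

Lemma cmodV x : cmod x^-1 = (cmod x)^-1.
Proof. by apply: complexI; rewrite fmorphV /= -!cmodE normfV. Qed.

Lemma cmodX x n : cmod (x ^+ n) = cmod x ^+ n.
Proof. by elim: n => [|n IH]; rewrite ?expr0 ?cmod1 // !exprS cmodM IH. Qed.

Lemma cmodC (x : R) : cmod x%:C%C = `|x|.
Proof. by apply: complexI; rewrite -cmodE normc_def /= expr0n /= addr0 sqrtr_sqr. Qed.

Lemma cmod_nat (n : nat) : cmod n%:R = n%:R.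
Proof. by rewrite -(rmorph_nat (real_complex R)) cmodC ger0_norm. Qed.

Lemma cmod_prod (I : Type) (s : seq I) (P : pred I) (F : I -> C) :
  cmod (\prod_(i <- s | P i) F i) = \prod_(i <- s | P i) cmod (F i).
Proof. exact: (big_morph _ cmodM cmod1). Qed.

Lemma cmod_sum (I : Type) (s : seq I) (P : pred I) (F : I -> C) :
  cmod (\sum_(i <- s | P i) F i) <= \sum_(i <- s | P i) cmod (F i).
Proof.
elim/big_ind2: _ => [|x x' y y' h h'|//]; first by rewrite cmod0.
by apply: (le_trans (cmodD _ _)); apply: lerD.
Qed.

Lemma cmod_triB x y z : cmod (x - z) <= cmod (x - y) + cmod (y - z).
Proof. by apply: le_trans (cmodD _ _); rewrite addrA subrK. Qed.

Lemma cmod_leB x y : cmod x - cmod y <= cmod (x - y).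
Proof. by rewrite lerBlDr; apply: le_trans (cmodD _ _); rewrite subrK. Qed.

Lemma normr_Re x : `|complex.Re x| <= cmod x.
Proof. by rewrite -lecR -cmodE; exact: normc_ge_Re. Qed.

Lemma normr_Im x : `|complex.Im x| <= cmod x.
Proof.
rewrite -(_ : complex.Re (- (x * 'i%C)) = complex.Im x).
  by apply: le_trans (normr_Re _) _; rewrite cmodN cmodM (_ : cmod 'i%C = 1) ?mulr1 //;
     apply: complexI; rewrite -cmodE normc_def /= expr0n add0r expr1n sqrtr1.
by case: x => a b /=; ring.
Qed.

Lemma cmod_le_ReIm x : cmod x <= `|complex.Re x| + `|complex.Im x|.
Proof.
rewrite {1}(complexE x); apply: le_trans (cmodD _ _) _.
rewrite cmodM !cmodC (_ : cmod 'i%C = 1) ?mul1r //.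
by apply: complexI; rewrite -cmodE normc_def /= expr0n add0r expr1n sqrtr1.
Qed.

Lemma cpos_real (e : C) : 0 < e -> exists2 d : R, 0 < d & e = d%:C%C.
Proof.
move=> e0; exists (complex.Re e).
  by move: e0; rewrite ltcE => /andP[_].
by apply/esym/RRe_real; rewrite ger0_real // ltW.
Qed.

Lemma nbhsCP (c : C) (U : set C) :
  nbhs c U <-> exists2 d : R, 0 < d & forall s, cmod (s - c) < d -> U s.
Proof.
split.
  move=> /nbhs_ballP[e /= /cpos_real[d d0 ->] H]; exists d => // s hs; apply: H.
  by rewrite /ball /= cmodE ltcR cmod_subC.
move=> [d d0 H]; apply/nbhs_ballP; exists d%:C%C => /=; first by rewrite ltcR.
by move=> s; rewrite /ball /= cmodE ltcR cmod_subC => /H.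
Qed.

Lemma cvgCP (T : Type) (F : set_system T) (FF : Filter F) (f : T -> C) (l : C) :
  f @ F --> l <-> forall e : R, 0 < e -> \forall x \near F, cmod (f x - l) < e.
Proof.
split=> [H e e0|H].
  by apply: (H [set y | cmod (y - l) < e]); apply/nbhsCP; exists e.
by move=> U /nbhsCP[d d0 HU]; apply: filterS (H _ d0) => x; apply: HU.
Qed.

Lemma contCP (T : topologicalType) (f : T -> C) (c : T) :
  {for c, continuous f} <->
  forall e : R, 0 < e -> \forall x \near c, cmod (f x - f c) < e.
Proof. exact: cvgCP. Qed.

Lemma cont1P (f : C -> C) (c : C) : {for c, continuous f} <->
  forall e : R, 0 < e -> exists2 d : R, 0 < d &
    forall s, cmod (s - c) < d -> cmod (f s - f c) < e.
Proof.
split=> [/contCP H e e0|H].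
  by have /nbhsCP := H _ e0.
by apply/contCP => e e0; apply/nbhsCP/H.
Qed.

(** The weak inequality admits s = c; conversely, e / 2 recovers the strict one. *)
Lemma diffCP (f : C -> C) (c : C) : differentiable f c <->
  exists l : C, forall e : R, 0 < e -> exists2 d : R, 0 < d &
    forall s, cmod (s - c) < d -> cmod (f s - f c - l * (s - c)) <= e * cmod (s - c).
Proof.
split.
  move=> /derivable1_diffP H; exists (derive f c 1) => e e0.
  have /cvgCP/(_ _ e0) := H.
  rewrite near_withinE => /nbhsCP[d d0 Hd]; exists d => // s hs.
  have [->|sc] := eqVneq s c; first by rewrite !subrr mulr0 subr0 cmod0 mulr0.
  have h0 : s - c != 0 by rewrite subr_eq0.
  have := Hd (s - c); rewrite subr0 => /(_ hs h0).
  rewrite /= scaler1 /= subrK.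
  rewrite /GRing.scale /= => h.
  have -> : f s - f c - 'D_1 f c * (s - c) =
     ((s - c)^-1 * (f s - f c) - 'D_1 f c) * (s - c).
    by rewrite mulrBl mulrAC mulVf // mul1r.
  by rewrite cmodM ler_wpM2r ?cmod_ge0 // ltW.
move=> [l H]; apply/derivable1_diffP; apply/cvg_ex; exists l.
apply/cvgCP => e e0.
have e20 : 0 < e / 2 by rewrite divr_gt0.
have [d d0 Hd] := H _ e20.
rewrite near_withinE; apply/nbhsCP; exists d => // s; rewrite subr0 => hs s0.
have := Hd (s + c); rewrite addrK => /(_ hs).
rewrite /= scaler1 /GRing.scale /= => h.
have -> : s^-1 * (f (s + c) - f c) - l = (f (s + c) - f c - l * s) * s^-1.
  by rewrite mulrBl mulfK // mulrC.
rewrite cmodM cmodV; apply: (@le_lt_trans _ _ (e / 2)).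
  by rewrite ler_pdivrMr ?cmod_gt0.
by rewrite ltr_pdivrMr // mulr_natr mulr2n ltrDl.
Qed.

Lemma cauchyC_cvg (u : nat -> C) :
  (forall e : R, 0 < e -> exists N, forall n, (N <= n)%N -> cmod (u n - u N) <= e) ->
  exists l : C, u n @[n --> \oo] --> l.
Proof.
move=> H.
have aux (g : C -> R) : (forall x y, `|g x - g y| <= cmod (x - y)) ->
    exists l : R, (g \o u) n @[n --> \oo] --> l.
  move=> hg; suff: cvg ((g \o u) n @[n --> \oo]) by move/cvg_ex.
  apply/cauchy_cvgP/cauchy_exP => e e0.
  have [N HN] := H _ (divr_gt0 e0 (ltr0Sn _ 1)).
  exists (g (u N)); exists N => // n /= Nn; rewrite /ball /=.
  rewrite distrC; apply: le_lt_trans (hg _ _) _; apply: le_lt_trans (HN _ Nn) _.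
  by rewrite ltr_pdivrMr // mulr_natr mulr2n ltrDl.
have [a Ha] : exists l : R, (@complex.Re R \o u) n @[n --> \oo] --> l.
  apply: aux => x y; rewrite (_ : _ - _ = complex.Re (x - y)) ?normr_Re //.
  by case: x => ? ?; case: y => ? ?.
have [b Hb] : exists l : R, (@complex.Im R \o u) n @[n --> \oo] --> l.
  apply: aux => x y; rewrite (_ : _ - _ = complex.Im (x - y)) ?normr_Im //.
  by case: x => ? ?; case: y => ? ?.
exists (Complex a b); apply/cvgCP => e e0.
have e20 : 0 < e / 2 by rewrite divr_gt0.
move/cvgrPdist_lt: Ha => /(_ _ e20) Ha; move/cvgrPdist_lt: Hb => /(_ _ e20) Hb.
near=> n; apply: le_lt_trans (cmod_le_ReIm _) _.
rewrite (splitr e); apply: ltrD.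
  have : `|a - (@complex.Re R \o u) n| < e / 2 by near: n.
  by rewrite distrC /=; case: (u n).
have : `|b - (@complex.Im R \o u) n| < e / 2 by near: n.
by rewrite distrC /=; case: (u n).
Unshelve. all: by end_near. Qed.

End Modulus.

(** * Integration over the unit interval *)

Section Bisect.
Variable R : realType.

(** If [P] failed on the unit square it would fail on a quarter, and so on; the nested failing
    squares shrink to a point, where the local hypothesis is violated. A square is given by its
    lower left corner and its side. This principle replaces compactness in many later arguments. *)
Lemma bisect2 (P : R -> R -> R -> Prop) :
  (forall x y l, 0 < l -> P x y (l / 2) -> P (x + l / 2) y (l / 2) ->
     P x (y + l / 2) (l / 2) -> P (x + l / 2) (y + l / 2) (l / 2) -> P x y l) ->
  (forall x0 y0, 0 <= x0 <= 1 -> 0 <= y0 <= 1 -> exists2 d, 0 < d &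
     forall x y l, 0 < l -> l < d -> x <= x0 <= x + l -> y <= y0 <= y + l ->
       0 <= x -> x + l <= 1 -> 0 <= y -> y + l <= 1 -> P x y l) ->
  P 0 0 1.
Proof.
move=> Hsub Hloc; apply: contrapT => nP.
(* The premises stand under the existential quantifier so that [nxt] is total and can be
   iterated. *)
have /choice[nxt Hnxt] : forall q : R * R * R, exists q' : R * R * R,
    0 < q.2 -> ~ P q.1.1 q.1.2 q.2 ->
    [/\ q'.2 = q.2 / 2, ~ P q'.1.1 q'.1.2 q'.2,
        q.1.1 <= q'.1.1 <= q.1.1 + q.2 / 2 & q.1.2 <= q'.1.2 <= q.1.2 + q.2 / 2].
  move=> [[x y] l] /=; apply: contrapT => H; apply: (H).
  exists (0, 0, 0) => l0 nPl; exfalso; apply: nPl.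
  have l20 : 0 <= l / 2 by rewrite divr_ge0 // ltW.
  by apply: Hsub => //; apply: contrapT => nPl; apply: H;
    [exists (x, y, l / 2)|exists (x + l / 2, y, l / 2)
    |exists (x, y + l / 2, l / 2)|exists (x + l / 2, y + l / 2, l / 2)];
    move=> _ _; split => //=; rewrite ?lexx ?lerDl ?l20.
pose u n := iter n nxt (0, 0, 1).
have u2 n : (u n).2 = 2^-1 ^+ n /\ ~ P (u n).1.1 (u n).1.2 (u n).2.
  elim: n => [|n [IH1 IH2]]; first by rewrite /= expr0.
  have l0 : 0 < (u n).2 by rewrite IH1 exprn_gt0 // invr_gt0.
  have [h1 h2 _ _] := Hnxt _ l0 IH2.
  by split=> //; rewrite /u iterS -/(u n) h1 IH1 exprSr.
have up n : 0 < (u n).2 by rewrite (u2 n).1 exprn_gt0 // invr_gt0.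
have ustep n : [/\ (u n.+1).2 = (u n).2 / 2,
    (u n).1.1 <= (u n.+1).1.1 <= (u n).1.1 + (u n).2 / 2 &
    (u n).1.2 <= (u n.+1).1.2 <= (u n).1.2 + (u n).2 / 2].
  by have [? ? ? ?] := Hnxt _ (up n) (u2 n).2.
(* Both coordinates behave alike: the lower end increases, the upper end decreases, and the supremum
   of the lower ends lies in all the intervals. *)
have mono (g : R * R * R -> R) :
    (forall n, g (u n) <= g (u n.+1) <= g (u n) + (u n).2 / 2) -> g (u 0) = 0 ->
    exists x0, [/\ 0 <= x0 <= 1, forall n, g (u n) <= x0 <= g (u n) + (u n).2,
       forall n, 0 <= g (u n) & forall n, g (u n) + (u n).2 <= 1].
  move=> Hg g0.
  have inc : {homo (fun n => g (u n)) : n k / (n <= k)%N >-> n <= k}.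
    by apply: homo_leq => [//|y x z|n]; [exact: le_trans|have /andP[] := Hg n].
  have dec : {homo (fun n => - (g (u n) + (u n).2)) : n k / (n <= k)%N >-> n <= k}.
    apply: homo_leq => [//|y x z|n]; first exact: le_trans.
    have /andP[_ h] := Hg n; have [-> _ _] := ustep n.
    by rewrite lerN2; move: h; lra.
  have cross n k : g (u n) <= g (u k) + (u k).2.
    have [nk|/ltnW kn] := leqP n k.
      by apply: le_trans (inc _ _ nk) _; rewrite lerDl ltW.
    by have := dec _ _ kn; rewrite lerN2; apply: le_trans; rewrite lerDl ltW.
  have hsup : has_sup (range (fun n => g (u n))).
    split; first by exists (g (u 0)); exists 0%N.
    by exists (g (u 0) + (u 0).2) => _ [n _ <-].
  exists (sup (range (fun n => g (u n)))).
  have h n : g (u n) <= sup (range (fun n => g (u n))) <= g (u n) + (u n).2.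
    apply/andP; split.
      by apply: ub_le_sup; [exact: hsup.2|exists n].
    by apply: ge_sup; [exact: hsup.1|move=> _ [k _ <-]].
  split=> // [|n|n].
  - by have := h 0%N; rewrite g0 add0r.
  - by rewrite -g0; apply: inc.
  - by have := dec _ _ (leq0n n); rewrite lerN2 g0 add0r.
have [x0 [x01 hx hx1 hx2]] : exists x0, [/\ 0 <= x0 <= 1,
    forall n, (u n).1.1 <= x0 <= (u n).1.1 + (u n).2,
    forall n, 0 <= (u n).1.1 & forall n, (u n).1.1 + (u n).2 <= 1].
  by apply: (mono (fun q => q.1.1)) => // n; have [] := ustep n.
have [y0 [y01 hy hy1 hy2]] : exists x0, [/\ 0 <= x0 <= 1,
    forall n, (u n).1.2 <= x0 <= (u n).1.2 + (u n).2,
    forall n, 0 <= (u n).1.2 & forall n, (u n).1.2 + (u n).2 <= 1].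
  by apply: (mono (fun q => q.1.2)) => // n; have [] := ustep n.
have [d d0 Hd] := Hloc x0 y0 x01 y01.
have [n hn] : exists n, (2^-1 : R) ^+ n < d.
  have : (2^-1 : R) ^+ n @[n --> \oo] --> (0 : R).
    by apply: cvg_expr; rewrite ger0_norm ?invr_ge0 // invf_lt1 // ltr1n.
  move/cvgrPdist_lt => /(_ d d0)[N _ HN]; exists N.
  by have := HN N (leqnn N); rewrite /= sub0r normrN ger0_norm // exprn_ge0 // invr_ge0.
have [_] := u2 n; apply; apply: Hd => //.
by rewrite (u2 n).1.
Qed.

(** The square version with the second coordinate ignored; transitivity joins the two halves. *)
Lemma bisect1 (P : R -> R -> Prop) :
  (forall x y z, P x y -> P y z -> P x z) ->
  (forall x0, 0 <= x0 <= 1 -> exists2 d, 0 < d &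
     forall x y, x < y -> y - x < d -> x <= x0 <= y -> 0 <= x -> y <= 1 -> P x y) ->
  P 0 1.
Proof.
move=> Htr Hloc.
suff : P 0 (0 + 1) by rewrite add0r.
apply: (@bisect2 (fun x (_ : R) l => P x (x + l))) => [x y l l0 h1 h2 _ _|x0 y0 x01 _].
  apply: Htr h1 _; rewrite (_ : x + l = x + l / 2 + l / 2) //.
  by rewrite -addrA -splitr.
have [d d0 Hd] := Hloc _ x01; exists d => // x y l l0 ld hx _ x0' x1 _ _.
by apply: Hd => //; rewrite ?ltrDl // addrAC subrr add0r.
Qed.

End Bisect.

Section Average.
Variable R : realType.
Local Notation C := R[i].
Implicit Types g h : R -> C.

(* The integral of g over [0, 1] as a limit of dyadic sums. *)
Fixpoint An n g : C :=
  if n is n'.+1 then (An n' (fun t => g (t / 2)) + An n' (fun t => g ((1 + t) / 2))) / 2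
  else g 0.

Definition avg g : C := lim (An n g @[n --> \oo]).

(** Continuity is two-sided even at 0 and 1, which suits integrands given by formulas on all of
    [R]. *)
Record icont g : Prop := Icont
  { icontP : forall t : R, 0 <= t <= 1 -> {for t, continuous g} }.

Lemma half01 (t : R) : 0 <= t <= 1 -> 0 <= t / 2 <= 1.
Proof. by move=> /andP[? ?]; apply/andP; split; lra. Qed.

Lemma half11 (t : R) : 0 <= t <= 1 -> 0 <= (1 + t) / 2 <= 1.
Proof. by move=> /andP[? ?]; apply/andP; split; lra. Qed.

Lemma An_bound n g (M : R) :
  (forall t, 0 <= t <= 1 -> cmod (g t) <= M) -> cmod (An n g) <= M.
Proof.
elim: n g => [|n IH] g H /=; first by apply: H; rewrite lexx ler01.
have h1 := IH (fun t => g (t / 2)) (fun t ht => H _ (half01 ht)).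
have h2 := IH (fun t => g ((1 + t) / 2)) (fun t ht => H _ (half11 ht)).
rewrite cmodM cmodV cmod_nat ler_pdivrMr //.
by apply: le_trans (cmodD _ _) _; rewrite mulr_natr mulr2n lerD.
Qed.

Lemma AnB n g h : An n (fun t => g t - h t) = An n g - An n h.
Proof. by elim: n g h => [//|n IH] g h /=; rewrite !IH -mulrBl opprD addrACA. Qed.

Lemma AnZ n (c : C) g : An n (fun t => c * g t) = c * An n g.
Proof. by elim: n g => [//|n IH] g /=; rewrite !IH -mulrDr mulrA. Qed.

Lemma An_cst n (c : C) : An n (fun=> c) = c.
Proof. by elim: n => [//|n IH] /=; rewrite IH -mulr2n -(mulr_natr c) mulfK // pnatr_eq0. Qed.

(** Refining j more times replaces the value at the left end of each dyadic interval of length 2^-n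
    by a mean of values on that same interval. *)
Lemma An_close n j g (e : R) :
  (forall t t', 0 <= t <= 1 -> 0 <= t' <= 1 -> `|t - t'| <= 2^-1 ^+ n ->
     cmod (g t - g t') <= e) ->
  cmod (An (n + j) g - An n g) <= e.
Proof.
elim: n g => [|n IH] g H.
  rewrite add0n -{2}[g]/g -(An_cst j (An 0 g)) -AnB; apply: An_bound => t ht /=.
  by apply: H => //; rewrite ?lexx ?ler01 // expr0; rewrite subr0; case/andP: ht => h1 h2;
      rewrite ger0_norm.
(* The cases a = 0 and a = 1 are the two halves of the interval. *)
have aux (a : R) : 0 <= a <= 1 ->
    cmod (An (n + j) (fun t => g ((a + t) / 2)) - An n (fun t => g ((a + t) / 2))) <= e.
  move=> ha; apply: IH => t t' ht ht' htt.
  have hh x : 0 <= x <= 1 -> 0 <= (a + x) / 2 <= 1.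
    by move: ha => /andP[? ?] /andP[? ?]; apply/andP; split; lra.
  apply: H; [exact: hh|exact: hh|].
  rewrite -mulrBl normrM (ger0_norm (x := 2^-1)) ?invr_ge0 // exprSr ler_wpM2r ?invr_ge0 //.
  by rewrite (_ : a + t - _ = t - t') //; lra.
have h0 := aux 0; have h1 := aux 1.
rewrite addSn /=.
rewrite -mulrBl cmodM cmodV cmod_nat ler_pdivrMr // opprD addrACA.
apply: le_trans (cmodD _ _) _; rewrite mulr_natr mulr2n; apply: lerD; last first.
  by apply: h1; rewrite ler01 lexx.
have {}h0 := h0 (introT andP (conj (lexx _) ler01)).
have E k : An k (fun t => g ((0 + t) / 2)) = An k (fun t => g (t / 2)).
  by congr An; apply/funext => t; rewrite add0r.
by rewrite !E in h0.
Qed.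

Lemma icont_unif g : icont g -> forall e : R, 0 < e -> exists2 d : R, 0 < d &
  forall t t', 0 <= t <= 1 -> 0 <= t' <= 1 -> `|t - t'| <= d -> cmod (g t - g t') <= e.
Proof.
move=> cg e e0.
have K : near_covering (`[0, 1] : set R).
  by apply/compact_near_coveringP; exact: segment_compact.
(* Compactness in near-covering form: a condition valid near each t for small positive d is valid
   for all t with one d. *)
have := K R^o (0^'+) (fun d t => forall t', `|t - t'| <= d -> cmod (g t - g t') <= e) _.
case => [t|d0 /= d0p H].
  rewrite /= in_itv /= => ht.
  have /contCP/(_ (e / 2)) := icontP cg ht; rewrite divr_gt0 // => /(_ isT).
  move=> /nbhs_ballP[r /= r0 Hr].
  exists ([set t' | `|t - t'| < r / 2], [set d | d < r / 2]) => /=.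
    split; first by exists (r / 2) => //=; rewrite divr_gt0.
    exists (r / 2) => /=; first by rewrite divr_gt0.
    by move=> d /=; rewrite sub0r normrN => h _; apply: le_lt_trans (ler_norm _) h.
  move=> [t1 d] /= [ht1 hd] t' ht'.
  apply: le_trans (cmod_triB _ (g t) _) _; rewrite (splitr e); apply: lerD.
    by apply/ltW/Hr; apply: lt_trans ht1 _; rewrite ltr_pdivrMr // mulr_natr mulr2n ltrDl.
  rewrite cmod_subC; apply/ltW/Hr; rewrite /ball /=.
  apply: le_lt_trans (ler_distD t1 _ _) _; rewrite (splitr r); apply: ltrD => //.
  by apply: le_lt_trans ht' _.
have h : 0 < d0 / 2 by rewrite divr_gt0.
exists (d0 / 2) => // t t' ht ht' htt; apply: (H (d0 / 2)) => //=.
  by rewrite sub0r normrN gtr0_norm // ltr_pdivrMr // mulr_natr mulr2n ltrDl.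
Qed.

Lemma avg_cvg g : icont g -> An n g @[n --> \oo] --> avg g.
Proof.
move=> cg; rewrite /avg.
suff [l hl] : exists l : C, An n g @[n --> \oo] --> l.
  by rewrite (cvg_lim _ hl) //; exact: norm_hausdorff.
apply: cauchyC_cvg => e e0; have [d d0 Hd] := icont_unif cg e0.
have [n hn] : exists n, (2^-1 : R) ^+ n < d.
  have : (2^-1 : R) ^+ n @[n --> \oo] --> (0 : R).
    by apply: cvg_expr; rewrite ger0_norm ?invr_ge0 // invf_lt1 // ltr1n.
  move/cvgrPdist_lt => /(_ d d0)[N _ HN]; exists N.
  by have := HN N (leqnn N); rewrite /= sub0r normrN ger0_norm // exprn_ge0 // invr_ge0.
exists n => k nk; rewrite -(subnKC nk); apply: An_close => t t' ht ht' h.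
by apply: Hd => //; apply: le_trans h (ltW hn).
Qed.

Lemma avg_unique g (l : C) : An n g @[n --> \oo] --> l -> avg g = l.
Proof. by move=> h; apply: cvg_lim => //; exact: norm_hausdorff. Qed.

Lemma avg_cst (c : C) : avg (fun=> c) = c.
Proof.
by apply: avg_unique; under eq_fun do rewrite An_cst; exact: cvg_cst.
Qed.

Lemma avgZ (c : C) g : icont g -> avg (fun t => c * g t) = c * avg g.
Proof.
move=> cg; apply: avg_unique; under eq_fun do rewrite AnZ.
by apply: cvgM (avg_cvg cg); exact: cvg_cst.
Qed.

Lemma avgB g h : icont g -> icont h -> avg (fun t => g t - h t) = avg g - avg h.
Proof.
move=> cg ch; apply: avg_unique; under eq_fun do rewrite AnB.
by apply: cvgB; exact: avg_cvg.
Qed.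

Lemma icontD g h : icont g -> icont h -> icont (fun t => g t + h t).
Proof. by move=> [cg] [ch]; split=> t ht; apply: cvgD; [exact: cg|exact: ch]. Qed.

Lemma icontB g h : icont g -> icont h -> icont (fun t => g t - h t).
Proof. by move=> [cg] [ch]; split=> t ht; apply: cvgB; [exact: cg|exact: ch]. Qed.

Lemma icontM g h : icont g -> icont h -> icont (fun t => g t * h t).
Proof. by move=> [cg] [ch]; split=> t ht; apply: cvgM; [exact: cg|exact: ch]. Qed.

Lemma icont_cst (c : C) : icont (fun=> c).
Proof. by split=> t _; exact: cvg_cst. Qed.

Lemma avgD g h : icont g -> icont h -> avg (fun t => g t + h t) = avg g + avg h.
Proof.
move=> cg ch; apply: avg_unique.
have E n : An n (fun t => g t + h t) = An n g + An n h.
  by elim: n g h {cg ch} => [//|n IH] g h /=; rewrite !IH -mulrDl addrACA.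
by under eq_fun do rewrite E; apply: cvgD; exact: avg_cvg.
Qed.

Lemma avg_bound g (M : R) : icont g ->
  (forall t, 0 <= t <= 1 -> cmod (g t) <= M) -> cmod (avg g) <= M.
Proof.
move=> cg H; apply/ler_addgt0Pl => e e0.
have /cvgCP/(_ e e0) [N _ HN] := avg_cvg cg.
have {}HN := HN N (leqnn N); rewrite /= in HN.
rewrite -[avg g](subrK (An N g)); apply: le_trans (cmodD _ _) _.
by rewrite cmod_subC; apply: lerD; [exact: ltW|exact: An_bound].
Qed.

Lemma eq_avg g h : (forall t, 0 <= t <= 1 -> g t = h t) -> avg g = avg h.
Proof.
move=> H; suff E n : An n g = An n h by rewrite /avg (funext E).
elim: n g h H => [|n IH] g h H /=; first by apply: H; rewrite lexx ler01.
rewrite (IH _ (fun t => h (t / 2))); last by move=> t ht; apply/H/half01.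
by rewrite (IH (fun t => g ((1 + t) / 2)) (fun t => h ((1 + t) / 2))) // => t ht; apply/H/half11.
Qed.

Lemma icont_comp g (a : R -> R) : continuous a ->
  (forall t, 0 <= t <= 1 -> 0 <= a t <= 1) -> icont g -> icont (g \o a).
Proof.
move=> ca ha [cg]; split=> t ht.
by apply: (@continuous_comp _ _ _ a g t); [exact: ca|apply/cg/ha].
Qed.

(** The recursion of [An] passed to the limit; it makes contour integrals additive under
    quartering. *)
Lemma avg_half g : icont g ->
  avg g = (avg (fun t => g (t / 2)) + avg (fun t => g ((1 + t) / 2))) / 2.
Proof.
move=> cg; apply: avg_unique.
rewrite -(cvg_shiftS (fun n => An n g)) /=.
apply: cvgM; last exact: cvg_cst.
apply: cvgD; apply: avg_cvg.
  apply: (icont_comp (a := fun t => t / 2)) cg; last by move=> t /half01.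
  by move=> t; apply: cvgM; [exact: cvg_id|exact: cvg_cst].
apply: (icont_comp (a := fun t => (1 + t) / 2)) cg; last by move=> t /half11.
move=> t; apply: cvgM; last exact: cvg_cst.
by apply: cvgD; [exact: cvg_cst|exact: cvg_id].
Qed.

End Average.

(** * Goursat's theorem and holomorphic functions of one variable *)

Section Goursat.
Variable R : realType.
Local Notation C := R[i].
Local Notation "x %:C" := (real_complex R x) : ring_scope.
Implicit Types x y l e d t : R.

Variables (G : R -> R -> C) (p q : C).
(** [G] is complex differentiable, with derivative k, as a function of the single complex variable p
    x + q y. *)
Hypothesis Gdiff : forall x0 y0, 0 <= x0 <= 1 -> 0 <= y0 <= 1 -> exists k : C,
  forall e, 0 < e -> exists2 d, 0 < d & forall x y, `|x - x0| < d -> `|y - y0| < d ->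
    cmod (G x y - G x0 y0 - k * (p * (x - x0)%:C + q * (y - y0)%:C))
      <= e * (`|x - x0| + `|y - y0|).

Let Gcont x0 y0 : 0 <= x0 <= 1 -> 0 <= y0 <= 1 -> forall e, 0 < e ->
  exists2 d, 0 < d & forall x y, `|x - x0| < d -> `|y - y0| < d -> cmod (G x y - G x0 y0) < e.
Proof.
move=> hx hy e e0; have [k Hk] := Gdiff hx hy.
have [d d0 Hd] := Hk 1 ltr01.
pose K := 2 + cmod k * (cmod p + cmod q).
have K0 : 0 < K.
  by rewrite /K ltr_wpDr // mulr_ge0 ?addr_ge0 ?cmod_ge0.
exists (Num.min d (e / K)) => [|x y]; first by rewrite lt_min d0 divr_gt0.
rewrite !lt_min => /andP[hx1 hx2] /andP[hy1 hy2].
have := Hd _ _ hx1 hy1; set u := k * _ => h.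
rewrite -[G x y - G x0 y0](subrK u); apply: le_lt_trans (cmodD _ _) _.
have hu : cmod u <= cmod k * (cmod p * `|x - x0| + cmod q * `|y - y0|).
  rewrite /u cmodM ler_wpM2l ?cmod_ge0 //; apply: le_trans (cmodD _ _) _.
  by rewrite !cmodM !cmodC.
apply: (@lt_le_trans _ _ (K * (e / K))); last by rewrite mulrCA divff ?gt_eqF // mulr1.
apply: (@le_lt_trans _ _ (1 * (`|x - x0| + `|y - y0|) + cmod k * (cmod p * `|x - x0| + cmod q * `|y - y0|))).
  exact: lerD.
rewrite /K mulrDl; apply: ltr_leD.
  by rewrite mul1r mulr_natl mulr2n ltrD.
rewrite -mulrA ler_wpM2l ?cmod_ge0 // mulrDl.
by apply: lerD; rewrite ler_wpM2l ?cmod_ge0 // ltW.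
Qed.

Let Gx x l y : 0 <= x -> x + l <= 1 -> 0 <= l -> 0 <= y <= 1 ->
  icont (fun t => G (x + l * t) y).
Proof.
move=> x0 xl l0 hy; split=> t /andP[t0 t1]; apply/contCP => e e0.
have hx : 0 <= x + l * t <= 1.
  rewrite addr_ge0 ?mulr_ge0 //=; apply: le_trans xl; rewrite lerD2l.
  by rewrite -[leRHS]mulr1 ler_wpM2l.
have [d d0 Hd] := Gcont hx hy e0.
have c : {for t, continuous (fun t => x + l * t)}.
  by apply: cvgD; [exact: cvg_cst|apply: cvgM; [exact: cvg_cst|exact: cvg_id]].
have /cvgrPdist_lt/(_ _ d0) := c; apply: filterS => s hs.
by apply: Hd; rewrite ?subrr ?normr0 // distrC.
Qed.

Let Gy x l y : 0 <= y -> y + l <= 1 -> 0 <= l -> 0 <= x <= 1 ->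
  icont (fun t => G x (y + l * t)).
Proof.
move=> x0 xl l0 hy; split=> t /andP[t0 t1]; apply/contCP => e e0.
have hx : 0 <= y + l * t <= 1.
  rewrite addr_ge0 ?mulr_ge0 //=; apply: le_trans xl; rewrite lerD2l.
  by rewrite -[leRHS]mulr1 ler_wpM2l.
have [d d0 Hd] := Gcont hy hx e0.
have c : {for t, continuous (fun t => y + l * t)}.
  by apply: cvgD; [exact: cvg_cst|apply: cvgM; [exact: cvg_cst|exact: cvg_id]].
have /cvgrPdist_lt/(_ _ d0) := c; apply: filterS => s hs.
by apply: Hd; rewrite ?subrr ?normr0 // distrC.
Qed.

Let H x l y := avg (fun t => G (x + l * t) y).
Let V y l x := avg (fun t => G x (y + l * t)).
(** The integral of G d(p x + q y) counterclockwise around the square; [H] and [V] are the means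
    over horizontal and vertical sides. *)
Let D x y l := l%:C * (p * (H x l y - H x l (y + l)) + q * (V y l (x + l) - V y l x)).

Let Hhalf x l y : 0 <= x -> x + l <= 1 -> 0 <= l -> 0 <= y <= 1 ->
  H x l y = (H x (l / 2) y + H (x + l / 2) (l / 2) y) / 2.
Proof.
move=> x0 xl l0 hy; rewrite /H avg_half; last exact: Gx.
congr ((_ + _) / _); congr avg; apply/funext => t; congr G.
  by rewrite mulrA mulrAC.
by rewrite -addrA; congr (_ + _); ring.
Qed.

Let Vhalf y l x : 0 <= y -> y + l <= 1 -> 0 <= l -> 0 <= x <= 1 ->
  V y l x = (V y (l / 2) x + V (y + l / 2) (l / 2) x) / 2.
Proof.
move=> x0 xl l0 hy; rewrite /V avg_half; last exact: Gy.
congr ((_ + _) / _); congr avg; apply/funext => t; congr G.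
  by rewrite mulrA mulrAC.
by rewrite -addrA; congr (_ + _); ring.
Qed.

Let Dsub x y l : 0 <= x -> x + l <= 1 -> 0 <= y -> y + l <= 1 -> 0 <= l ->
  D x y l = D x y (l / 2) + D (x + l / 2) y (l / 2) +
            (D x (y + l / 2) (l / 2) + D (x + l / 2) (y + l / 2) (l / 2)).
Proof.
move=> x0 xl y0 yl l0; rewrite /D.
rewrite (Hhalf x0 xl l0 (y := y)); last by apply/andP; split; lra.
rewrite (Hhalf x0 xl l0 (y := y + l)); last by apply/andP; split; lra.
rewrite (Vhalf y0 yl l0 (x := x)); last by apply/andP; split; lra.
rewrite (Vhalf y0 yl l0 (x := x + l)); last by apply/andP; split; lra.
have E z : z + l / 2 + l / 2 = z + l by rewrite -addrA -splitr.
rewrite !E.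
rewrite (_ : (l / 2)%:C = l%:C / 2); last by rewrite rmorphM fmorphV rmorph_nat.
by field.
Qed.

(** The bound e l^2 on the contour integral is stable under quartering, since four bounds e (l /
    2)^2 add up to it, and on small squares it follows from the linear approximation. Bisection
    gives the bound e on the unit square for every e. *)
Lemma goursat : p * (avg (fun x => G x 0) - avg (fun x => G x 1)) +
  q * (avg (fun y => G 1 y) - avg (fun y => G 0 y)) = 0.
Proof.
have -> : p * (avg (fun x => G x 0) - avg (fun x => G x 1)) +
  q * (avg (fun y => G 1 y) - avg (fun y => G 0 y)) = D 0 0 1.
  rewrite /D rmorph1 mul1r add0r.
  by congr (p * (_ - _) + q * (_ - _)); congr avg; apply/funext => t; rewrite add0r mul1r.
apply/eqP; rewrite -cmod_eq0 eq_le cmod_ge0 andbT.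
apply/ler_addgt0Pl => e e0; rewrite addr0.
pose P x y l := 0 <= x -> x + l <= 1 -> 0 <= y -> y + l <= 1 ->
         0 < l -> cmod (D x y l) <= e * l ^+ 2.
suff : P 0 0 1.
  by rewrite /P expr1n mulr1 add0r; apply; rewrite ?lexx ?ler01 ?ltr01.
apply: (@bisect2 _ P) => [x y l l0 h1 h2 h3 h4 x0 xl y0 yl _|x0 y0 hx0 hy0].
  have l2 : 0 < l / 2 by rewrite divr_gt0.
  rewrite Dsub ?(ltW l0) //.
  rewrite (_ : e * l ^+ 2 = (e * (l / 2) ^+ 2 + e * (l / 2) ^+ 2) +
     (e * (l / 2) ^+ 2 + e * (l / 2) ^+ 2)); last by field.
  apply: le_trans (cmodD _ _) _; apply: lerD; apply: le_trans (cmodD _ _) _; apply: lerD.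
  - by apply: h1 => //; lra.
  - by apply: h2 => //; lra.
  - by apply: h3 => //; lra.
  - by apply: h4 => //; lra.
have [k Hk] := Gdiff hx0 hy0.
(* A point of the square is within l of (x0, y0) in each coordinate, so a pair of opposite sides
   contributes an error of at most e1 times 4 l; the summand 1 keeps [K] positive. *)
pose K := 4 * (cmod p + cmod q + 1).
have K0 : 0 < K by rewrite /K mulr_gt0 // ltr_wpDl // addr_ge0 ?cmod_ge0.
have [d d0 Hd] := Hk (e / K) (divr_gt0 e0 K0).
exists d => // x y l l0 ld /andP[xx0 x0x] /andP[yy0 y0y] x0' xl y0' yl _ _ _ _ _.
set e1 := e / K in Hd; have e1p : 0 < e1 by rewrite /e1 divr_gt0.
have err x' y' : x <= x' <= x + l -> y <= y' <= y + l ->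
   cmod (G x' y' - G x0 y0 - k * (p * (x' - x0)%:C + q * (y' - y0)%:C)) <= e1 * (2 * l).
  move=> /andP[hx1 hx2] /andP[hy1 hy2].
  have ax : `|x' - x0| <= l by rewrite ler_norml; apply/andP; split; lra.
  have ay : `|y' - y0| <= l by rewrite ler_norml; apply/andP; split; lra.
  apply: le_trans (Hd _ _ (le_lt_trans ax ld) (le_lt_trans ay ld)) _.
  by rewrite ler_wpM2l ?(ltW e1p) // mulr_natl mulr2n lerD.
have seg a t : 0 <= t <= 1 -> a <= a + l * t <= a + l.
  move=> /andP[t0 t1]; rewrite lerDl lerD2l mulr_ge0 ?(ltW l0) //=.
  by rewrite -[leRHS]mulr1 ler_wpM2l // ltW.
(* Opposite sides are compared point by point; their linear parts differ by the constants k q l and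
   k p l, which cancel in [D]. *)
have hh : cmod (H x l y - H x l (y + l) + k * q * l%:C) <= e1 * (4 * l).
  have i1 : icont (fun t => G (x + l * t) y) by apply: Gx => //; [exact: ltW|apply/andP; split;
      lra].
  have i2 : icont (fun t => G (x + l * t) (y + l)) by apply: Gx => //; [exact: ltW|apply/andP;
      split; lra].
  rewrite -[k * q * l%:C]opprK -[X in _ - _ - X]avg_cst -avgB // -avgB;
      [|exact: icontB|exact: icont_cst].
  apply: avg_bound => [|t ht].
    by apply: icontB; [exact: icontB|exact: icont_cst].
  have := err (x + l * t) y (seg _ _ ht); rewrite lexx lerDl (ltW l0) => /(_ isT) hb.
  have := err (x + l * t) (y + l) (seg _ _ ht); rewrite lexx lerDl (ltW l0) => /(_ isT) ha.
  have hab := lerD hb ha; apply: (@le_trans _ _ (e1 * (2 * l) + e1 * (2 * l))); last by lra.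
  apply: le_trans hab; rewrite -[X in _ <= _ + X]cmodN; apply: le_trans (cmodD _ _).
  by rewrite le_eqVlt; apply/orP; left; apply/eqP; congr cmod; rewrite !rmorphB rmorphD /=; ring.
have vv : cmod (V y l (x + l) - V y l x - k * p * l%:C) <= e1 * (4 * l).
  have i1 : icont (fun t => G (x + l) (y + l * t)) by apply: Gy => //; [exact: ltW|apply/andP;
      split; lra].
  have i2 : icont (fun t => G x (y + l * t)) by apply: Gy => //; [exact: ltW|apply/andP; split;
      lra].
  rewrite -[X in _ - _ - X]avg_cst -avgB // -avgB; [|exact: icontB|exact: icont_cst].
  apply: avg_bound => [|t ht].
    by apply: icontB; [exact: icontB|exact: icont_cst].
  have := err x (y + l * t); rewrite lexx lerDl (ltW l0) => /(_ isT (seg _ _ ht)) hb.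
  have := err (x + l) (y + l * t); rewrite lexx lerDl (ltW l0) => /(_ isT (seg _ _ ht)) ha.
  have hab := lerD ha hb; apply: (@le_trans _ _ (e1 * (2 * l) + e1 * (2 * l))); last by lra.
  apply: le_trans hab; rewrite -[X in _ <= _ + X]cmodN; apply: le_trans (cmodD _ _).
  by rewrite le_eqVlt; apply/orP; left; apply/eqP; congr cmod; rewrite !rmorphB rmorphD /=; ring.
rewrite /D (_ : p * _ + q * _ = p * (H x l y - H x l (y + l) + k * q * l%:C) +
   q * (V y l (x + l) - V y l x - k * p * l%:C)); last by ring.
rewrite cmodM cmodC gtr0_norm // expr2 mulrCA ler_wpM2l ?(ltW l0) //.
apply: le_trans (cmodD _ _) _; rewrite !cmodM.
apply: (@le_trans _ _ ((cmod p + cmod q + 1) * (e1 * (4 * l)))).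
  have e4 : 0 <= e1 * (4 * l) by apply: mulr_ge0; [exact: ltW|apply: mulr_ge0; [|exact: ltW]].
  rewrite mulrDl mul1r; apply: ler_wpDr => //.
  by rewrite mulrDl; apply: lerD; rewrite ler_wpM2l ?cmod_ge0.
rewrite /e1 (_ : (cmod p + cmod q + 1) * (e / K * (4 * l)) = e * l * ((4 * (cmod p + cmod q + 1)) / K)); last by ring.
by rewrite divff ?gt_eqF // mulr1.
Qed.

End Goursat.

Section Annulus.
Variable R : realType.
Local Notation C := R[i].
Local Notation "x %:C" := (real_complex R x) : ring_scope.
Implicit Types x y r e d t : R.

Lemma ler_cross (P Q a b : R) : 0 <= P -> 0 <= Q -> 0 <= a -> 0 <= b ->
  P * a + Q * b <= (P + Q) * (a + b).
Proof.
move=> P0 Q0 a0 b0; have := mulr_ge0 P0 b0; have := mulr_ge0 Q0 a0; lra.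
Qed.

Lemma dcst (k c : C) : differentiable (fun=> k : C) c.
Proof. exact: differentiable_cst. Qed.

Lemma did (c : C) : differentiable (fun s : C => s) c.
Proof. by []. Qed.

Lemma dD (f g : C -> C) c : differentiable f c -> differentiable g c ->
  differentiable (fun s => f s + g s) c.
Proof. exact: differentiableD. Qed.

Lemma dB (f g : C -> C) c : differentiable f c -> differentiable g c ->
  differentiable (fun s => f s - g s) c.
Proof. exact: differentiableB. Qed.

Lemma dM (f g : C -> C) c : differentiable f c -> differentiable g c ->
  differentiable (fun s => f s * g s) c.
Proof. exact: differentiableM. Qed.

Lemma dV (f : C -> C) c : differentiable f c -> f c != 0 ->
  differentiable (fun s => (f s)^-1) c.
Proof. exact: differentiableV. Qed.

Lemma dcomp (f g : C -> C) c : differentiable f c -> differentiable g (f c) ->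
  differentiable (fun s => g (f s)) c.
Proof. exact: differentiable_comp. Qed.

Lemma dX (f : C -> C) n c : differentiable f c -> differentiable (fun s => f s ^+ n) c.
Proof.
move=> hf; elim: n => [|n IH]; first exact: dcst.
by under eq_fun do rewrite exprS; apply: dM.
Qed.

Lemma derive_at0 (g : R -> R) (l : R) : is_derive (0 : R) (1 : R) g l -> forall e, 0 < e ->
  exists2 d, 0 < d & forall h, `|h| < d -> `|g h - g 0 - l * h| <= e * `|h|.
Proof.
move=> gl e e0; have /cvgrPdist_lt/(_ _ e0) := @ex_derive _ _ _ _ _ _ _ gl.
rewrite near_withinE => /nbhs_ballP[d /= d0 Hd]; exists d => // h hd.
have [->|h0] := eqVneq h 0; first by rewrite subrr mulr0 subrr normr0 mulr0.
have := Hd h; rewrite /ball /= sub0r normrN => /(_ hd h0).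
rewrite -/(derive g 0 1) derive_val /= scaler1 addr0 /GRing.scale /= => H.
have -> : g h - g 0 - l * h = - (l - h^-1 * (g h - g 0)) * h.
  by rewrite opprB mulrBl mulrAC mulVf // mul1r.
by rewrite normrM normrN ler_wpM2r // ltW.
Qed.

Lemma cexp_diff0 : differentiable (@cexp R) 0.
Proof.
apply/diffCP; exists 1 => e e0; rewrite cexp0.
(* The errors collected in [B1] and [B2] are 4 k M and 3 k M + 2 M^2, with M below k: nine times k M
   in all. *)
have [k [k0 k1 ke]] : exists k : R, [/\ 0 < k, k <= 1 & 9 * k <= e].
  exists (Num.min 1 (e / 9)); split; first by rewrite lt_min ltr01 divr_gt0.
    by rewrite ge_min lexx.
  by rewrite -ler_pdivlMl // mulrC ge_min lexx orbT.
have [d1 d1p H1] : exists2 d, 0 < d & forall h, `|h| < d ->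
    `|expR h - expR 0 - 1 * h| <= k * `|h|.
  by apply: derive_at0 => //; rewrite -[X in is_derive _ _ _ X]expR0; exact: is_derive_expR.
have [d2 d2p H2] : exists2 d, 0 < d & forall h, `|h| < d ->
    `|@cos R h - cos 0 - 0 * h| <= k * `|h|.
  by apply: derive_at0 => //; rewrite -[X in is_derive _ _ _ X]oppr0 -[X in - X]sin0;
      exact: is_derive_cos.
have [d3 d3p H3] : exists2 d, 0 < d & forall h, `|h| < d ->
    `|@sin R h - sin 0 - 1 * h| <= k * `|h|.
  by apply: derive_at0 => //; rewrite -[X in is_derive _ _ _ X]cos0; exact: is_derive_sin.
exists (Num.min k (Num.min d1 (Num.min d2 d3))) => [|[a b]].
  by rewrite !lt_min k0 d1p d2p d3p.
rewrite subr0 !lt_min => /and4P[hk h1 h2 h3].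
set M := cmod _ in hk h1 h2 h3 *.
have ha : `|a| <= M by exact: (normr_Re (Complex a b)).
have hb : `|b| <= M by exact: (normr_Im (Complex a b)).
have {}H1 := H1 a (le_lt_trans ha h1).
have {}H2 := H2 b (le_lt_trans hb h2).
have {}H3 := H3 b (le_lt_trans hb h3).
rewrite expR0 mul1r in H1; rewrite cos0 mul0r subr0 in H2; rewrite sin0 subr0 mul1r in H3.
have M0 : 0 <= M by exact: cmod_ge0.
have {}H1 : `|expR a - 1 - a| <= k * M by apply: le_trans H1 _; rewrite ler_wpM2l // ltW.
have {}H2 : `|cos b - 1| <= k * M by apply: le_trans H2 _; rewrite ler_wpM2l // ltW.
have {}H3 : `|sin b - b| <= k * M by apply: le_trans H3 _; rewrite ler_wpM2l // ltW.
have kM : k * M <= M by rewrite -[leRHS]mul1r ler_wpM2r.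
have E1 : `|expR a - 1| <= 2 * M.
  have := ler_normD (expR a - 1 - a) a; rewrite subrK; lra.
have E2 : `|expR a| <= 3.
  have := ler_normD (expR a - 1) 1; rewrite subrK normr1; lra.
rewrite mul1r; apply: le_trans (cmod_le_ReIm _) _; rewrite /cexp /= !mul0r subr0 addr0.
have -> : expR a * cos b - 1 - a = expR a * (cos b - 1) + (expR a - 1 - a) by ring.
have -> : expR a * sin b - 0 - b = expR a * (sin b - b) + (expR a - 1) * b by ring.
have B1 : `|expR a * (cos b - 1) + (expR a - 1 - a)| <= 4 * (k * M).
  apply: le_trans (ler_normD _ _) _; rewrite normrM.
  by have := ler_pM (normr_ge0 _) (normr_ge0 _) E2 H2; lra.
have B2 : `|expR a * (sin b - b) + (expR a - 1) * b| <= 3 * (k * M) + 2 * M * M.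
  apply: le_trans (ler_normD _ _) _; rewrite !normrM.
  have := ler_pM (normr_ge0 _) (normr_ge0 _) E2 H3.
  by have := ler_pM (normr_ge0 _) (normr_ge0 _) E1 hb; lra.
have B3 : M * M <= k * M by rewrite ler_wpM2r // ltW.
have B4 : 9 * (k * M) <= e * M by rewrite mulrA ler_wpM2r.
have kM0 : 0 <= k * M by rewrite mulr_ge0 // ltW.
by lra.
Qed.



Lemma cexpE (a b : R) : cexp (Complex a b) = (expR a)%:C * cexp (Complex 0 b).
Proof. by rewrite /cexp /= expR0 rmorph1 mul1r. Qed.

Definition ee t : C := cexp (Complex 0 (2 * pi * t)).

Lemma cmod_cexp (a b : R) : cmod (cexp (Complex a b)) = expR a.
Proof.
rewrite /cexp cmodM cmodC /= gtr0_norm ?expR_gt0 // -[RHS]mulr1; congr (_ * _).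
by apply: complexI; rewrite -cmodE normc_def /= cos2Dsin2 sqrtr1.
Qed.

Lemma cmod_ee t : cmod (ee t) = 1.
Proof. by rewrite /ee cmod_cexp expR0. Qed.

Lemma ee_neq0 t : ee t != 0.
Proof. by rewrite -cmod_gt0 cmod_ee. Qed.

Lemma cexp_neq0 (z : C) : cexp z != 0.
Proof. by case: z => a b; rewrite -cmod_gt0 cmod_cexp expR_gt0. Qed.

Lemma cexp_diff (z : C) : differentiable (@cexp R) z.
Proof.
have -> : @cexp R = (fun w => cexp z * cexp (w - z)).
  by apply/funext => w; rewrite -cexpD addrC subrK.
apply: dM (dcst _ _) _; apply: dcomp; first by apply: dB (did _) (dcst _ _).
by rewrite subrr; exact: cexp_diff0.
Qed.

Lemma ee0 : ee 0 = 1.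
Proof. by rewrite /ee mulr0 cexp0. Qed.

Lemma eeD t t' : ee (t + t') = ee t * ee t'.
Proof.
rewrite /ee -cexpD; congr cexp; apply/eqP; rewrite eq_complex /= addr0 eqxx /=.
by rewrite mulrDr.
Qed.

Lemma ee1 : ee 1 = 1.
Proof.
rewrite /ee mulr1 /cexp /= expR0 mul1r.
by rewrite mulr_natl cos2pi sin2pi.
Qed.

Lemma cont_Complex (T : topologicalType) (a b : T -> R) (t : T) :
  {for t, continuous a} -> {for t, continuous b} ->
  {for t, continuous (fun s : T => (Complex (a s) (b s) : C))}.
Proof.
move=> ca cb; apply/contCP => e e0; have e2 : 0 < e / 2 by rewrite divr_gt0.
move/cvgrPdist_lt: ca => /(_ _ e2) ca; move/cvgrPdist_lt: cb => /(_ _ e2) cb.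
near=> s; apply: le_lt_trans (cmod_le_ReIm _) _; rewrite (splitr e); apply: ltrD => /=.
  by rewrite distrC; near: s.
by rewrite distrC; near: s.
Unshelve. all: by end_near. Qed.

Lemma cont_ee : continuous ee.
Proof.
move=> t; apply: (@continuous_comp _ _ _ (fun t => Complex 0 (2 * pi * t)) (@cexp R)).
  apply: cont_Complex; first exact: cvg_cst.
  by apply: cvgM; [exact: cvg_cst|exact: cvg_id].
exact/differentiable_continuous/cexp_diff.
Qed.

Definition circ (c : C) r t : C := c + r%:C * ee t.

Lemma cont_circ c r : continuous (circ c r).
Proof.
move=> t; apply: cvgD; first exact: cvg_cst.
by apply: cvgM; [exact: cvg_cst|exact: cont_ee].
Qed.

Lemma circ_dist c r t : 0 <= r -> cmod (circ c r t - c) = r.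
Proof. by move=> r0; rewrite /circ addrC addKr cmodM cmodC cmod_ee mulr1 ger0_norm. Qed.

Lemma icont_circ (f : C -> C) c r : 0 <= r ->
  (forall s, cmod (s - c) = r -> {for s, continuous f}) ->
  icont (fun t => f (circ c r t)).
Proof.
move=> r0 H; split=> t _; apply: (@continuous_comp _ _ _ (circ c r) f).
  exact: cont_circ.
by apply: H; rewrite circ_dist.
Qed.

(* Goursat's theorem for w |-> f (c + r1 * cexp w) on a rectangle: the integrals over the
   two horizontal sides cancel by periodicity. *)
Lemma avg_annulus (f : C -> C) (c : C) r1 r2 : 0 < r1 -> r1 <= r2 ->
  (forall s, r1 <= cmod (s - c) <= r2 -> differentiable f s) ->
  avg (fun t => f (circ c r1 t)) = avg (fun t => f (circ c r2 t)).
Proof.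
move=> r10 r12 Hf; have r20 := lt_le_trans r10 r12.
pose B := ln (r2 / r1).
have eB : r1 * expR B = r2.
  by rewrite lnK ?posrE ?divr_gt0 // mulrC divfK // gt_eqF.
have B0 : 0 <= B by rewrite ln_ge0 // ler_pdivlMr // mul1r.
pose Z x y := r1%:C * cexp (Complex (B * x) (2 * pi * y)).
pose p : C := B%:C; pose q : C := Complex 0 (2 * pi).
have Zmod x y : 0 <= x <= 1 -> r1 <= cmod (Z x y) <= r2.
  move=> /andP[x0 x1]; rewrite /Z cmodM cmodC cmod_cexp gtr0_norm //.
  rewrite -{1}[r1]mulr1 -eB !ler_pM2l // -{1}expR0 !ler_expR mulr_ge0 //=.
  by rewrite -[leRHS]mulr1 ler_wpM2l.
have := @goursat R (fun x y => f (c + Z x y)) p q _.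
have E0 : avg (fun x => f (c + Z x 0)) = avg (fun x => f (c + Z x 1)).
  congr avg; apply/funext => x; congr (f (c + _)); rewrite /Z; congr (_ * _).
  by rewrite !(cexpE (B * x)) -![cexp (Complex 0 _)]/(ee _) ee0 ee1.
have E1 r' x : r1 * expR (B * x) = r' -> avg (fun y => f (c + Z x y)) = avg (fun t =>
    f (circ c r' t)).
  move=> <-; congr avg; apply/funext => y; congr (f (c + _)).
  by rewrite /Z cexpE rmorphM mulrA.
rewrite E0 subrr mulr0 add0r (E1 r2 1) ?mulr1 // (E1 r1 0); last by rewrite mulr0 expR0 mulr1.
have q0 : q != 0 by rewrite eq_complex /= eqxx /= mulf_neq0 // ?pnatr_eq0 // gt_eqF // pi_gt0.
move=> H; apply/esym/eqP; rewrite -subr_eq0; apply/eqP/(mulfI q0); rewrite mulr0; apply: H.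
move=> x0 y0 hx hy {E0 E1}.
(* Since [cexp] turns sums into products, [Phi] is f along Z in the variable w = p (x - x0) + q (y -
   y0); its derivative at 0 is the number k required by [goursat]. *)
pose Phi w := f (c + Z x0 y0 * cexp w).
have dPhi : differentiable Phi 0.
  apply: dcomp; first exact: dD (dcst _ _) (dM (dcst _ _) (cexp_diff _)).
  apply: Hf; rewrite cexp0 mulr1 addrC addKr; exact: Zmod.
have /diffCP[l Hl] := dPhi; exists l => e e0.
pose M := cmod p + cmod q.
have M0 : 0 < M by rewrite /M ltr_wpDl ?cmod_ge0 // cmod_gt0.
have [d d0 Hd] := Hl (e / M) (divr_gt0 e0 M0).
exists (d / M) => [|x y hx' hy']; first exact: divr_gt0.
set w := p * _ + q * _.
have hw : cmod w <= M * (`|x - x0| + `|y - y0|).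
  apply: le_trans (cmodD _ _) _; rewrite !cmodM (cmodC (x - x0)) (cmodC (y - y0)) /M.
  by apply: ler_cross; rewrite ?cmod_ge0.
have hw2 : cmod w < d.
  apply: le_lt_trans (cmodD _ _) _; rewrite !cmodM (cmodC (x - x0)) (cmodC (y - y0)).
  have h1 : cmod p * `|x - x0| <= cmod p * (d / M) by rewrite ler_wpM2l ?cmod_ge0 // ltW.
  have h2 : cmod q * `|y - y0| < cmod q * (d / M) by rewrite ltr_pM2l // cmod_gt0.
  have h3 : cmod p * (d / M) + cmod q * (d / M) = d by rewrite -mulrDl mulrC divfK // gt_eqF.
  by rewrite -h3; exact: ler_ltD.
have := Hd w; rewrite subr0 => /(_ hw2).
rewrite {1 2}/Phi cexp0 mulr1 (_ : Z x0 y0 * cexp w = Z x y); last first.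
  rewrite /Z -mulrA -cexpD; congr (_ * cexp _); apply/eqP.
  by rewrite eq_complex /=; apply/andP; split; apply/eqP; ring.
move/le_trans; apply; rewrite mulrAC ler_pdivrMr // -mulrA ler_wpM2l ?(ltW e0) //.
by rewrite mulrC.
Qed.

End Annulus.

Section Holomorphic.
Variable R : realType.
Local Notation C := R[i].
Local Notation "x %:C" := (real_complex R x) : ring_scope.
Implicit Types (f g : C -> C) (c s z w : C) (r e d t M K : R).

Lemma lt_both (a b : R) : 0 < a -> 0 < b -> exists m : R, [/\ 0 < m, m < a & m < b].
Proof.
move=> a0 b0; exists (Num.min a b / 2); split.
- by rewrite divr_gt0 // lt_min a0.
- have : Num.min a b <= a by rewrite ge_min lexx.
  by move: a0; lra.
- have : Num.min a b <= b by rewrite ge_min lexx orbT.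
  by move: b0; lra.
Qed.

Definition hol c r f := forall s, cmod (s - c) < r -> differentiable f s.

Definition isdv f c (l : C) := forall e, 0 < e -> exists2 d, 0 < d &
  forall s, cmod (s - c) < d -> cmod (f s - f c - l * (s - c)) <= e * cmod (s - c).

Lemma isdv_uniq f c (l l' : C) : isdv f c l -> isdv f c l' -> l = l'.
Proof.
move=> h h'; apply/eqP; rewrite -subr_eq0 -cmod_eq0 eq_le cmod_ge0 andbT.
apply/ler_addgt0Pl => e e0; rewrite addr0.
have e2 : 0 < e / 2 by rewrite divr_gt0.
have [d d0 Hd] := h _ e2; have [d' d0' Hd'] := h' _ e2.
have [m [m0 md md']] := lt_both d0 d0'.
have E : cmod (c + m%:C - c) = m by rewrite addrC addKr cmodC gtr0_norm.
have := Hd (c + m%:C); have := Hd' (c + m%:C); rewrite E => /(_ md') h1 /(_ md) h2.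
rewrite -(ler_pM2r m0) -{1}[m]gtr0_norm // -cmodC -cmodM.
rewrite (_ : (l - l') * _ = (f (c + m%:C) - f c - l' * (c + m%:C - c)) -
   (f (c + m%:C) - f c - l * (c + m%:C - c))); last by ring.
by apply: le_trans (cmodD _ _) _; rewrite cmodN; move: h1 h2; lra.
Qed.

Definition dv f c : C := xget 0 [set l | isdv f c l].

Lemma dvP f c : differentiable f c -> isdv f c (dv f c).
Proof. by move=> /diffCP[l hl]; rewrite /dv; case: xgetP => [? -> //|/(_ l)]. Qed.

Lemma isdv_diff f c l : isdv f c l -> differentiable f c.
Proof. by move=> h; apply/diffCP; exists l. Qed.

Lemma dvE f c l : isdv f c l -> dv f c = l.
Proof. by move=> h; apply: isdv_uniq (dvP (isdv_diff h)) h. Qed.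

Lemma isdvB f g c l k : isdv f c l -> isdv g c k -> isdv (fun s => f s - g s) c (l - k).
Proof.
move=> hf hg e e0; have e2 : 0 < e / 2 by rewrite divr_gt0.
have [d d0 Hd] := hf _ e2; have [d' d0' Hd'] := hg _ e2.
exists (Num.min d d') => [|s]; first by rewrite lt_min d0.
rewrite lt_min => /andP[/Hd h1 /Hd' h2].
rewrite (_ : _ - _ - _ = (f s - f c - l * (s - c)) - (g s - g c - k * (s - c))); last by ring.
by apply: le_trans (cmodD _ _) _; rewrite cmodN; move: h1 h2; lra.
Qed.

(** Subtracting such a polynomial from f before applying the mean value inequality yields Taylor
    estimates; k = 0 gives the first order. *)
Lemma isdv_quad (c0 l k s0 : C) :
  isdv (fun s => l * (s - c0) + k * (s - c0) ^+ 2) s0 (l + k * 2 * (s0 - c0)).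
Proof.
move=> e e0; have k0 : 0 < cmod k + 1 by rewrite ltr_wpDl ?cmod_ge0.
exists (e / (cmod k + 1)) => [|s]; first by rewrite divr_gt0.
rewrite ltr_pdivlMr // => hs.
rewrite (_ : _ - _ - _ = k * (s - s0) * (s - s0)); last by ring.
rewrite 2!cmodM ler_wpM2r ?cmod_ge0 //; apply: le_trans (ltW hs).
by rewrite mulrC ler_wpM2l ?cmod_ge0 // lerDl.
Qed.

Lemma eq_isdv f g c l d : 0 < d -> (forall s, cmod (s - c) < d -> f s = g s) ->
  isdv f c l -> isdv g c l.
Proof.
move=> d0 E H e e0; have [d' d0' Hd'] := H _ e0.
exists (Num.min d d') => [|s]; first by rewrite lt_min d0.
rewrite lt_min => /andP[h1 h2]; rewrite -!E //; first exact: Hd'.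
by rewrite subrr cmod0.
Qed.

Lemma eq_differentiable f g c d : 0 < d -> (forall s, cmod (s - c) < d -> f s = g s) ->
  differentiable f c -> differentiable g c.
Proof. by move=> d0 E /dvP h; apply: isdv_diff (eq_isdv d0 E h). Qed.

Lemma dshift f s : differentiable (fun h => f (s + h)) 0 -> differentiable f s.
Proof.
move=> h; have -> : f = (fun x => (fun h => f (s + h)) (x - s)).
  by apply/funext => x; rewrite addrC subrK.
apply: (@dcomp _ (fun x => x - s) (fun h => f (s + h))); last by rewrite subrr.
exact: dB (did _) (dcst _ _).
Qed.

Lemma hol_cont f c r : hol c r f -> forall s, cmod (s - c) < r -> {for s, continuous f}.
Proof. by move=> h s /h; exact: differentiable_continuous. Qed.

Lemma icont_hol f c r s r' : hol c r f -> 0 <= r' -> cmod (s - c) + r' < r ->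
  icont (fun t => f (circ s r' t)).
Proof.
move=> h r0 hr; apply: icont_circ => // u hu; apply: (hol_cont h).
by apply: le_lt_trans hr; apply: le_trans (cmod_triB _ s _) _; rewrite hu addrC.
Qed.

(** The mean does not depend on the radius and tends to f c as the radius shrinks. Only continuity
    is asked at c, so the lemma applies to [dq f c] before its differentiability there is known. *)
Lemma mean_value_punct f c r0 r : {for c, continuous f} ->
  (forall s, 0 < cmod (s - c) < r0 -> differentiable f s) -> 0 < r < r0 ->
  avg (fun t => f (circ c r t)) = f c.
Proof.
move=> cf df /andP[r0p rr0]; apply/eqP; rewrite -subr_eq0 -cmod_eq0 eq_le cmod_ge0 andbT.
apply/ler_addgt0Pl => e e0; rewrite addr0.
have [d d0 Hd] := (cont1P _ _).1 cf e e0.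
have [m [m0 md mr]] : exists m, [/\ 0 < m, m < d & m <= r].
  exists (Num.min (d / 2) r); split; first by rewrite lt_min r0p divr_gt0.
    by apply: (@le_lt_trans _ _ (d / 2)); [rewrite ge_min lexx|lra].
  by rewrite ge_min lexx orbT.
have ic m' : 0 < m' <= r -> icont (fun t => f (circ c m' t)).
  move=> /andP[m1 m2]; apply: icont_circ; first exact: ltW.
  by move=> s hs; apply/differentiable_continuous/df; rewrite hs m1 (le_lt_trans m2).
have H s : m <= cmod (s - c) <= r -> differentiable f s.
  by move=> /andP[h1 h2]; apply: df; rewrite (lt_le_trans m0 h1) (le_lt_trans h2).
rewrite -(avg_annulus m0 mr H).
rewrite -[X in _ - X]avg_cst -avgB; [|by apply: ic; rewrite m0|exact: icont_cst].
apply: avg_bound => [|t _].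
  by apply: icontB (@icont_cst _ _); apply: ic; rewrite m0.
by apply/ltW/Hd; rewrite circ_dist // ltW.
Qed.

Lemma mean_value f c r0 r : hol c r0 f -> 0 < r < r0 ->
  avg (fun t => f (circ c r t)) = f c.
Proof.
move=> h /andP[r1 r2]; apply: (@mean_value_punct _ _ r0).
- by apply: (hol_cont h); rewrite subrr cmod0 (lt_trans r1).
- by move=> s /andP[_]; exact: h.
- by rewrite r1.
Qed.

Lemma dsub_neq0 (a s : C) : s != a -> differentiable (fun u => (u - a)^-1) s.
Proof. by move=> h; apply: dV; [exact: dB (did _) (dcst _ _)|rewrite subr_eq0]. Qed.

(** The only pole lies inside the circle, so the radius can be enlarged without changing the mean,
    which tends to 0 as the circle goes to infinity. *)
Lemma avg_pole c a r : cmod (a - c) < r ->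
  icont (fun t => (circ c r t - a)^-1) /\ avg (fun t => (circ c r t - a)^-1) = 0.
Proof.
move=> h; have r0 := le_lt_trans (cmod_ge0 _) h.
have far s : r <= cmod (s - c) -> s != a.
  by apply: contraTneq => ->; rewrite -ltNge.
have ic r' : r <= r' -> icont (fun t => (circ c r' t - a)^-1).
  move=> rr'; apply: (@icont_circ _ (fun s => (s - a)^-1)).
    exact: ltW (lt_le_trans r0 rr').
  by move=> s hs; apply/differentiable_continuous/dsub_neq0/far; rewrite hs.
split; first exact: ic.
apply/eqP; rewrite -cmod_eq0 eq_le cmod_ge0 andbT.
apply/ler_addgt0Pl => e e0; rewrite addr0.
(* On this circle the distance to a is at least 1 / e. *)
pose r' := r + e^-1.
have rr' : r <= r' by rewrite lerDl invr_ge0 ltW.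
have H s : r <= cmod (s - c) <= r' -> differentiable (fun s => (s - a)^-1) s.
  by move=> /andP[h1 _]; apply/dsub_neq0/far.
rewrite (avg_annulus r0 rr' H).
apply: avg_bound => [|t _]; first exact: ic.
rewrite cmodV -[leRHS]invrK lef_pV2 ?posrE ?invr_gt0 //.
  have := cmod_leB (circ c r' t - c) (a - c).
  rewrite circ_dist; last exact: ltW (lt_le_trans r0 rr').
  by rewrite opprB addrA subrK /r'; move: h; lra.
by rewrite cmod_gt0 subr_eq0 far // circ_dist // ltW // (lt_le_trans r0).
Qed.

Definition dq f c s : C := if s == c then dv f c else (f s - f c) / (s - c).

Lemma dqE f c s : f s = f c + (s - c) * dq f c s.
Proof.
rewrite /dq; have [->|h] := eqVneq s c; first by rewrite subrr mul0r addr0.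
by rewrite mulrCA divff ?subr_eq0 // mulr1 addrC subrK.
Qed.

Lemma dq_cont f c : differentiable f c -> {for c, continuous (dq f c)}.
Proof.
move=> /dvP h; apply/cont1P => e e0.
have [d d0 Hd] := h (e / 2) (divr_gt0 e0 (ltr0Sn _ 1)); exists d => // s /Hd.
have [->|sc] := eqVneq s c; first by move=> _; rewrite [X in cmod X]subrr cmod0.
rewrite [dq f c c]/dq eqxx /dq (negPf sc) => H.
have s0 : 0 < cmod (s - c) by rewrite cmod_gt0 subr_eq0.
apply: (@le_lt_trans _ _ (e / 2)); last by rewrite ltr_pdivrMr // mulr_natr mulr2n ltrDl.
rewrite -(ler_pM2r s0) -cmodM mulrBl divfK ?subr_eq0 //.
Qed.

Lemma dq_diff_off f c s : s != c -> differentiable f s -> differentiable (dq f c) s.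
Proof.
move=> sc hf; have s0 : 0 < cmod (s - c) by rewrite cmod_gt0 subr_eq0.
apply: (@eq_differentiable (fun u => (f u - f c) * (u - c)^-1) _ _ _ s0).
  move=> u hu; rewrite /dq; case: eqVneq => // uc.
  by move: hu; rewrite uc cmod_subC ltxx.
by apply: dM; [exact: dB hf (dcst _ _)|exact: dsub_neq0].
Qed.

(** Mean value property of the difference quotient [dq f c], whose value at c is the derivative; its
    constant term f c integrates to 0 by [avg_pole]. *)
Lemma dv_avg f c r0 r : hol c r0 f -> 0 < r < r0 ->
  dv f c = avg (fun t => f (circ c r t) / (circ c r t - c)).
Proof.
move=> h /andP[r1 r2].
have cc0 : cmod (c - c) < r by rewrite subrr cmod0.
have [i0 a0] := avg_pole cc0.
have fc : differentiable f c by apply: h; rewrite (lt_trans cc0).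
have i1 : icont (fun t => f (circ c r t)).
  by apply: (icont_hol h); rewrite ?subrr ?cmod0 ?add0r // ltW.
have <- : avg (fun t => dq f c (circ c r t)) = dv f c.
  rewrite (mean_value_punct (dq_cont fc) (r0 := r0)); first by rewrite /dq eqxx.
    move=> s /andP[s0 s1]; apply: dq_diff_off; last exact: h.
    by rewrite -subr_eq0 -cmod_gt0.
  by rewrite r1.
rewrite -[RHS]subr0 -(mulr0 (f c)) -a0 -avgZ // -avgB.
- apply: eq_avg => t _; rewrite /dq; case: eqVneq => E; last by rewrite -mulrBl.
  by have := circ_dist c t (ltW r1); rewrite E subrr cmod0 => r00; move: r1; rewrite -r00 ltxx.
- exact: icontM.
- by apply: icontM => //; exact: icont_cst.
Qed.

Lemma dv_bound f c r0 r M : hol c r0 f -> 0 < r < r0 ->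
  (forall s, cmod (s - c) = r -> cmod (f s) <= M) -> cmod (dv f c) <= M / r.
Proof.
move=> h hr HM; rewrite (dv_avg h hr); case/andP: hr => r1 r2.
have cc0 : cmod (c - c) < r by rewrite subrr cmod0.
have [i0 a0] := avg_pole cc0.
apply: avg_bound => [|t _].
  by apply: icontM => //; apply: (icont_hol h); rewrite ?subrr ?cmod0 ?add0r // ltW.
rewrite cmodM cmodV circ_dist ?(ltW r1) // ler_wpM2r ?invr_ge0 ?(ltW r1) //.
by apply: HM; rewrite circ_dist // ltW.
Qed.

(** A Lipschitz bound along the segment is additive, and differentiability gives it near each
    parameter with constant K plus a slack; bisection globalises it and the slack tends to 0. *)
Lemma mvi f s s' K : 0 <= K ->
  (forall t, 0 <= t <= 1 -> exists2 l, isdv f (s + t%:C * (s' - s)) l & cmod l <= K) ->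
  cmod (f s' - f s) <= K * cmod (s' - s).
Proof.
move=> K0 H; apply/ler_addgt0Pr => e e0.
pose D := s' - s; pose g t := f (s + t%:C * D).
have D1 : 0 < cmod D + 1 by rewrite ltr_wpDl ?cmod_ge0.
pose e1 := e / (cmod D + 1).
have e10 : 0 < e1 by rewrite divr_gt0.
(* The local comparison passes through a point between x and y, so the two lengths add up to y - x
   exactly. *)
pose P x y := x <= y /\ cmod (g y - g x) <= (K + e1) * (y - x) * cmod D.
have : P 0 1.
  apply: bisect1 => [x y z [xy h1] [yz h2]|x0 hx0].
    split; first exact: le_trans xy yz.
    apply: le_trans (cmod_triB _ (g y) _) _.
    rewrite (_ : z - x = (z - y) + (y - x)); last by ring.
    by rewrite mulrDr mulrDl lerD.
  have [l hl lK] := H _ hx0; have [d d0 Hd] := hl _ e10.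
  exists (d / (cmod D + 1)) => [|x y xy yx /andP[xx0 x0y] x_0 y1]; first exact: divr_gt0.
  split; first exact: ltW.
  have err u : x <= u <= y ->
      cmod (g u - g x0 - l * ((u - x0)%:C * D)) <= e1 * (`|u - x0| * cmod D).
    move=> /andP[xu uy].
    have E : s + u%:C * D - (s + x0%:C * (s' - s)) = (u - x0)%:C * D.
      by rewrite rmorphB /= /D; ring.
    have := Hd (s + u%:C * D); rewrite E cmodM cmodC; apply.
    have ux : `|u - x0| <= y - x by rewrite ler_norml; apply/andP; split; lra.
    have h1 : `|u - x0| * cmod D <= (y - x) * cmod D by rewrite ler_wpM2r ?cmod_ge0.
    have h2 : (y - x) * (cmod D + 1) < d by rewrite -ltr_pdivlMr.
    by move: h1 h2; lra.
  have h1 := err y; rewrite lexx (ltW xy) in h1; have {}h1 := h1 isT.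
  have h2 := err x; rewrite lexx (ltW xy) in h2; have {}h2 := h2 isT.
  rewrite (_ : g y - g x = (g y - g x0 - l * ((y - x0)%:C * D)) -
     (g x - g x0 - l * ((x - x0)%:C * D)) + l * ((y - x)%:C * D)); last first.
    by rewrite !rmorphB /=; ring.
  apply: le_trans (cmodD _ _) _; rewrite !cmodM cmodC gtr0_norm ?subr_gt0 //.
  have h3 : cmod l * ((y - x) * cmod D) <= K * ((y - x) * cmod D).
    by rewrite ler_wpM2r // mulr_ge0 ?cmod_ge0 // subr_ge0 ltW.
  have h4 := cmodD (g y - g x0 - l * ((y - x0)%:C * D)) (- (g x - g x0 - l * ((x - x0)%:C * D))).
  rewrite cmodN in h4.
  rewrite ger0_norm ?subr_ge0 // in h1; rewrite ler0_norm ?subr_le0 // in h2.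
  apply: le_trans (lerD (le_trans h4 (lerD h1 h2)) h3) _.
  by rewrite le_eqVlt; apply/orP; left; apply/eqP; ring.
have g0 : g 0 = f s by rewrite /g rmorph0 mul0r addr0.
have g1 : g 1 = f s' by rewrite /g rmorph1 mul1r /D addrC subrK.
move=> [_]; rewrite g0 g1 subr0 mulr1 mulrDl => /le_trans; apply; rewrite lerD2l.
by rewrite /e1 mulrAC ler_pdivrMr // ler_wpM2l ?(ltW e0) // lerDl.
Qed.

End Holomorphic.

Section CauchyEstimates.
Variable R : realType.
Local Notation C := R[i].
Local Notation "x %:C" := (real_complex R x) : ring_scope.
Implicit Types (f g : C -> C) (c s z w : C) (r e d t M K : R).

Lemma seg_in c r s s' t : cmod (s - c) < r -> cmod (s' - c) < r -> 0 <= t <= 1 ->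
  cmod (s + t%:C * (s' - s) - c) < r.
Proof.
move=> h h' /andP[t0 t1].
rewrite (_ : _ - c = (1 - t)%:C * (s - c) + t%:C * (s' - c)); last first.
  by rewrite rmorphB rmorph1 /=; ring.
apply: le_lt_trans (cmodD _ _) _; rewrite !cmodM !cmodC !ger0_norm ?subr_ge0 //.
have h1 : (1 - t) * cmod (s - c) <= (1 - t) * Num.max (cmod (s - c)) (cmod (s' - c)).
  by rewrite ler_wpM2l ?subr_ge0 // le_max lexx.
have h2 : t * cmod (s' - c) <= t * Num.max (cmod (s - c)) (cmod (s' - c)).
  by rewrite ler_wpM2l // le_max lexx orbT.
apply: le_lt_trans (lerD h1 h2) _; rewrite -mulrDl subrK mul1r.
by rewrite gt_max h h'.
Qed.

(** Circles of radius r / 4 about points of the half disc stay in the disc, so Cauchy's estimate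
    bounds the derivative by M / (r / 4). *)
Lemma hol_lip f c r M : 0 < r -> hol c r f -> (forall s, cmod (s - c) < r -> cmod (f s) <= M) ->
  forall s s', cmod (s - c) < r / 2 -> cmod (s' - c) < r / 2 ->
  cmod (f s' - f s) <= M / (r / 4) * cmod (s' - s).
Proof.
move=> r0 h HM s s' hs hs'.
have M0 : 0 <= M by apply: le_trans (HM s _); [exact: cmod_ge0|move: hs; lra].
have r4 : 0 < r / 4 by rewrite divr_gt0.
apply: mvi => [|t ht]; first by rewrite divr_ge0 // ltW.
have hp := seg_in hs hs' ht; set p := s + _ in hp *.
have hq u : cmod (u - p) < r / 2 -> cmod (u - c) < r.
  by move=> hu; have := cmod_triB u p c; move: hu hp; lra.
have hh : hol p (r / 2) f by move=> u /hq; exact: h.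
exists (dv f p); first by apply: dvP; apply: hh; rewrite subrr cmod0 divr_gt0.
apply: (dv_bound hh); first by rewrite r4 /=; lra.
by move=> u hu; apply/HM/hq; rewrite hu; lra.
Qed.

(** Both derivatives are means over translates of one circle: the denominators coincide and
    [hol_lip] controls the numerators. *)
Lemma dv_lip f c r M : 0 < r -> hol c r f -> (forall s, cmod (s - c) < r -> cmod (f s) <= M) ->
  forall s, cmod (s - c) < r / 4 ->
  cmod (dv f s - dv f c) <= M / (r / 4) / (r / 4) * cmod (s - c).
Proof.
move=> r0 h HM s hs; have r4 : 0 < r / 4 by rewrite divr_gt0.
have cc : cmod (c - c) < r / 4 by rewrite subrr cmod0.
have hh u : cmod (u - c) < r / 4 -> hol u (r / 2) f.
  by move=> hu v hv; apply: h; have := cmod_triB v u c; lra.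
have r42 : 0 < r / 4 < r / 2 by rewrite r4 /=; lra.
rewrite (dv_avg (hh _ hs) r42) (dv_avg (hh _ cc) r42).
have i1 u : cmod (u - c) < r / 4 ->
    icont (fun t => f (circ u (r / 4) t) / (circ u (r / 4) t - u)).
  move=> hu; apply: icontM.
    by apply: (icont_hol (hh _ hu)); [exact: ltW|rewrite subrr cmod0; lra].
  by apply: (avg_pole _).1; rewrite subrr cmod0.
rewrite -avgB; [|exact: i1|exact: i1].
apply: avg_bound => [|t ht]; first by apply: icontB; exact: i1.
have E u : circ u (r / 4) t - u = (r / 4)%:C * ee t by rewrite /circ addrC addKr.
rewrite !E -mulrBl cmodM cmodV cmodM cmodC cmod_ee mulr1 gtr0_norm //.
rewrite mulrAC ler_wpM2r ?invr_ge0 ?(ltW r4) //.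
rewrite (_ : cmod (s - c) = cmod (circ s (r / 4) t - circ c (r / 4) t)); last first.
  by congr cmod; rewrite /circ opprD addrACA subrr addr0.
apply: (hol_lip r0 h HM).
  by have := circ_dist c t (ltW r4); lra.
by have := circ_dist s t (ltW r4); have := cmod_triB (circ s (r / 4) t) s c; lra.
Qed.

(** The remainder depends only on M and r, which makes it uniform over families of functions. *)
Lemma taylor2 f c r M : 0 < r -> hol c r f -> (forall s, cmod (s - c) < r -> cmod (f s) <= M) ->
  forall s, cmod (s - c) < r / 4 ->
  cmod (f s - f c - dv f c * (s - c)) <= M / (r / 4) / (r / 4) * cmod (s - c) ^+ 2.
Proof.
move=> r0 h HM s hs; have r4 : 0 < r / 4 by rewrite divr_gt0.
have cc : cmod (c - c) < r / 4 by rewrite subrr cmod0.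
have M0 : 0 <= M by apply: le_trans (HM s _); [exact: cmod_ge0|lra].
have K0 : 0 <= M / (r / 4) / (r / 4) * cmod (s - c).
  by rewrite mulr_ge0 ?cmod_ge0 // !divr_ge0 // ltW.
have := @mvi _ (fun u => f u - (dv f c * (u - c) + 0 * (u - c) ^+ 2)) c s _ K0 _.
rewrite subrr mulr0 expr0n mulr0 addr0 subr0 mul0r addr0.
rewrite [f s - _ - _]addrAC expr2 mulrA; apply => t ht.
have hp := seg_in cc hs ht; set p := c + _ in hp *.
exists (dv f p - (dv f c + 0 * 2 * (p - c))).
  apply: isdvB; last exact: isdv_quad.
  by apply: dvP; apply: h; lra.
rewrite !mul0r addr0; apply: le_trans (dv_lip r0 h HM hp) _.
rewrite ler_wpM2l //; first by rewrite !divr_ge0 // ltW.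
rewrite /p addrC addKr cmodM cmodC; case/andP: ht => t0 t1; rewrite ger0_norm //.
by rewrite -[leRHS]mul1r ler_wpM2r ?cmod_ge0.
Qed.

(** Differentiation under the integral sign: the quadratic remainder is uniform in t, so the
    first-order expansion of the integrand may be integrated. *)
Lemma avg_param (g : C -> R -> C) r M : 0 < r ->
  (forall t, hol 0 r (g^~ t)) -> (forall z t, cmod z < r -> cmod (g z t) <= M) ->
  (forall z, cmod z < r -> icont (g z)) ->
  differentiable (fun z => avg (g z)) 0.
Proof.
move=> r0 hg HM ic; have r4 : 0 < r / 4 by rewrite divr_gt0.
pose D t := dv (g^~ t) 0; pose L := M / (r / 4) / (r / 4).
have HT t z : cmod z < r / 4 ->
    cmod (g z t - g 0 t - D t * z) <= L * cmod z ^+ 2.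
  move=> hz; have := @taylor2 (g^~ t) 0 r M r0 (hg t) _ z.
  rewrite subr0; apply => // s; rewrite subr0 => hs; exact: HM.
have M0 : 0 <= M.
  by apply: le_trans (HM 0 0 _); rewrite ?cmod_ge0 ?cmod0.
have L0 : 0 <= L by rewrite /L !divr_ge0 // ltW.
have z0r : cmod (0 : C) < r by rewrite cmod0.
(* [D] is a uniform limit of difference quotients with step m, each continuous in t. *)
have icD : icont D.
  split=> t0 ht0; apply/contCP => e e0.
  have L1 : 0 < L + 1 by rewrite ltr_wpDl.
  have e4 : 0 < e / 4 by rewrite divr_gt0.
  have [m [m0 m1 m2]] := lt_both r4 (divr_gt0 e4 L1).
  have hz : cmod (m%:C : C) = m by rewrite cmodC gtr0_norm.
  have mr : m < r by lra.
  have mz : cmod (m%:C : C) < r by rewrite hz.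
  have mz4 : cmod (m%:C : C) < r / 4 by rewrite hz.
  have cq : {for t0, continuous (fun t => g m%:C t - g 0 t)}.
    exact: (icontP (icontB (ic _ mz) (ic _ z0r)) ht0).
  have me : 0 < m * (e / 4) by rewrite mulr_gt0.
  have /contCP/(_ _ me) := cq; apply: filterS => t.
  have h1 := HT t _ mz4; have h2 := HT t0 _ mz4.
  rewrite hz in h1 h2 => h3.
  have b1 : L * m ^+ 2 <= m * (e / 4).
    have : m * (L + 1) < e / 4 by rewrite -ltr_pdivlMr.
    rewrite expr2 mulrA [leRHS]mulrC => h4; rewrite ler_wpM2r ?(ltW m0) //.
    by move: h4 m0; rewrite mulrDr mulr1 mulrC; lra.
  rewrite -(ltr_pM2r m0) -{1}hz -cmodM.
  rewrite (_ : (D t - D t0) * _ = - (g m%:C t - g 0 t - D t * m%:C) +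
     (g m%:C t0 - g 0 t0 - D t0 * m%:C) +
     (g m%:C t - g 0 t - (g m%:C t0 - g 0 t0))); last by ring.
  apply: le_lt_trans (cmodD _ _) _.
  have := cmodD (- (g m%:C t - g 0 t - D t * m%:C)) (g m%:C t0 - g 0 t0 - D t0 * m%:C).
  rewrite cmodN => h4; have : 0 < e * m by rewrite mulr_gt0.
  by move: h1 h2 h3 h4 b1; lra.
have bound z : cmod z < r / 4 ->
    cmod (avg (g z) - avg (g 0) - avg D * z) <= L * cmod z ^+ 2.
  move=> hz; have zr : cmod z < r by lra.
  have i1 := ic _ zr; have i2 := ic _ z0r.
  have iz := @icont_cst R z.
  rewrite [avg D * z]mulrC -avgZ // -avgB // -avgB; [|exact: icontB|exact: icontM].
  apply: avg_bound => [|t ht]; first by apply: icontB; [exact: icontB|exact: icontM].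
  by rewrite [_ * D t]mulrC; exact: HT.
apply: (@isdv_diff _ _ _ (avg D)) => e e0.
have L1 : 0 < L + 1 by rewrite ltr_wpDl.
have [m [m0 m1 m2]] := lt_both r4 (divr_gt0 e0 L1).
exists m => // z; rewrite subr0 => hz; apply: le_trans (bound z _) _; first lra.
rewrite expr2 mulrA ler_wpM2r ?cmod_ge0 //.
have : cmod z * (L + 1) < e by rewrite -ltr_pdivlMr //; lra.
by have := cmod_ge0 z; lra.
Qed.

End CauchyEstimates.

Section CauchyFormula.
Variable R : realType.
Local Notation C := R[i].
Local Notation "x %:C" := (real_complex R x) : ring_scope.
Implicit Types (f g : C -> C) (c s z w : C) (r e d t M K : R).

Lemma hol_sub c r f s r' : hol c r f -> cmod (s - c) + r' <= r -> hol s r' f.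
Proof.
move=> h hs u hu; apply: h; apply: le_lt_trans (cmod_triB u s c) _.
by move: hs hu; lra.
Qed.

Lemma cont_bound f s : {for s, continuous f} ->
  exists2 d, 0 < d & forall u, cmod (u - s) < d -> cmod (f u) <= cmod (f s) + 1.
Proof.
move=> /cont1P/(_ _ ltr01)[d d0 Hd]; exists d => // u /Hd h.
by have := cmodD (f u - f s) (f s); rewrite subrK; lra.
Qed.

(** With the circle moving along with its centre, Cauchy's formula writes the derivative as a mean
    of functions holomorphic in the displacement z. *)
Lemma dv_hol c r f : hol c r f -> hol c r (dv f).
Proof.
move=> h s0 hs0; have [d1 d10 Hd1] := cont_bound (hol_cont h hs0).
have rs : 0 < r - cmod (s0 - c) by rewrite subr_gt0.
have [d [d0 dd1 dr]] := lt_both d10 rs.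
set M := cmod _ + 1 in Hd1; set q := d / 4.
have q0 : 0 < q by rewrite divr_gt0.
have hq : hol s0 d f by apply: (hol_sub h); lra.
have hM u : cmod (u - s0) < d -> cmod (f u) <= M by move=> hu; apply: Hd1; lra.
apply: dshift.
pose g (z : C) t := f (circ (s0 + z) q t) / (q%:C * ee t).
have zin z t : cmod z < q -> cmod (circ (s0 + z) q t - s0) < d.
  move=> hz; have := cmod_triB (circ (s0 + z) q t) (s0 + z) s0.
  rewrite circ_dist ?(ltW q0) //; have -> : s0 + z - s0 = z by rewrite addrC addKr.
  by rewrite /q in hz *; lra.
have qe t : cmod (q%:C * ee t) = q by rewrite cmodM cmodC cmod_ee mulr1 gtr0_norm.
have qe0 t : q%:C * ee t != 0 by rewrite -cmod_gt0 qe.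
apply: (@eq_differentiable _ (fun z => avg (g z)) _ 0 q q0).
  move=> z; rewrite subr0 => hz.
  have hz2 : hol (s0 + z) (d / 2) f.
    apply: (hol_sub hq); have -> : s0 + z - s0 = z by rewrite addrC addKr.
    by rewrite /q in hz; lra.
  have q2 : 0 < q < d / 2 by rewrite q0 /q /=; lra.
  rewrite (dv_avg hz2 q2).
  by apply: eq_avg => t _; rewrite /g /circ [X in _ = _ / X](_ : _ = q%:C * ee t) // addrC addKr.
apply: (@avg_param _ g q (M / q)) => //.
- move=> t z; rewrite subr0 => hz.
  rewrite /g; apply: dM; last exact: dcst.
  apply: (@dcomp _ (fun z => circ (s0 + z) q t) f); last exact/hq/zin.
  by apply: dD; [apply: dD; [exact: dcst|exact: did]|exact: dcst].
- move=> z t hz; rewrite /g cmodM cmodV qe ler_wpM2r ?invr_ge0 ?(ltW q0) //.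
  exact/hM/zin.
- move=> z hz; rewrite /g; apply: icontM.
    apply: (icont_hol hq); first exact: ltW.
    have -> : s0 + z - s0 = z by rewrite addrC addKr.
    by rewrite /q in hz *; lra.
  split=> t _; apply: cvgV => //; apply: cvgM; first exact: cvg_cst.
  exact: cont_ee.
Qed.

(** The derivative is half the second derivative of f, by the second-order expansion obtained from
    [mvi] for f minus a quadratic polynomial. *)
Lemma dq_diff_at c r f : 0 < r -> hol c r f -> differentiable (dq f c) c.
Proof.
move=> r0 h; have h' := dv_hol h.
have cc : cmod (c - c) < r by rewrite subrr cmod0.
have d2 := dvP (h' _ cc); set k := dv (dv f) c in d2.
apply: (@isdv_diff _ _ _ (k / 2)) => e e0.
have [d d0 Hd] := d2 _ e0.
have [m [m0 mr md]] := lt_both r0 d0.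
exists m => // s hs.
have [->|sc] := eqVneq s c; first by rewrite !subrr mulr0 subr0 !cmod0 mulr0.
have s0 : 0 < cmod (s - c) by rewrite cmod_gt0 subr_eq0.
rewrite -(ler_pM2r s0) -cmodM.
rewrite {1}/dq (negPf sc) [dq f c c]/dq eqxx.
have E : ((f s - f c) / (s - c) - dv f c - k / 2 * (s - c)) * (s - c) =
  f s - f c - (dv f c * (s - c) + k / 2 * (s - c) ^+ 2).
  by field; rewrite subr_eq0.
rewrite E.
have K0 : 0 <= e * cmod (s - c) by rewrite mulr_ge0 ?ltW.
have := @mvi _ (fun u => f u - (dv f c * (u - c) + k / 2 * (u - c) ^+ 2)) c s _ K0 _.
rewrite subrr mulr0 expr0n mulr0 addr0 subr0 [f s - _ - _]addrAC; apply => t ht.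
have ccm : cmod (c - c) < m by rewrite subrr cmod0.
have hp := seg_in ccm hs ht; set p := c + _ in hp *.
exists (dv f p - (dv f c + k / 2 * 2 * (p - c))).
  by apply: isdvB; [apply/dvP/h; lra|exact: isdv_quad].
have -> : dv f p - (dv f c + k / 2 * 2 * (p - c)) = dv f p - dv f c - k * (p - c) by field.
apply: le_trans (Hd _ _) _; first lra.
rewrite ler_wpM2l ?(ltW e0) // /p addrC addKr cmodM cmodC.
case/andP: ht => t0 t1; rewrite ger0_norm //.
by rewrite -[leRHS]mul1r ler_wpM2r ?cmod_ge0.
Qed.

Lemma dq_hol c r f a : cmod (a - c) < r -> hol c r f -> hol c r (dq f a).
Proof.
move=> ha h s hs; have [->|sa] := eqVneq s a.
  apply: (@dq_diff_at a (r - cmod (a - c))); first by rewrite subr_gt0.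
  by apply: (hol_sub h); lra.
by apply: dq_diff_off => //; exact: h.
Qed.

Lemma avg_kernel c a r : cmod (a - c) < r ->
  icont (fun t => (circ c r t - c) / (circ c r t - a)) /\
  avg (fun t => (circ c r t - c) / (circ c r t - a)) = 1.
Proof.
move=> h; have [i0 a0] := avg_pole h; have r0 := le_lt_trans (cmod_ge0 _) h.
have i1 := @icont_cst R 1; have i2 := @icont_cst R (a - c).
have E : (fun t => (circ c r t - c) / (circ c r t - a)) =
         (fun t => 1 + (a - c) * (circ c r t - a)^-1).
  apply/funext => t; have ta : circ c r t - a != 0.
    rewrite subr_eq0; apply: contraTneq h => <-.
    by rewrite circ_dist ?ltxx // ltW.
  by field.
rewrite E; split; first by apply: icontD => //; exact: icontM.
rewrite avgD //; last exact: icontM.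
by rewrite avgZ // a0 avg_cst mulr0 addr0.
Qed.

(** The factor s - c comes from ds = 2 pi i (s - c) dt on the circle. The mean value property is
    applied to (s - c) [dq f a], which vanishes at c. *)
Lemma cauchy c r r' f a : hol c r' f -> r < r' -> cmod (a - c) < r ->
  f a = avg (fun t => f (circ c r t) * ((circ c r t - c) / (circ c r t - a))).
Proof.
move=> h rr' ha; have r0 := le_lt_trans (cmod_ge0 _) ha.
have [i1 a1] := avg_kernel ha.
have ha' : cmod (a - c) < r' by lra.
have hq := dq_hol ha' h.
have hq2 : hol c r' (fun s => (s - c) * dq f a s).
  by move=> s hs; apply: dM (hq _ hs); apply: dB (did _) (dcst _ _).
have := @mean_value _ _ _ _ r hq2; rewrite r0 rr' => /(_ isT).
rewrite subrr mul0r.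
have if1 : icont (fun t => f (circ c r t)).
  by apply: (icont_hol h); rewrite ?subrr ?cmod0 ?add0r // ltW.
have E : avg (fun t => (circ c r t - c) * dq f a (circ c r t)) =
   avg (fun t => f (circ c r t) * ((circ c r t - c) / (circ c r t - a)) -
          f a * ((circ c r t - c) / (circ c r t - a))).
  apply: eq_avg => t _; rewrite /dq; case: eqVneq => E; last by ring.
  by move: ha; rewrite -E circ_dist ?ltxx // ltW.
have i3 := @icont_cst R (f a).
rewrite E avgB; [|exact: icontM|exact: icontM].
by rewrite avgZ // a1 mulr1 => /subr0_eq.
Qed.

Lemma cauchy_bound c r r' f a M : hol c r' f -> r < r' -> cmod (a - c) < r ->
  (forall t, 0 <= t <= 1 -> cmod (f (circ c r t)) <= M) ->
  cmod (f a) <= M * (r / (r - cmod (a - c))).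
Proof.
move=> h rr' ha HM; have r0 := le_lt_trans (cmod_ge0 _) ha.
have [i1 a1] := avg_kernel ha.
have if1 : icont (fun t => f (circ c r t)).
  by apply: (icont_hol h); rewrite ?subrr ?cmod0 ?add0r // ltW.
rewrite (cauchy h rr' ha); apply: avg_bound => [|t ht]; first exact: icontM.
have cr : cmod (circ c r t - c) = r by rewrite circ_dist // ltW.
have rs : 0 < r - cmod (a - c) by rewrite subr_gt0.
rewrite !cmodM cmodV cr; apply: ler_pM;
    rewrite ?cmod_ge0 ?mulr_ge0 ?invr_ge0 ?cmod_ge0 ?(ltW r0) //.
  exact: HM.
rewrite ler_wpM2l ?(ltW r0) // lef_pV2 ?posrE //.
  have := cmod_leB (circ c r t - c) (a - c); rewrite cr.
  by rewrite opprB addrA subrK.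
rewrite cmod_gt0 subr_eq0; apply: contraTneq ha => <-; by rewrite cr ltxx.
Qed.

Lemma icont_bounded (g : R -> C) : icont g ->
  exists2 M, 0 <= M & forall t, 0 <= t <= 1 -> cmod (g t) <= M.
Proof.
move=> [cg]; pose P x y := exists2 M, 0 <= M & forall t, x <= t <= y -> cmod (g t) <= M.
apply: (@bisect1 _ P) => [x y z [M M0 HM] [N N0 HN]|x0 hx0].
  exists (M + N) => [|t /andP[xt tz]]; first exact: addr_ge0.
  have [ty|/ltW yt] := leP t y.
    by apply: le_trans (HM t _) _; rewrite ?xt ?lerDl.
  by apply: le_trans (HN t _) _; rewrite ?yt ?lerDr.
have /contCP/(_ _ ltr01)/nbhs_ballP[d /= d0 Hd] := cg _ hx0.
exists d => // x y xy yxd /andP[xx0 x0y] _ _; exists (cmod (g x0) + 1).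
  by rewrite addr_ge0 ?cmod_ge0.
move=> t /andP[xt ty]; have : ball x0 d t.
  by rewrite /ball /= ltr_norml; apply/andP; split; lra.
by move/Hd => /= h; have := cmodD (g t - g x0) (g x0); rewrite subrK; lra.
Qed.

(** [dq] removes one factor s - c at a time. If this never stops, Cauchy's bound for the k-th
    quotient makes f s at most a constant times (|s - c| / q)^k, hence 0. The quotient g is
    holomorphic on every disc about c on which f is, so zeros can be removed without shrinking a
    larger disc. *)
Lemma factor c r f : 0 < r -> hol c r f ->
  (forall s, cmod (s - c) < r -> f s = 0) \/
  exists n g, [/\ forall c' r', cmod (c - c') < r' -> hol c' r' f -> hol c' r' g,
    g c != 0 & forall s, f s = (s - c) ^+ n * g s].
Proof.
move=> r0 h; pose F n := iter n (fun g => dq g c) f.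
have cc : cmod (c - c) < r by rewrite subrr cmod0.
have hF' n c' r' : cmod (c - c') < r' -> hol c' r' f -> hol c' r' (F n).
  by move=> hc hf; elim: n => [//|n IH]; exact: dq_hol.
have hF n : hol c r (F n) by exact: hF'.
have [[n Hn]|H] := pselect (exists n, F n c != 0).
  right; case: (@ex_minnP (fun n => F n c != 0) (ex_intro _ n Hn)) => {Hn}n Hn Hmin.
  exists n, (F n); split=> [c' r'|//|s]; first exact: hF'.
  have : forall k, (k <= n)%N -> f s = (s - c) ^+ k * F k s.
    elim=> [_|k IH kn]; first by rewrite expr0 mul1r.
    rewrite (IH (ltnW kn)) (dqE (F k) c s).
    have -> : F k c = 0.
      by apply: contraTeq kn => /Hmin; rewrite -leqNgt.
    by rewrite add0r exprSr mulrA.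
  by apply.
left=> s hs.
have F0 n : F n c = 0 by apply: contrapT => E; apply: H; exists n; exact/eqP.
have fE k u : f u = (u - c) ^+ k * F k u.
  elim: k => [|k IH]; first by rewrite expr0 mul1r.
  by rewrite IH (dqE (F k) c u) F0 add0r exprSr mulrA.
pose q := (cmod (s - c) + r) / 2.
have q0 : 0 < q by have := cmod_ge0 (s - c); rewrite /q; lra.
have sq : cmod (s - c) < q by rewrite /q; lra.
have qr : q < r by rewrite /q; lra.
have cq : cmod (c - c) + q < r by rewrite subrr cmod0 add0r.
have [M M0 HM] := icont_bounded (icont_hol h (ltW q0) cq).
pose K := q / (q - cmod (s - c)).
have HF k : cmod (f s) <= M * K * (cmod (s - c) / q) ^+ k.
  rewrite (fE k) cmodM cmodX expr_div_n.
  have : cmod (F k s) <= M / q ^+ k * K.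
    apply: (cauchy_bound (hF k) qr sq) => t ht.
    have := HM t ht; rewrite (fE k) cmodM cmodX circ_dist ?(ltW q0) //.
    by rewrite ler_pdivlMr ?exprn_gt0 // mulrC.
  move=> /(ler_wpM2l (exprn_ge0 k (cmod_ge0 (s - c)))) /le_trans; apply.
  by rewrite le_eqVlt; apply/orP; left; apply/eqP; ring.
apply/eqP; rewrite -cmod_eq0 eq_le cmod_ge0 andbT.
have rat : `|cmod (s - c) / q| < 1.
  have q1 : 0 <= cmod (s - c) / q by apply: divr_ge0; [exact: cmod_ge0|exact: ltW].
  by rewrite (ger0_norm q1) ltr_pdivrMr // mul1r.
have lim : M * K * (cmod (s - c) / q) ^+ k @[k --> \oo] --> M * K * 0.
  by apply: cvgM; [exact: cvg_cst|exact: cvg_expr].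
rewrite mulr0 in lim.
apply/ler_addgt0Pl => e e0; rewrite addr0.
have /cvgrPdist_lt/(_ _ e0)[N _ HN] := lim.
have := HN N (leqnn N); rewrite /= sub0r normrN => hN.
by apply: le_trans (HF N) _; apply: le_trans (ler_norm _) (ltW hN).
Qed.

End CauchyFormula.

Section Zeros.
Variable R : realType.
Local Notation C := R[i].
Local Notation "x %:C" := (real_complex R x) : ring_scope.
Implicit Types (f g : C -> C) (c s z w : C) (r e d t M K q : R).

Lemma seg_conn (Z : C -> Prop) (a b : C) :
  (forall t, 0 <= t <= 1 -> exists2 d, 0 < d &
     (forall s, cmod (s - (a + t%:C * (b - a))) < d -> Z s) \/
     (forall s, cmod (s - (a + t%:C * (b - a))) < d -> ~ Z s)) ->
  Z a -> Z b.
Proof.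
move=> H; pose G t := a + t%:C * (b - a).
have -> : b = G 1 by rewrite /G rmorph1 mul1r addrC subrK.
have -> : a = G 0 by rewrite /G rmorph0 mul0r addr0.
apply: (@bisect1 _ (fun x y => Z (G x) -> Z (G y))) => [x y z h1 h2 /h1 //|x0 hx0].
have [d d0 Hd] := H _ hx0.
have B0 : 0 < cmod (b - a) + 1 by rewrite ltr_wpDl ?cmod_ge0.
exists (d / (cmod (b - a) + 1)) => [|x y xy yx /andP[h1 h2] _ _]; first exact: divr_gt0.
have near u : x <= u <= y -> cmod (G u - G x0) < d.
  move=> /andP[xu uy]; have -> : G u - G x0 = (u - x0)%:C * (b - a).
    by rewrite /G rmorphB /=; ring.
  rewrite cmodM cmodC.
  have ux : `|u - x0| <= y - x by rewrite ler_norml; apply/andP; split; lra.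
  have k1 : `|u - x0| * cmod (b - a) <= (y - x) * cmod (b - a) by rewrite ler_wpM2r ?cmod_ge0.
  have k2 : (y - x) * (cmod (b - a) + 1) < d by rewrite -ltr_pdivlMr.
  by move: k1 k2; rewrite mulrDr; lra.
case: Hd => Hd; first by move=> _; apply/Hd/near; rewrite lexx ltW.
by move=> Zx; exfalso; apply: Hd Zx; apply: near; rewrite lexx ltW.
Qed.

Lemma zero_dich c r f : 0 < r -> hol c r f -> exists2 d, 0 < d &
  (forall s, cmod (s - c) < d -> f s = 0) \/
  (forall s, 0 < cmod (s - c) < d -> f s != 0).
Proof.
move=> r0 h; have cc : cmod (c - c) < r by rewrite subrr cmod0.
have [f0|[n [g [hg gc fE]]]] := factor r0 h; first by exists r => //; left.
have gcp : 0 < cmod (g c) by rewrite cmod_gt0.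
have /cont1P/(_ _ gcp)[d d0 Hd] := hol_cont (hg _ _ cc h) cc.
exists d => //; right=> s /andP[s0 sd].
rewrite fE mulf_neq0 ?expf_neq0 // -cmod_gt0 //.
by have := Hd _ sd; rewrite cmod_subC => h1; have := cmod_leB (g c) (g s); lra.
Qed.

Lemma ident_seg f a b : (forall t, 0 <= t <= 1 -> exists2 d, 0 < d &
    hol (a + t%:C * (b - a)) d f) ->
  (exists2 d, 0 < d & forall s, cmod (s - a) < d -> f s = 0) ->
  exists2 d, 0 < d & forall s, cmod (s - b) < d -> f s = 0.
Proof.
move=> H; apply: (@seg_conn (fun p => exists2 d, 0 < d & forall s, cmod (s - p) < d -> f s = 0)).
move=> t ht; have [r r0 hr] := H t ht; have [d d0 Hd] := zero_dich r0 hr.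
set p := a + _ in hr Hd *; exists d => //; case: Hd => Hd; [left|right] => s hs.
  exists (d - cmod (s - p)) => [|u hu]; first by rewrite subr_gt0.
  by apply: Hd; have := cmod_triB u s p; lra.
move=> [d' d'0 Hd'].
have [m [m0 m1 m2]] : exists m, [/\ 0 < m, m < d' & m < d - cmod (s - p)].
  by apply: lt_both => //; rewrite subr_gt0.
have [sp|sp] := eqVneq s p.
  have := Hd (p + m%:C); rewrite addrC addKr cmodC gtr0_norm // m0 => /(_ _)/negP[].
    by move: m2; rewrite sp subrr cmod0 subr0.
  by apply/eqP/Hd'; rewrite sp addrC addKr cmodC gtr0_norm.
have := Hd s; rewrite cmod_gt0 subr_eq0 sp hs => /(_ isT)/negP; apply.
by apply/eqP/Hd'; rewrite subrr cmod0.
Qed.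

Lemma ident c r f a : hol c r f -> cmod (a - c) < r ->
  (exists2 d, 0 < d & forall s, cmod (s - a) < d -> f s = 0) ->
  forall s, cmod (s - c) < r -> f s = 0.
Proof.
move=> h ha H s hs.
suff [d d0 Hd] : exists2 d, 0 < d & forall u, cmod (u - s) < d -> f u = 0.
  by apply: Hd; rewrite subrr cmod0.
apply: (ident_seg _ H) => t ht; have hp := seg_in ha hs ht; set p := a + _ in hp *.
exists (r - cmod (p - c)); first by rewrite subr_gt0.
by apply: (hol_sub h); lra.
Qed.

Lemma fin_sep (E : seq C) (e : C) : e \notin E -> exists2 d, 0 < d & forall u, u \in E ->
    d <= cmod (u - e).
Proof.
elim: E => [_|a E IH]; first by exists 1.
rewrite inE negb_or => /andP[ea /IH[d d0 Hd]].
have a0 : 0 < cmod (a - e) by rewrite cmod_gt0 subr_eq0 eq_sym.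
have [m [m0 m1 m2]] := lt_both d0 a0; exists m => // u; rewrite inE => /orP[/eqP->|/Hd].
  exact: ltW.
by apply: le_trans; exact: ltW.
Qed.

(** (s - c)^2 f, set to 0 at c, is differentiable there with derivative 0; two divisions by s - c
    give the extension. *)
Lemma riemann_punct c r f M : 0 < r ->
  (forall s, 0 < cmod (s - c) < r -> differentiable f s) ->
  (forall s, 0 < cmod (s - c) < r -> cmod (f s) <= M) ->
  exists2 g, hol c r g & forall s, 0 < cmod (s - c) < r -> g s = f s.
Proof.
move=> r0 hf HM; pose h s := (s - c) * ((s - c) * f s).
have cc : cmod (c - c) < r by rewrite subrr cmod0.
have hc0 : h c = 0 by rewrite /h subrr mul0r.
have dh0 : isdv h c 0.
  move=> e e0; have M1 : 0 < `|M| + 1 by rewrite ltr_wpDl.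
  have [d [d0 d1 d2]] := lt_both r0 (divr_gt0 e0 M1).
  exists d => // s hs; rewrite hc0 subr0 mul0r subr0 /h.
  have [->|sc] := eqVneq s c; first by rewrite subrr !mul0r !cmod0 mulr0.
  have s0 : 0 < cmod (s - c) by rewrite cmod_gt0 subr_eq0.
  have fM := HM s; rewrite s0 (lt_trans hs d1) in fM; have {}fM := fM isT.
  rewrite cmodM mulrC ler_wpM2r ?cmod_ge0 // cmodM.
  have h1 : cmod (s - c) * cmod (f s) <= cmod (s - c) * (`|M| + 1).
    rewrite ler_wpM2l ?cmod_ge0 //; apply: le_trans fM _.
    by apply: le_trans (ler_norm _) _; rewrite lerDl.
  apply: le_trans h1 _; rewrite -ler_pdivlMr //; lra.
have hh : hol c r h.
  move=> s hs; have [->|sc] := eqVneq s c; first exact: isdv_diff dh0.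
  have s0 : 0 < cmod (s - c) by rewrite cmod_gt0 subr_eq0.
  have ds : differentiable (fun s => s - c) s by apply: dB (did _) (dcst _ _).
  by apply: (dM ds (dM ds (hf s _))); rewrite s0.
exists (dq (dq h c) c); first by apply: dq_hol => //; exact: dq_hol.
move=> s /andP[s0 sr]; have sc : s != c by rewrite -subr_eq0 -cmod_gt0.
rewrite {1}/dq (negPf sc) /dq (negPf sc) eqxx (dvE dh0) hc0 !subr0 /h.
by field; rewrite subr_eq0.
Qed.

(** The points of E are filled in one by one, the bound growing by the value at the new point;
    repetitions and points outside the disc are skipped. *)
Lemma riemann_fin c r (E : seq C) f M :
  (forall s, cmod (s - c) < r -> s \notin E -> differentiable f s) ->
  (forall s, cmod (s - c) < r -> s \notin E -> cmod (f s) <= M) ->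
  exists2 g, hol c r g & forall s, cmod (s - c) < r -> s \notin E -> g s = f s.
Proof.
elim: E f M => [|a E IH] f M hf HM; first by exists f => // s hs; exact: hf.
have [aE|aE] := boolP (a \in E).
  have EE s : s \notin E -> s \notin a :: E.
    by move=> sE; rewrite inE negb_or sE andbT; apply: contraNneq sE => ->.
  have [|//|g hg gE] := IH f M; first by move=> s hs /EE; exact: hf.
    by move=> s hs /EE; exact: HM.
  by exists g => // s hs; rewrite inE negb_or => /andP[_]; exact: gE.
have [ar|ra] := ltP (cmod (a - c)) r; last first.
  have EE s : cmod (s - c) < r -> s \notin E -> s \notin a :: E.
    move=> hs sE; rewrite inE negb_or sE andbT; apply: contraTneq hs => ->.
    by rewrite -leNgt.
  have [|//|g hg gE] := IH f M; first by move=> s hs /(EE _ hs); exact: hf.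
    by move=> s hs /(EE _ hs); exact: HM.
  by exists g => // s hs; rewrite inE negb_or => /andP[_]; exact: gE.
have [d d0 Hd] := fin_sep aE.
have ra : 0 < r - cmod (a - c) by rewrite subr_gt0.
have [m [m0 m1 m2]] := lt_both d0 ra.
have nE s : 0 < cmod (s - a) < m -> s \notin a :: E /\ cmod (s - c) < r.
  move=> /andP[s0 sm]; split; last by have := cmod_triB s a c; lra.
  rewrite inE negb_or -subr_eq0 -cmod_gt0 s0 /=.
  by apply/negP => /Hd; lra.
have [|s /nE[h1 h2]|g hg gE] := @riemann_punct a m f M m0.
  by move=> s /nE[h1 h2]; exact: hf.
  exact: HM.
pose f1 s := if s == a then g a else f s.
have f1g s : cmod (s - a) < m -> f1 s = g s.
  move=> sm; rewrite /f1; case: eqVneq => [->//|sa].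
  by rewrite gE // sm cmod_gt0 subr_eq0 sa.
have [|s hs sE|h hh hE] := IH f1 (`|M| + cmod (g a)).
- move=> s hs sE; have [->|sa] := eqVneq s a.
    apply: (@eq_differentiable _ g _ _ m m0) => [u hu|]; first by rewrite f1g.
    by apply: hg; rewrite subrr cmod0.
  have s0 : 0 < cmod (s - a) by rewrite cmod_gt0 subr_eq0.
  apply: (@eq_differentiable _ f _ _ _ s0) => [u hu|].
    by rewrite /f1; case: eqVneq => // ua; move: hu; rewrite ua cmod_subC ltxx.
  by apply: hf => //; rewrite inE negb_or sa.
- rewrite /f1; case: eqVneq => [_|sa]; first by rewrite lerDr.
  apply: (@le_trans _ _ M); first by apply: HM => //; rewrite inE negb_or sa.
  by apply: le_trans (ler_norm _) _; rewrite lerDl cmod_ge0.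
exists h => // s hs; rewrite inE negb_or => /andP[sa sE].
by rewrite hE // /f1 (negPf sa).
Qed.

(** Compactness of the closed disc for an ideal [Q] of sets, by bisection of the circumscribed
    square. *)
Lemma disc_cover c q (Q : set C -> Prop) : 0 < q ->
  (forall S S' : set C, S `<=` S' -> Q S' -> Q S) ->
  (forall S S', Q S -> Q S' -> Q (S `|` S')) ->
  (forall p, cmod (p - c) <= q -> exists2 d, 0 < d & Q [set s | cmod (s - p) < d]) ->
  Q [set s | cmod (s - c) <= q].
Proof.
move=> q0 Qsub QU Qloc.
pose G x y : C := c + Complex (2 * q * x - q) (2 * q * y - q).
pose K x y l := [set s | cmod (s - c) <= q /\
  exists x' y', [/\ x <= x' <= x + l, y <= y' <= y + l & s = G x' y']].
have Q0 : Q set0.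
  have [|d d0 Qd] := Qloc c; first by rewrite subrr cmod0 ltW.
  by apply: Qsub Qd; exact: sub0set.
have QK : Q (K 0 0 1).
  apply: (@bisect2 _ (fun x y l => Q (K x y l))) => [x y l l0 h1 h2 h3 h4|x0 y0 hx0 hy0].
    apply: (Qsub _ _ _ (QU _ _ (QU _ _ h1 h2) (QU _ _ h3 h4))).
    move=> s [sq [x' [y' [/andP[hx1 hx2] /andP[hy1 hy2] sE]]]].
    have E a : a + l / 2 + l / 2 = a + l by rewrite -addrA -splitr.
    have [xl|/ltW xl] := leP x' (x + l / 2); have [yl|/ltW yl] := leP y' (y + l / 2).
    - by left; left; split=> //; exists x', y'; rewrite hx1 hy1 xl yl.
    - by right; left; split=> //; exists x', y'; rewrite hx1 xl yl E hy2.
    - by left; right; split=> //; exists x', y'; rewrite hy1 xl yl E hx2.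
    - by right; right; split=> //; exists x', y'; rewrite xl yl !E hx2 hy2.
  have Gd x y l x' y' : x <= x0 <= x + l -> y <= y0 <= y + l -> x <= x' <= x + l ->
      y <= y' <= y + l -> cmod (G x' y' - G x0 y0) <= 4 * q * l.
    move=> /andP[a1 a2] /andP[b1 b2] /andP[a3 a4] /andP[b3 b4].
    apply: le_trans (cmod_le_ReIm _) _; rewrite /G.
    have -> : c + Complex (2 * q * x' - q) (2 * q * y' - q) -
      (c + Complex (2 * q * x0 - q) (2 * q * y0 - q)) =
      Complex (2 * q * (x' - x0)) (2 * q * (y' - y0)).
      by rewrite opprD addrACA subrr add0r; apply/eqP; rewrite eq_complex /=;
         apply/andP; split; apply/eqP; ring.
    rewrite /= !normrM !(gtr0_norm q0) !(@ger0_norm _ 2) //.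
    have h1 : `|x' - x0| <= l by rewrite ler_norml; apply/andP; split; lra.
    have h2 : `|y' - y0| <= l by rewrite ler_norml; apply/andP; split; lra.
    have := ler_wpM2l (ltW q0) h1; have := ler_wpM2l (ltW q0) h2; lra.
  have q4 : 0 < 4 * q by rewrite mulr_gt0.
  (* Parts of the square lie outside the disc; small squares around such a point miss the disc and
     are covered by [Q0]. *)
  have [hp|hp] := leP (cmod (G x0 y0 - c)) q; last first.
    exists ((cmod (G x0 y0 - c) - q) / (4 * q)) => [|x y l l0].
      by rewrite divr_gt0 ?subr_gt0.
    rewrite ltr_pdivlMr // => hl hx hy _ _ _ _.
    apply: Qsub Q0 => s [hq [x' [y' [hx' hy' sE]]]]; have := Gd _ _ _ _ _ hx hy hx' hy'.
    rewrite -sE; have := cmod_triB (G x0 y0) s c; rewrite [cmod (_ - s)]cmod_subC.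
    by move=> *; exfalso; lra.
  have [d d0 Qd] := Qloc _ hp.
  exists (d / (4 * q)) => [|x y l l0]; first by rewrite divr_gt0.
  rewrite ltr_pdivlMr // => hl hx hy _ _ _ _.
  apply: Qsub Qd => s [_ [x' [y' [hx' hy' ->]]]] /=.
  by have := Gd _ _ _ _ _ hx hy hx' hy'; lra.
apply: Qsub QK => s /= hs; split=> //.
have hR := normr_Re (s - c); have hI := normr_Im (s - c).
pose x := (complex.Re (s - c) + q) / (2 * q); pose y := (complex.Im (s - c) + q) / (2 * q).
have q2 : 0 < 2 * q by rewrite mulr_gt0.
exists x, y.
have in01 u : `|u| <= cmod (s - c) -> 0 <= (u + q) / (2 * q) <= 0 + 1.
  move=> hu; have := le_trans hu hs; rewrite ler_norml => /andP[u1 u2].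
  by rewrite divr_ge0 ?(ltW q2) ?ler_pdivrMr //=; lra.
split; rewrite ?in01 //.
rewrite /G /x /y !(mulrC (2 * q)) !divfK ?gt_eqF // !addrK.
have -> : Complex (complex.Re (s - c)) (complex.Im (s - c)) = s - c by case: (s - c).
by rewrite addrC subrK.
Qed.

Lemma fin_zeros c r q f : hol c r f -> 0 < q < r ->
  (exists2 s, cmod (s - c) < r & f s != 0) ->
  exists E : seq C, forall s, cmod (s - c) <= q -> f s = 0 -> s \in E.
Proof.
move=> h /andP[q0 qr] [s0 hs0 fs0].
apply: (@disc_cover c q (fun S => exists E : seq C, forall s, S s -> f s = 0 -> s \in E)) => //.
- by move=> S S' SS' [E HE]; exists E => s /SS'; exact: HE.
- move=> S S' [E HE] [E' HE']; exists (E ++ E') => s [] Ss fs; rewrite mem_cat.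
    by rewrite HE.
  by rewrite HE' ?orbT.
move=> p hp; have pr : cmod (p - c) < r by lra.
have rp : 0 < r - cmod (p - c) by lra.
have hh : hol p (r - cmod (p - c)) f by apply: (hol_sub h); lra.
have [d d0 [Hd|Hd]] := zero_dich rp hh.
  by case/negP: fs0; apply/eqP; apply: (ident h pr _ hs0); exists d.
exists d => //; exists [:: p] => s /= sd fs; rewrite inE.
have := Hd s; rewrite fs eqxx sd andbT cmod_gt0 subr_eq0.
by case: eqVneq => // _ /(_ isT).
Qed.

End Zeros.

(** * Power sums of the zeros *)

Section PowerSums.
Variable R : realType.
Local Notation C := R[i].
Local Notation "x %:C" := (real_complex R x) : ring_scope.
Implicit Types (f g : C -> C) (c s z w : C) (r e d t M K q : R).

(** The contour integral of s^k f' / f over 2 pi i, which is the sum of the k-th powers of the zeros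
    in the disc, counted with multiplicity. *)
Definition psum f c q (k : nat) : C :=
  avg (fun t => let s := circ c q t in (s - c) * s ^+ k * (dv f s / f s)).

Lemma isdv_lin f a s k : isdv f s k -> isdv (fun u => (u - a) * f u) s (f s + (s - a) * k).
Proof.
move=> h e e0.
pose K := cmod (s - a) + 1 + cmod k.
have K0 : 0 < K by rewrite /K -addrA ltr_wpDl ?cmod_ge0 // ltr_pwDl ?cmod_ge0.
have e1 : 0 < e / K by rewrite divr_gt0.
have [d d0 Hd] := h _ e1.
have [m1 [m10 m11 m12]] := lt_both d0 e1.
have [m [m0 m2 m3]] := lt_both m10 (@ltr01 R).
exists m => // u hu; have {}Hd := Hd u (lt_trans (lt_trans hu m2) m11).
rewrite (_ : _ - _ - _ = (u - a) * (f u - f s - k * (u - s)) + k * (u - s) * (u - s));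
    last by ring.
apply: le_trans (cmodD _ _) _; rewrite !cmodM.
have h1 : cmod (u - a) <= cmod (s - a) + 1 by have := cmod_triB u s a; lra.
have h2 : cmod (u - a) * cmod (f u - f s - k * (u - s)) <= (cmod (s - a) + 1) * (e / K * cmod (u - s)).
  by apply: ler_pM; rewrite ?cmod_ge0.
have h3 : cmod k * cmod (u - s) * cmod (u - s) <= cmod k * (e / K) * cmod (u - s).
  rewrite ler_wpM2r ?cmod_ge0 // ler_wpM2l ?cmod_ge0 //; lra.
apply: le_trans (lerD h2 h3) _.
have -> : (cmod (s - a) + 1) * (e / K * cmod (u - s)) + cmod k * (e / K) * cmod (u - s) =
   K * (e / K) * cmod (u - s) by rewrite /K; ring.
by rewrite mulrCA divff ?gt_eqF // mulr1.
Qed.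

Lemma icont_psum f c r q k : hol c r f -> 0 < q < r ->
  (forall s, cmod (s - c) = q -> f s != 0) ->
  icont (fun t => let s := circ c q t in (s - c) * s ^+ k * (dv f s / f s)).
Proof.
move=> h /andP[q0 qr] nz.
apply: (@icont_circ _ (fun s => (s - c) * s ^+ k * (dv f s / f s))); first exact: ltW.
move=> s hs; apply: differentiable_continuous.
have sr : cmod (s - c) < r by rewrite hs.
apply: dM.
  by apply: dM; [apply: dB (did _) (dcst _ _)|apply: dX (did _)].
by apply: dM; [apply: (dv_hol h)|apply: dV; [exact: h|exact: nz]].
Qed.

(** The logarithmic derivative turns the factor s - a into a summand 1 / (s - a), and Cauchy's
    formula evaluates its contribution. *)
Lemma psum_step f c r q k a : hol c r f -> 0 < q < r -> cmod (a - c) < q ->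
  (forall s, cmod (s - c) = q -> f s != 0) ->
  psum (fun s => (s - a) * f s) c q k = a ^+ k + psum f c q k.
Proof.
move=> h /andP[q0 qr] ha nz.
have [i1 a1] := avg_kernel ha.
have hk : hol c r (fun s => s ^+ k) by move=> s _; exact: dX (did _).
rewrite [a ^+ k](@cauchy _ c q r (fun s => s ^+ k) a hk qr ha).
have i2 : icont (fun t => circ c q t ^+ k).
  by apply: (icont_hol hk); rewrite ?subrr ?cmod0 ?add0r // ltW.
rewrite /psum -avgD; [|exact: icontM|apply: icont_psum h _ nz; rewrite q0 qr //].
apply: eq_avg => t _ /=.
set s := circ c q t; have hs : cmod (s - c) = q by rewrite circ_dist // ltW.
have sa : s - a != 0 by rewrite subr_eq0; apply: contraTneq ha => <-; rewrite hs ltxx.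
have fs := nz _ hs.
rewrite (dvE (isdv_lin a (dvP (h s _)))); last by rewrite hs.
by field; rewrite sa fs.
Qed.

(** The integrand is holomorphic on a slightly larger disc and vanishes at the centre through its
    factor s - c. *)
Lemma psum_nz f c r q k : hol c r f -> 0 < q < r ->
  (forall s, cmod (s - c) <= q -> f s != 0) -> psum f c q k = 0.
Proof.
move=> h /andP[q0 qr] nz.
have q1 : q < (q + r) / 2 < r by apply/andP; split; lra.
have q1' : 0 < (q + r) / 2 < r by apply/andP; split; lra.
have cc0 : cmod (c - c) <= q by rewrite subrr cmod0 ltW.
have ccr : cmod (c - c) < r by lra.
have [E HE] := fin_zeros h q1' (ex_intro2 _ _ c ccr (nz c cc0)).
(* No point of the finite list lies in the open disc of radius [q2] but outside the closed one of
   radius q. *)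
have [q2 [q21 q22]] : exists q2, [/\ q < q2, q2 < (q + r) / 2 &
    forall u, u \in E -> cmod (u - c) < q2 -> cmod (u - c) <= q].
  elim: (E) => [|a E' [q2 [h1 h2 h3]]].
    by exists ((q + (q + r) / 2) / 2); split; [lra|lra|].
  have [ha|ha] := leP (cmod (a - c)) q.
    by exists q2; split=> // u; rewrite inE => /orP[/eqP->|/h3].
  have ha0 : 0 < cmod (a - c) - q by rewrite subr_gt0.
  have h10 : 0 < q2 - q by rewrite subr_gt0.
  have [m [m0 m1 m2]] := lt_both ha0 h10.
  exists (q + m); split; [lra|lra|] => u; rewrite inE => /orP[/eqP->|uE hu]; first lra.
  by apply: h3 => //; lra.
move=> Hq2; have h2 : hol c q2 (fun s => (s - c) * s ^+ k * (dv f s / f s)).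
  move=> s hs; have sr : cmod (s - c) < r by lra.
  apply: dM.
    by apply: dM; [apply: dB (did _) (dcst _ _)|apply: dX (did _)].
  apply: dM; first exact: (dv_hol h).
  apply: dV; first exact: h.
  apply/eqP => fs; have := nz s (Hq2 _ (HE s _ fs) hs); rewrite fs eqxx => /(_ _)/negP; apply =>
      //.
  lra.
rewrite /psum /= (mean_value h2); last by rewrite q0.
by rewrite subrr !mul0r.
Qed.

(** Induction on a list containing the zeros: entries outside the closed disc are dropped, the
    others divided out as often as [factor] allows, possibly zero times. *)
Lemma roots_list c r q f : hol c r f -> 0 < q < r ->
  (exists2 s, cmod (s - c) < r & f s != 0) ->
  exists (rs : seq C) g, [/\ hol c r g, forall s, f s = \prod_(a <- rs) (s - a) * g s,
     forall a, a \in rs -> cmod (a - c) <= q & forall s, cmod (s - c) <= q -> g s != 0].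
Proof.
move=> h hq; have /andP[q0 qr] := hq.
move=> ex; have [E HE] := fin_zeros h hq ex.
elim: E f h ex HE => [|e E IH] f h ex HE.
  exists [::], f; split=> // [s|s hs]; first by rewrite big_nil mul1r.
  by apply/eqP => /(HE s hs).
have [eq|qe] := leP (cmod (e - c)) q; last first.
  apply: IH => // s hs /(HE s hs); rewrite inE => /orP[/eqP es|//].
  by move: qe; rewrite -es ltNge hs.
have re : 0 < r - cmod (e - c) by lra.
have her : hol e (r - cmod (e - c)) f by apply: (hol_sub h); lra.
have [f0|[n [g [hg ge fE]]]] := factor re her.
  case: ex => s hs /negP[]; apply/eqP; apply: (ident h (a := e) _ _ hs); first lra.
  by exists (r - cmod (e - c)).
have er : cmod (e - c) < r by lra.
have exg : exists2 s, cmod (s - c) < r & g s != 0 by exists e.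
have HEg s : cmod (s - c) <= q -> g s = 0 -> s \in E.
  move=> hs gs; have : s \in e :: E by apply: HE => //; rewrite fE gs mulr0.
  by rewrite inE => /orP[/eqP es|//]; move: ge; rewrite -es gs eqxx.
have [rs [g' [h1 h2 h3 h4]]] := IH g (hg _ _ er h) exg HEg.
exists (nseq n e ++ rs), g'; split=> //.
  by move=> s; rewrite fE h2 big_cat /= mulrA; congr (_ * _ * _); rewrite big_nseq iter_mulr_1.
by move=> a; rewrite mem_cat mem_nseq => /orP[/andP[_ /eqP->]//|/h3].
Qed.

Lemma psum_roots c r q f : hol c r f -> 0 < q < r ->
  (forall s, cmod (s - c) = q -> f s != 0) ->
  exists rs : seq C, (forall a, (a \in rs) = (cmod (a - c) < q) && (f a == 0)) /\
    forall k, psum f c q k = \sum_(a <- rs) a ^+ k.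
Proof.
move=> h hq nz; have /andP[q0 qr] := hq.
have hc : cmod (circ c q 0 - c) = q by rewrite circ_dist // ltW.
have [|rs [g [hg fE rsq gnz]]] := @roots_list c r q f h hq.
  by exists (circ c q 0); [rewrite hc|exact: nz].
have f0 a : a \in rs -> f a = 0.
  move=> ar; rewrite fE; suff -> : \prod_(b <- rs) (a - b) = 0 by rewrite mul0r.
  by rewrite (big_rem a) //= subrr mul0r.
exists rs; split=> [a|k].
  apply/idP/andP => [ar|[aq]].
    rewrite f0 //; split=> //; rewrite lt_neqAle rsq // andbT.
    by apply/eqP => /nz; rewrite f0 // eqxx.
  rewrite fE mulf_eq0 (negPf (gnz a (ltW aq))) orbF prodf_seq_eq0.
  by move=> /hasP[b br /=]; rewrite subr_eq0 => /eqP->.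
have {f0} rsq' a : a \in rs -> cmod (a - c) < q.
  move=> ar; rewrite lt_neqAle rsq // andbT.
  by apply/eqP => /nz; rewrite f0 // eqxx.
have ef : f = (fun s => \prod_(a <- rs) (s - a) * g s) by apply/funext => s; exact: fE.
rewrite ef {ef}.
have gnz' s : cmod (s - c) = q -> g s != 0 by move=> hs; apply: gnz; rewrite hs.
have hprod (l : seq C) : hol c r (fun s => \prod_(a <- l) (s - a) * g s).
  move=> s hs; apply: dM (hg _ hs); elim: l => [|a l IH].
    by under eq_fun do rewrite big_nil; exact: dcst.
  by under eq_fun do rewrite big_cons; apply: dM IH; apply: dB (did _) (dcst _ _).
elim: rs rsq' {fE rsq} => [|a rs IH] rsq.
  rewrite big_nil; under [X in psum X]eq_fun do rewrite big_nil mul1r.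
  exact: psum_nz hg hq gnz.
rewrite big_cons -IH; last by move=> b br; apply: rsq; rewrite inE br orbT.
under [X in psum X]eq_fun do rewrite big_cons -mulrA.
apply: (psum_step k (hprod rs) hq); first by apply: rsq; rewrite inE eqxx.
move=> s hs; rewrite mulf_neq0 ?gnz' // prodf_seq_neq0; apply/allP => b br /=.
rewrite subr_eq0; apply: contraTneq (rsq b _) => [<-|]; first by rewrite hs ltxx.
by rewrite inE br orbT.
Qed.

End PowerSums.

(** * Holomorphic functions of several variables *)

Section SeveralVariables.
Variable R : realType.
Local Notation C := R[i].
Local Notation "x %:C" := (real_complex R x) : ring_scope.
Variable V : normedModType C.
Implicit Types (f g : V -> C) (c s : C) (x y z u b : V) (r e d t M q : R).

Definition vmod (x : V) : R := complex.Re `|x|.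

Lemma vmodE x : `|x| = (vmod x)%:C.
Proof.
rewrite /vmod; have := normr_ge0 x; case: (`|x|) => a b /ger0_Im /= ->; by [].
Qed.

Lemma vmod_ge0 x : 0 <= vmod x.
Proof. by rewrite -lecR -vmodE normr_ge0. Qed.

Lemma vmodD x y : vmod (x + y) <= vmod x + vmod y.
Proof. by rewrite -lecR rmorphD /= -!vmodE; exact: ler_normD. Qed.

Lemma vmodZ s x : vmod (s *: x) = cmod s * vmod x.
Proof. by apply: complexI; rewrite rmorphM /= -!vmodE -cmodE; exact: normrZ. Qed.

Lemma vmod_triB x y z : vmod (x - z) <= vmod (x - y) + vmod (y - z).
Proof. by apply: le_trans (vmodD _ _); rewrite addrA subrK. Qed.

Lemma vmod0 : vmod 0 = 0.
Proof. by rewrite /vmod normr0. Qed.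

Lemma vmod_subC x y : vmod (x - y) = vmod (y - x).
Proof. by rewrite /vmod distrC. Qed.

Lemma nbhsVP (z : V) (U : set V) :
  nbhs z U <-> exists2 d : R, 0 < d & forall y, vmod (y - z) < d -> U y.
Proof.
split.
  move=> /nbhs_ballP[e /= /cpos_real[d d0 ->] H]; exists d => // s hs; apply: H.
  by rewrite -ball_normE /= vmodE ltcR vmod_subC.
move=> [d d0 H]; apply/nbhs_ballP; exists d%:C => /=; first by rewrite ltcR.
by move=> s; rewrite -ball_normE /= vmodE ltcR vmod_subC => /H.
Qed.

Lemma seg_inV z r y y' t : vmod (y - z) < r -> vmod (y' - z) < r -> 0 <= t <= 1 ->
  vmod (y + t%:C *: (y' - y) - z) < r.
Proof.
move=> h h' /andP[t0 t1].
rewrite (_ : _ - z = (1 - t)%:C *: (y - z) + t%:C *: (y' - z)); last first.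
  rewrite rmorphB rmorph1 /= scalerBl scale1r -[RHS]addrA [X in _ = _ + X]addrC -scalerBr.
  by rewrite [- (y - z)]opprB [y' - z + _]addrA subrK addrAC.
apply: le_lt_trans (vmodD _ _) _; rewrite !vmodZ !cmodC !ger0_norm ?subr_ge0 //.
have h1 : (1 - t) * vmod (y - z) <= (1 - t) * Num.max (vmod (y - z)) (vmod (y' - z)).
  by rewrite ler_wpM2l ?subr_ge0 // le_max lexx.
have h2 : t * vmod (y' - z) <= t * Num.max (vmod (y - z)) (vmod (y' - z)).
  by rewrite ler_wpM2l // le_max lexx orbT.
apply: le_lt_trans (lerD h1 h2) _; rewrite -mulrDl subrK mul1r.
by rewrite gt_max h h'.
Qed.

(** Continuity and complex differentiability on lines, instead of full differentiability: it passes
    to means over a parameter by one-variable arguments, and the zeros are only ever studied on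
    lines. *)
Definition hol1 f z := {for z, continuous f} /\
  forall u, differentiable (fun h : C => f (z + h *: u)) 0.

Definition nhol f z := \forall y \near z, hol1 f y.

Lemma nhol_hol1 f z : nhol f z -> hol1 f z.
Proof. exact: nbhs_singleton. Qed.

Lemma nhol_near f z : nhol f z -> \forall y \near z, nhol f y.
Proof. exact: near_join. Qed.

Lemma hol1_cst (k : C) z : hol1 (fun=> k) z.
Proof. by split; [exact: cvg_cst|move=> u; exact: dcst]. Qed.

Lemma hol1D f g z : hol1 f z -> hol1 g z -> hol1 (fun y => f y + g y) z.
Proof.
move=> [cf df] [cg dg]; split=> [|u]; last exact: (dD (df u) (dg u)).
by apply: cvgD; [exact: cf|exact: cg].
Qed.

Lemma hol1B f g z : hol1 f z -> hol1 g z -> hol1 (fun y => f y - g y) z.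
Proof.
move=> [cf df] [cg dg]; split=> [|u]; last exact: (dB (df u) (dg u)).
by apply: cvgB; [exact: cf|exact: cg].
Qed.

Lemma hol1M f g z : hol1 f z -> hol1 g z -> hol1 (fun y => f y * g y) z.
Proof.
move=> [cf df] [cg dg]; split=> [|u]; last exact: (dM (df u) (dg u)).
by apply: cvgM; [exact: cf|exact: cg].
Qed.

Lemma hol1V f z : hol1 f z -> f z != 0 -> hol1 (fun y => (f y)^-1) z.
Proof.
move=> [cf df] fz; split=> [|u]; first by apply: cvgV; [exact: fz|exact: cf].
by apply: (dV (df u)); rewrite scale0r addr0.
Qed.

Lemma hol1_sum (I : Type) (l : seq I) (P : pred I) (F : I -> V -> C) z :
  (forall i, hol1 (F i) z) -> hol1 (fun y => \sum_(i <- l | P i) F i y) z.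
Proof.
move=> h; elim: l => [|i l IH].
  by rewrite (_ : (fun y => _) = fun=> 0); [exact: hol1_cst|apply/funext => y; rewrite big_nil].
have [Pi|nPi] := boolP (P i).
  rewrite (_ : (fun y => _) = fun y => F i y + \sum_(j <- l | P j) F j y); first exact: hol1D.
  by apply/funext => y; rewrite big_cons Pi.
rewrite (_ : (fun y => _) = fun y => \sum_(j <- l | P j) F j y) //.
by apply/funext => y; rewrite big_cons (negPf nPi).
Qed.

Lemma hol1_prod (I : Type) (l : seq I) (P : pred I) (F : I -> V -> C) z :
  (forall i, P i -> hol1 (F i) z) -> hol1 (fun y => \prod_(i <- l | P i) F i y) z.
Proof.
move=> h; elim: l => [|i l IH].
  by rewrite (_ : (fun y => _) = fun=> 1); [exact: hol1_cst|apply/funext => y; rewrite big_nil].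
have [Pi|nPi] := boolP (P i).
  rewrite (_ : (fun y => _) = fun y => F i y * \prod_(j <- l | P j) F j y).
    by apply: hol1M => //; exact: h.
  by apply/funext => y; rewrite big_cons Pi.
rewrite (_ : (fun y => _) = fun y => \prod_(j <- l | P j) F j y) //.
by apply/funext => y; rewrite big_cons (negPf nPi).
Qed.

Lemma near_line z u (P : V -> Prop) : (\forall y \near z, P y) ->
  exists2 d, 0 < d & forall s, cmod s < d -> P (z + s *: u).
Proof.
move=> /nbhsVP[d d0 Hd]; have u0 : 0 < vmod u + 1 by rewrite ltr_wpDl ?vmod_ge0.
exists (d / (vmod u + 1)) => [|s]; first by rewrite divr_gt0.
rewrite ltr_pdivlMr // mulrDr mulr1 => hs; apply: Hd.
by rewrite addrC addKr vmodZ; have := cmod_ge0 s; lra.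
Qed.

Lemma eq_hol1 f g z : (\forall y \near z, f y = g y) -> hol1 f z -> hol1 g z.
Proof.
move=> E [cf df]; have fg : f z = g z by exact: nbhs_singleton E.
split.
  apply/contCP => e e0; have /contCP/(_ _ e0) := cf.
  by apply: filterS2 E => y -> ; rewrite fg.
move=> u; have [d d0 Hd] := near_line u E.
by apply: (eq_differentiable d0 _ (df u)) => s; rewrite subr0; exact: Hd.
Qed.

Lemma eq_nhol f g z : (\forall y \near z, f y = g y) -> nhol f z -> nhol g z.
Proof.
move=> /near_join E h; rewrite /nhol; apply: filterS2 E h => y; exact: eq_hol1.
Qed.

Lemma diff_hol1 f z : differentiable f z -> hol1 f z.
Proof.
move=> h; split; first exact: differentiable_continuous.
move=> u; apply: (@differentiable_comp _ _ _ _ (fun h : C => z + h *: u));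
    last by rewrite scale0r addr0.
by apply: differentiableD; [exact: differentiable_cst|exact: differentiableZl].
Qed.

Lemma hol1_line f z u s : hol1 f (z + s *: u) -> differentiable (fun h : C => f (z + h *: u)) s.
Proof.
move=> [_ df]; apply: dshift.
rewrite (_ : (fun h => _) = fun h => f (z + s *: u + h *: u)); first exact: df.
by apply/funext => h; rewrite scalerDl addrA.
Qed.

Lemma cont_line z0 s0 b : {for (z0, s0), continuous (fun p : V * C => p.1 + p.2 *: b)}.
Proof.
apply: cvgD; first exact: cvg_fst.
by apply: cvgZr_tmp; exact: cvg_snd.
Qed.

Lemma near_pair z0 s0 b (P : V -> Prop) : (\forall y \near (z0 + s0 *: b), P y) ->
  \forall p \near (z0, s0), P (p.1 + p.2 *: b).
Proof. by move=> h; exact: (@cont_line z0 s0 b). Qed.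

Lemma near_fix (P : V * C -> Prop) z0 s0 : (\forall p \near (z0, s0), P p) ->
  exists2 d, 0 < d & \forall z \near z0, forall s, cmod (s - s0) < d -> P (z, s).
Proof.
move=> [[A B] /= [hA /nbhsCP[d d0 hB]] AB]; exists d => //.
by apply: filterS hA => z Az s /hB Bs; exact: (AB (z, s)).
Qed.

Lemma tube c q (P : V -> C -> Prop) z0 : 0 < q ->
  (forall s, cmod (s - c) <= q -> \forall p \near (z0, s), P p.1 p.2) ->
  \forall z \near z0, forall s, cmod (s - c) <= q -> P z s.
Proof.
move=> q0 H; apply: (@disc_cover _ c q (fun S => \forall z \near z0, forall s, S s -> P z s)) =>
    //.
- by move=> S S' SS'; apply: filterS => z h s /SS'; exact: h.
- by move=> S S'; apply: filterS2 => z h h' s [/h|/h'].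
- by move=> p /H/near_fix[d d0 h]; exists d.
Qed.

Lemma cont_mod c s q : cmod (s - c) != q -> exists2 d, 0 < d & forall s', cmod (s' - s) < d ->
    cmod (s' - c) != q.
Proof.
move=> h; exists `|cmod (s - c) - q|; first by rewrite normr_gt0 subr_eq0.
move=> s' hs; apply: contraTneq hs => <-; rewrite -leNgt ler_norml.
have := cmod_triB s s' c; have := cmod_triB s' s c; rewrite [cmod (s - s')]cmod_subC => h1 h2.
by apply/andP; split; lra.
Qed.

Lemma tube_circ c q (P : V -> C -> Prop) z0 : 0 < q ->
  (forall s, cmod (s - c) = q -> \forall p \near (z0, s), cmod (p.2 - c) = q -> P p.1 p.2) ->
  \forall z \near z0, forall s, cmod (s - c) = q -> P z s.
Proof.
move=> q0 H; have : \forall z \near z0, forall s, cmod (s - c) <= q -> cmod (s - c) = q -> P z s.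
  apply: tube => // s hs; have [E|/cont_mod[d d0 Hd]] := eqVneq (cmod (s - c)) q; first exact: H.
  exists (setT, [set s' | cmod (s' - s) < d]) => /=.
    by split; [exact: filterT|apply/nbhsCP; exists d].
  by move=> [z s'] /= [_ /Hd /eqP].
by apply: filterS => z h s E; apply: h => //; rewrite E.
Qed.

Lemma bounded_circ c q (g : V -> C -> C) z0 : 0 < q ->
  (forall s, cmod (s - c) = q -> {for (z0, s), continuous (fun p : V * C => g p.1 p.2)}) ->
  exists M, \forall z \near z0, forall s, cmod (s - c) = q -> cmod (g z s) <= M.
Proof.
move=> q0 H.
suff [M HM] : exists M, \forall z \near z0, forall s, cmod (s - c) <= q -> cmod (s - c) = q ->
    cmod (g z s) <= M.
  by exists M; apply: filterS HM => z h s E; apply: h => //; rewrite E.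
apply: (@disc_cover _ c q (fun S => exists M, \forall z \near z0, forall s, S s ->
    cmod (s - c) = q -> cmod (g z s) <= M)) => //.
- by move=> S S' SS' [M HM]; exists M; apply: filterS HM => z h s /SS'; exact: h.
- move=> S S' [M HM] [M' HM']; exists (Num.max M M'); apply: filterS2 HM HM' => z h h' s Ss E.
  by rewrite le_max; case: Ss => [/h/(_ E) ->//|/h'/(_ E) ->]; rewrite orbT.
- move=> p _; have [E|/cont_mod[d d0 Hd]] := eqVneq (cmod (p - c)) q; last first.
    by exists d => //; exists 0; apply: nearW => z s /= /Hd /eqP.
  have /contCP/(_ _ ltr01) := H p E; move=> /near_fix[d d0 h]; exists d => //.
  exists (cmod (g z0 p) + 1); apply: filterS h => z h s /= hs _.
  by have := h s hs => /=; have := cmodD (g z s - g z0 p) (g z0 p); rewrite subrK; lra.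
Qed.

(** Continuity comes from uniform closeness over the compact circle, differentiability on lines from
    [avg_param]. Conditions are imposed only for parameters on the circle, since g may be singular
    inside. *)
Lemma avg_hol1 (g : V -> C -> C) c q z0 : 0 < q ->
  (forall s, cmod (s - c) = q -> \forall p \near (z0, s), cmod (p.2 - c) = q ->
     hol1 (g^~ p.2) p.1 /\ {for p, continuous (fun p : V * C => g p.1 p.2)}) ->
  nhol (fun z => avg (fun t => g z (circ c q t))) z0.
Proof.
move=> q0 H.
have [M HM] : exists M, \forall z \near z0, forall s, cmod (s - c) = q -> cmod (g z s) <= M.
  apply: bounded_circ => // s hs.
  by have := nbhs_singleton (H s hs); rewrite /= hs => /(_ erefl)[].
have HH := tube_circ (P := fun z s => hol1 (g^~ s) z /\
  {for (z, s), continuous (fun p : V * C => g p.1 p.2)}) q0.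
have {HH} HN := HH c z0 _.
have {}HN : \forall z \near z0, forall s, cmod (s - c) = q ->
    hol1 (g^~ s) z /\ {for (z, s), continuous (fun p : V * C => g p.1 p.2)}.
  by apply: HN => s /H; apply: filterS => -[z s'].
have ic z : (forall s, cmod (s - c) = q ->
    hol1 (g^~ s) z /\ {for (z, s), continuous (fun p : V * C => g p.1 p.2)}) ->
    icont (fun t => g z (circ c q t)).
  move=> h; apply: (@icont_circ _ (g z)); first exact: ltW.
  move=> s /h[_ cs]; apply/contCP => e e0; have /contCP/(_ _ e0) := cs.
  move=> /near_fix[d d0 Hd]; apply/nbhsCP; exists d => //.
  exact: (nbhs_singleton Hd).
rewrite /nhol; apply: filterS2 (near_join HN) (near_join HM) => z {}HN {}HM;
    have HNz := nbhs_singleton HN; split.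
  apply/contCP => e e0.
  have e2 : 0 < e / 2 by rewrite divr_gt0.
  have : \forall y \near z, forall s, cmod (s - c) = q -> cmod (g y s - g z s) <= e / 2.
    apply: tube_circ => // s hs; have [_ cs] := HNz s hs.
    have e4 : 0 < e / 4 by rewrite divr_gt0.
    have /contCP/(_ _ e4) h := cs; have [d d0 Hd] := near_fix h.
    have Hz := nbhs_singleton Hd.
    near=> p => _; apply: le_trans (cmod_triB _ (g z s) _) _.
    have h1 : cmod (g p.1 p.2 - g z s) < e / 4 by near: p.
    have h2 : cmod (g z p.2 - g z s) < e / 4.
      apply: (Hz p.2); near: p.
      exists (setT, [set s' | cmod (s' - s) < d]) => /=; last by move=> [? ?] [].
      by split; [exact: filterT|apply/nbhsCP; exists d].
    by rewrite [cmod (g z s - _)]cmod_subC; lra.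
  move=> HK; have HNK : \forall y \near z, (forall s, cmod (s - c) = q ->
      hol1 (g^~ s) y /\ {for (y, s), continuous (fun p : V * C => g p.1 p.2)}) /\
      forall s, cmod (s - c) = q -> cmod (g y s - g z s) <= e / 2.
    exact: filterI HN HK.
  apply: filterS HNK => y [HNy h].
  have iy := ic _ HNy; have iz := ic _ HNz; rewrite -(avgB iy iz).
  apply: (@le_lt_trans _ _ (e / 2)); last lra.
  apply: avg_bound => [|t _]; first exact: icontB.
  by apply: h; rewrite circ_dist // ltW.
move=> u; have [d d0 Hd] := near_line u (filterI HN HM).
apply: (@avg_param _ (fun h t => g (z + h *: u) (circ c q t)) d M d0) => [t h|h t hd|h hd].
- rewrite subr0 => /Hd[h1 _]; apply: (@hol1_line (g^~ (circ c q t))).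
  by apply: (h1 _ _).1; rewrite circ_dist // ltW.
- by have [_ h2] := Hd h hd; apply: h2; rewrite circ_dist // ltW.
- by apply: ic; have [h1 _] := Hd h hd.
Unshelve. all: by end_near. Qed.

End SeveralVariables.

(** * Zeros on lines depending on a parameter *)

Section Hurwitz.
Variable R : realType.
Local Notation C := R[i].
Local Notation "x %:C" := (real_complex R x) : ring_scope.
Variable V : normedModType C.
Implicit Types (f g : V -> C) (c s : C) (x y z u b : V) (r e d t M q : R).

Lemma isdv_shift (f : C -> C) c l : isdv (fun h => f (c + h)) 0 l <-> isdv f c l.
Proof.
split=> H e e0; have [d d0 Hd] := H _ e0; exists d => // s hs.
  have := Hd (s - c); rewrite subr0 addr0 => /(_ hs).
  by rewrite [c + (s - c)]addrC subrK.
rewrite subr0 in hs; have := Hd (c + s); rewrite [c + s - c]addrC addKr => /(_ hs).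
by rewrite subr0 addr0.
Qed.

Definition dvb b f z : C := dv (fun s => f (z + s *: b)) 0.

Lemma dvb_line b f z s : dv (fun s => f (z + s *: b)) s = dvb b f (z + s *: b).
Proof.
rewrite /dvb /dv; congr xget; apply/seteqP; split=> l /=.
  move=> /isdv_shift; rewrite (_ : (fun h => f (z + (s + h) *: b)) = fun h =>
      f (z + s *: b + h *: b)) //.
  by apply/funext => h; rewrite scalerDl addrA.
move=> H; apply/isdv_shift; rewrite (_ : (fun h => f (z + (s + h) *: b)) = fun h =>
    f (z + s *: b + h *: b)) //.
by apply/funext => h; rewrite scalerDl addrA.
Qed.

Lemma hol1_shift f z u : hol1 f (z + u) -> hol1 (fun y => f (y + u)) z.
Proof.
move=> [cf df]; split.
  apply: (@continuous_comp _ _ _ (fun y => y + u) f); last exact: cf.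
  by apply: cvgD; [exact: cvg_id|exact: cvg_cst].
move=> w; rewrite (_ : (fun h => _) = fun h => f (z + u + h *: w)); first exact: df.
by apply/funext => h; rewrite addrAC.
Qed.

Lemma cont_jline f z0 s0 b : {for z0 + s0 *: b, continuous f} ->
  {for (z0, s0), continuous (fun p : V * C => f (p.1 + p.2 *: b))}.
Proof.
move=> cf; apply: (@continuous_comp _ _ _ (fun p : V * C => p.1 + p.2 *: b) f); last exact: cf.
exact: cont_line.
Qed.

Lemma near_snd z0 s0 (P : C -> Prop) : (\forall s \near s0, P s) ->
  \forall p \near (z0, s0), P p.2.
Proof.
move=> h; exists (setT, P) => /=; first by split; [exact: filterT|].
by move=> p [].
Qed.

Lemma cont_snd (k : C -> C) z0 s0 : {for s0, continuous k} ->
  {for (z0, s0), continuous (fun p : V * C => k p.2)}.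
Proof.
move=> ck; apply: (@continuous_comp _ _ _ (@snd V C) k); last exact: ck.
exact: cvg_snd.
Qed.

Lemma near_neq0 s0 : s0 != 0 -> \forall s \near s0, s != 0.
Proof.
move=> h; apply/nbhsCP; exists (cmod s0); first by rewrite cmod_gt0.
by move=> s; apply: contraTneq => ->; rewrite sub0r cmodN ltxx.
Qed.

(** Cauchy's formula on the line makes the directional derivative a mean of values of f. *)
Lemma dvb_nhol b f z0 : nhol f z0 -> nhol (dvb b f) z0.
Proof.
move=> hf.
have : \forall p \near (z0, (0 : C)), nhol f (p.1 + p.2 *: b).
  by apply: near_pair; rewrite scale0r addr0; exact: nhol_near.
move=> /near_fix[d d0 Hd]; have q0 : 0 < d / 2 by rewrite divr_gt0.
pose g z s := f (z + s *: b) / (s - 0).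
apply: (@eq_nhol _ _ (fun z => avg (fun t => g z (circ 0 (d / 2) t)))).
  apply: filterS Hd => z Hd; apply/esym; apply: (@dv_avg _ _ _ d).
    by move=> s; rewrite subr0 => hs; apply/hol1_line/nhol_hol1/(Hd s); rewrite subr0.
  by rewrite q0 /=; lra.
apply: avg_hol1 => // s hs.
have sd : cmod (s - 0) < d by rewrite hs; lra.
have hz := nbhs_singleton Hd s sd; rewrite /= in hz.
have sn0 : s != 0 by rewrite -cmod_gt0 -(subr0 s) hs.
have N1 := near_pair (nhol_near hz).
have N2 := near_snd z0 (near_neq0 sn0).
apply: filterS2 N1 N2 => -[z' s'] /= h1 h2 _; rewrite /g; split.
  by apply: hol1M (hol1_cst _ _); exact/hol1_shift/nhol_hol1.
apply: cvgM; first exact: cont_jline (nhol_hol1 h1).1.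
apply: (@cont_snd (fun s => (s - 0)^-1)).
by apply: differentiable_continuous; apply: dsub_neq0.
Qed.

Definition vpsum b f z c q k : C := psum (fun s => f (z + s *: b)) c q k.

Lemma psum_nhol b f z0 c q k : 0 < q ->
  (forall s, cmod (s - c) = q -> nhol f (z0 + s *: b) /\ f (z0 + s *: b) != 0) ->
  nhol (fun z => vpsum b f z c q k) z0.
Proof.
move=> q0 H.
pose g z s := (s - c) * s ^+ k * (dvb b f (z + s *: b) / f (z + s *: b)).
apply: (@eq_nhol _ _ (fun z => avg (fun t => g z (circ c q t)))).
  apply: nearW => z; apply: eq_avg => t _; rewrite /g /=.
  by rewrite dvb_line.
apply: avg_hol1 => // s hs; have [hf fz] := H s hs.
have hd := dvb_nhol b hf.
have N1 := near_pair (nhol_near hf); have N2 := near_pair (nhol_near hd).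
have cf := (nhol_hol1 hf).1.
have N3 : \forall p \near (z0, s), f (p.1 + p.2 *: b) != 0.
  have fz' : 0 < cmod (f (z0 + s *: b)) by rewrite cmod_gt0.
  have /contCP/(_ _ fz') := cont_jline cf; apply: filterS => p /= h.
  by apply: contraTneq h => ->; rewrite sub0r cmodN ltxx.
apply: filterS3 N1 N2 N3 => -[z' s'] /= h1 h2 h3 _; rewrite /g; split.
  apply: hol1M (hol1_cst _ _) _; apply: hol1M; first exact/hol1_shift/nhol_hol1.
  exact: (hol1V (hol1_shift (nhol_hol1 h1)) h3).
apply: cvgM.
  apply: (@cont_snd (fun s => (s - c) * s ^+ k)).
  apply: differentiable_continuous.
  by apply: dM; [apply: dB (did _) (dcst _ _)|apply: dX (did _)].
apply: cvgM; first exact: (cont_jline (nhol_hol1 h2).1).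
by apply: cvgV; [exact: h3|exact: (cont_jline (nhol_hol1 h1).1)].
Qed.

Lemma near_cont_neq0 f z0 : {for z0, continuous f} -> f z0 != 0 -> \forall z \near z0, f z != 0.
Proof.
move=> cf fz; have fz' : 0 < cmod (f z0) by rewrite cmod_gt0.
have /contCP/(_ _ fz') := cf; apply: filterS => p h.
by apply: contraTneq h => ->; rewrite sub0r cmodN ltxx.
Qed.

Lemma near_circ_neq0 b f z0 c q : 0 < q ->
  (forall s, cmod (s - c) = q -> {for z0 + s *: b, continuous f} /\ f (z0 + s *: b) != 0) ->
  \forall z \near z0, forall s, cmod (s - c) = q -> f (z + s *: b) != 0.
Proof.
move=> q0 H; apply: tube_circ => // s hs; have [cf fz] := H s hs.
have := near_pair (near_cont_neq0 cf fz); apply: filterS => p h _; exact: h.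
Qed.

Lemma near_roots b f z0 c q r : 0 < q < r ->
  (forall s, cmod (s - c) < r -> nhol f (z0 + s *: b)) ->
  (forall s, cmod (s - c) = q -> f (z0 + s *: b) != 0) ->
  \forall z \near z0, (forall s, cmod (s - c) <= q -> nhol f (z + s *: b)) /\
    (forall k, nhol (fun z => vpsum b f z c q k) z) /\
    exists rs : seq C, (forall a, (a \in rs) = (cmod (a - c) < q) && (f (z + a *: b) == 0)) /\
    forall k, vpsum b f z c q k = \sum_(a <- rs) a ^+ k.
Proof.
move=> /andP[q0 qr] hf nz; pose q' := (q + r) / 2.
have q'0 : 0 < q' by rewrite /q'; lra.
have qq' : q < q' by rewrite /q'; lra.
have q'r : q' < r by rewrite /q'; lra.
have N1 : \forall z \near z0, forall s, cmod (s - c) <= q' -> nhol f (z + s *: b).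
  by apply: tube => // s hs; apply: (near_pair (nhol_near (hf s _))); lra.
have N2 : \forall z \near z0, forall s, cmod (s - c) = q -> f (z + s *: b) != 0.
  apply: near_circ_neq0 => // s hs; split; last exact: nz.
  by apply: (nhol_hol1 (hf s _)).1; rewrite hs.
apply: filterS2 N1 N2 => z h1 h2; split; [|split].
- by move=> s hs; apply: h1; lra.
- by move=> k; apply: psum_nhol => // s hs; split; [apply: h1; rewrite hs ltW|exact: h2].
- apply: (@psum_roots _ c q'); [|by rewrite q0|exact: h2].
  by move=> s hs; apply/hol1_line/nhol_hol1/h1; exact: ltW.
Qed.

Lemma cmod_natB (n k : nat) : cmod (n%:R - k%:R : C) < 1 -> n = k.
Proof.
have aux (i j : nat) : (j <= i)%N -> cmod (i%:R - j%:R : C) < 1 -> i = j.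
  move=> ji; rewrite -natrB // cmod_nat (_ : 1 = 1%:R :> R) // ltr_nat ltnS leqn0 subn_eq0 => ij.
  by apply/eqP; rewrite eqn_leq ij.
have [kn|/ltnW nk] := leqP k n; first exact: aux.
by rewrite cmod_subC => /(aux _ _ nk).
Qed.

Lemma sum_expr0 (rs : seq C) : \sum_(a <- rs) a ^+ 0 = (size rs)%:R :> C.
Proof.
elim: rs => [|a rs IH]; first by rewrite big_nil.
by rewrite big_cons IH expr0 /= -natr1 addrC.
Qed.

(** The zeroth power sum counts the zeros; being continuous in z and integer valued, it is locally
    constant. *)
Lemma hurwitz b f z0 c q r : 0 < q < r ->
  (forall s, cmod (s - c) < r -> nhol f (z0 + s *: b)) ->
  (forall s, cmod (s - c) = q -> f (z0 + s *: b) != 0) ->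
  (exists2 s, cmod (s - c) < q & f (z0 + s *: b) = 0) ->
  \forall z \near z0, exists2 s, cmod (s - c) < q & f (z + s *: b) = 0.
Proof.
move=> hq hf nz [s0 hs0 fs0]; have N := near_roots hq hf nz.
have [_ [/(_ 0%N)/nhol_hol1[c0 _] [rs0 [hr0 hp0]]]] := nbhs_singleton N.
have /contCP/(_ _ ltr01) := c0; apply: filterS2 N => z [_ [_ [rs [hr hp]]]].
rewrite hp hp0 !sum_expr0 => /cmod_natB E.
have : s0 \in rs0 by rewrite hr0 hs0 fs0 eqxx.
case: rs E hr hp => [|a rs] E hr hp.
  by case: (rs0) E.
by move=> _; exists a; have := hr a; rewrite inE eqxx => /esym/andP[h1 /eqP].
Qed.

End Hurwitz.

(** * Hankel determinants of power sums *)

Section Hankel.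
Variable K : numFieldType.

Definition hankel n (p : nat -> K) : 'M[K]_n := \matrix_(i < n, j < n) p (i + j)%N.

Let H n (rs : seq K) := hankel n (fun k => \sum_(a <- rs) a ^+ k).

Lemma hankel_factor n (rs : seq K) : let t := undup rs in
  H n rs = (\matrix_(i < n, l < size t) t`_l ^+ i) *m
    diag_mx (\row_(l < size t) (count_mem t`_l rs)%:R) *m
    (\matrix_(i < n, l < size t) t`_l ^+ i)^T.
Proof.
move=> t; rewrite mul_mx_diag; apply/matrixP => i j; rewrite !mxE.
rewrite -(big_undup_iterop_count _ _ xpredT) /= -/t.
under [RHS]eq_bigr do rewrite !mxE.
rewrite (big_nth 0) big_mkord; apply: eq_bigr => l _.
have -> : forall k (x : K), iterop k +%R x 0 = x *+ k.
  by [].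
by rewrite exprD mulrAC mulr_natr.
Qed.

(** With fewer than n distinct roots the factorisation runs through a space of smaller dimension;
    with n of them it is the square of a Vandermonde determinant times the multiplicities, which are
    nonzero in characteristic 0. *)
Lemma det_hankel n (rs : seq K) : (size (undup rs) <= n)%N ->
  (\det (H n rs) != 0) = (size (undup rs) == n).
Proof.
move=> sz; have [E|ne] := eqVneq (size (undup rs)) n; last first.
  apply/negP => dn; have lt : (size (undup rs) < n)%N by rewrite ltn_neqAle ne.
  have : \rank (H n rs) = n.
    apply: mxrank_unit; rewrite unitmxE unitfE; exact/negP.
  rewrite hankel_factor => rk.
  have := mxrankM_maxr ((\matrix_(i < n, l < size (undup rs)) (undup rs)`_l ^+ i) *m
    diag_mx (\row_(l < size (undup rs)) (count_mem (undup rs)`_l rs)%:R))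
    (\matrix_(i < n, l < size (undup rs)) (undup rs)`_l ^+ i)^T.
  rewrite rk => /leq_trans/(_ (rank_leq_row _)).
  by rewrite leqNgt lt.
rewrite hankel_factor /=; move: (undup_uniq rs).
have cnt x : x \in undup rs -> (count_mem x rs)%:R != 0 :> K.
  by rewrite mem_undup pnatr_eq0 -lt0n -has_count has_pred1.
move: (undup rs) E cnt => t; case: _ / => cnt ut.
rewrite !det_mulmx det_tr det_diag.
have -> : (\matrix_(i < size t,
    l < size t) t`_l ^+ i) = Vandermonde (size t) (\row_(l < size t) t`_l).
  by apply/matrixP => i l; rewrite !mxE.
rewrite det_Vandermonde.
have D0 : \prod_(i < size t) \prod_(j < size t | (i < j)%N)
    ((\row_(l < size t) t`_l) 0 j - (\row_(l < size t) t`_l) 0 i) != 0 :> K.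
  apply/prodf_neq0 => i _; apply/prodf_neq0 => j ij.
  by rewrite !mxE subr_eq0 nth_uniq // gtn_eqF.
rewrite !mulf_neq0 //; apply/prodf_neq0 => i _; rewrite !mxE; apply: cnt.
exact: mem_nth.
Qed.

End Hankel.

Section ProdSet.
Variable K : fieldType.

(** The product over a set without a named enumeration; for an infinite set the default list is
    empty and the value is 1. *)
Definition prodset (Y : set K) : K :=
  \prod_(a <- xget [::] [set l : seq K | uniq l /\ forall a, a \in l <-> Y a]) a.

Lemma prodsetE (Y : set K) (l : seq K) : uniq l -> (forall a, a \in l <-> Y a) ->
  prodset Y = \prod_(a <- l) a.
Proof.
move=> ul hl; rewrite /prodset; case: xgetP => [l' _ [ul' hl']|/(_ l)[]//].
apply: perm_big; apply: uniq_perm => // a.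
by apply/idP/idP => [/hl'/hl|/hl/hl'].
Qed.

End ProdSet.

(** * Removable singularities in several variables *)

Section RiemannSeveral.
Variable R : realType.
Local Notation C := R[i].
Local Notation "x %:C" := (real_complex R x) : ring_scope.
Variable V : normedModType C.
Implicit Types (f g : V -> C) (c s : C) (x y z u b : V) (r e d t M q : R).

Lemma hol1_det n (A : V -> 'M[C]_n) z : (forall i j, hol1 (fun y => A y i j) z) ->
  hol1 (fun y => \det (A y)) z.
Proof.
move=> h; apply: hol1_sum => s; apply: hol1M; first exact: hol1_cst.
by apply: hol1_prod => i _; exact: h.
Qed.

Lemma ball_line z0 y u r s t : vmod (y - z0) < r - t * vmod u -> cmod s <= t ->
    vmod (y + s *: u - z0) < r.
Proof.
move=> h hs; rewrite addrAC; apply: le_lt_trans (vmodD _ _) _; rewrite vmodZ.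
by have := ler_wpM2r (vmod_ge0 u) hs; lra.
Qed.

Lemma in_ball_near y z r : vmod (y - z) < r -> \forall y' \near y, vmod (y' - z) < r.
Proof.
move=> h; apply/nbhsVP; exists (r - vmod (y - z)); first by rewrite subr_gt0.
by move=> y' h'; have := vmod_triB y' y z; lra.
Qed.

Lemma hol_seg f z r y y' : (forall y, vmod (y - z) < r -> hol1 f y) ->
  vmod (y - z) < r -> vmod (y' - z) < r -> forall t, 0 <= t <= 1 ->
  exists2 d, 0 < d & hol t%:C d (fun h => f (y + h *: (y' - y))).
Proof.
move=> hf hy hy' t ht; have hp := seg_inV hy hy' ht.
have [d d0 Hd] := near_line (y' - y) (in_ball_near hp).
exists d => // s hs; apply: hol1_line; apply: hf.
by have := Hd _ hs; rewrite -(addrA y) -scalerDl [t%:C + _]addrC subrK.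
Qed.

(** Vanishing near y2 would spread along the segment to y1 by the identity theorem. *)
Lemma dense_nz f z0 r y1 : (forall y, vmod (y - z0) < r -> hol1 f y) ->
  vmod (y1 - z0) < r -> f y1 != 0 -> forall y2, vmod (y2 - z0) < r ->
  forall P : V -> Prop, (\forall y \near y2, P y) -> exists2 y, P y & f y != 0.
Proof.
move=> hf h1 f1 y2 h2 P NP; apply: contrapT => H; case/negP: f1; apply/eqP.
have N0 : \forall y \near y2, f y = 0.
  by apply: filterS NP => y Py; apply: contrapT => /eqP fy; apply: H; exists y.
have [d d0 Hd] := near_line (y1 - y2) N0.
have := @ident_seg _ (fun h : C => f (y2 + h *: (y1 - y2))) 0 1.
case=> [t ht||e e0].
- rewrite subr0 mulr1 add0r; exact: (hol_seg hf).
- by exists d => // s; rewrite subr0; exact: Hd.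
by move=> /(_ 1); rewrite subrr cmod0 scale1r addrC subrK => /(_ e0).
Qed.

(** On the line through z0 in a suitable direction u, delta has no zero on a small circle, hence
    none on the same circle over nearby z, and the mean of [F] over it is holomorphic in z. On each
    such line delta has finitely many zeros, so the one-variable theorem and the mean value property
    identify this mean with F z where delta z is nonzero. *)
Lemma riemannV (delta F : V -> C) z0 r M : 0 < r ->
  (forall y, vmod (y - z0) < r -> hol1 delta y) ->
  (exists2 y, vmod (y - z0) < r & delta y != 0) ->
  (forall y, vmod (y - z0) < r -> delta y != 0 -> hol1 F y /\ cmod (F y) <= M) ->
  exists2 Fe : V -> C, nhol Fe z0 & \forall y \near z0, delta y != 0 -> Fe y = F y.
Proof.
move=> r0 hd [y1 hy1 dy1] hF.
have zz : vmod (z0 - z0) < r by rewrite subrr vmod0.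
(* In the direction y - z0 delta is nonzero at s = 1. Length below r / 8 keeps z + s u in the ball
   for z within r / 2 of z0 and s of modulus at most 4. *)
have [y hy dy] := dense_nz hd hy1 dy1 zz (in_ball_near (r := r / 8) (y := z0) (z := z0) ltac:(by rewrite subrr vmod0 divr_gt0)).
pose u := y - z0; have hu : vmod u < r / 8 by exact: hy.
have u0 := vmod_ge0 u.
have inb z s : vmod (z - z0) < r / 2 -> cmod s <= 4 -> vmod (z + s *: u - z0) < r.
  by move=> hz hs; apply: (@ball_line _ _ _ _ _ 4) => //; lra.
have zz2 : vmod (z0 - z0) < r / 2 by rewrite subrr vmod0 divr_gt0.
have hphi z : vmod (z - z0) < r / 2 -> hol 0 4 (fun s => delta (z + s *: u)).
  by move=> hz s; rewrite subr0 => hs; apply/hol1_line/hd/inb => //; exact: ltW.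
have [d d0 Hd] := zero_dich (ltr0Sn _ 3) (hphi _ zz2).
have {}Hd : forall s, 0 < cmod (s - 0) < d -> delta (z0 + s *: u) != 0.
  case: Hd => // Hd; exfalso; case/negP: dy; apply/eqP.
  have c0 : cmod (0 - 0 : C) < 4 by rewrite subrr cmod0.
  have := ident (hphi _ zz2) c0 (ex_intro2 _ _ d d0 Hd) (s := 1).
  by rewrite subr0 cmod1 scale1r /u addrC subrK; apply; rewrite ltr1n.
have [q [q0 qd q1]] := lt_both d0 (@ltr01 R).
have nz0 s : cmod (s - 0) = q -> delta (z0 + s *: u) != 0.
  by move=> hs; apply: Hd; rewrite hs q0.
have N1 : \forall z \near z0, forall s, cmod (s - 0) = q -> delta (z + s *: u) != 0.
  apply: near_circ_neq0 => // s hs; split; last exact: nz0.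
  by apply: (hd _ _).1; apply: inb => //; rewrite subr0 in hs; lra.
exists (fun z => avg (fun t => F (z + circ 0 q t *: u))).
  apply: (@avg_hol1 _ _ (fun z s => F (z + s *: u))) => // s hs.
  have hz : vmod (z0 + s *: u - z0) < r by apply: inb => //; rewrite subr0 in hs; lra.
  have M1 := near_pair (near_cont_neq0 (hd _ hz).1 (nz0 _ hs)).
  have M2 := near_pair (in_ball_near hz).
  apply: filterS2 M1 M2 => -[z' s'] /= h1 h2 _; have [hFy _] := hF _ h2 h1.
  by split; [exact: hol1_shift|exact: cont_jline hFy.1].
apply: filterS2 N1 (in_ball_near zz2) => z nz hz dz.
have q2 : 0 < (q + 1) / 2 < 4 by lra.
have [|E HE] := fin_zeros (hphi _ hz) q2.
  by exists 0; rewrite ?subrr ?cmod0 // scale0r addr0.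
(* [E] may contain points that are no zeros; they are discarded so that the extension keeps the
   values of [F] at 0 and on the circle. *)
pose E' := [seq a <- E | delta (z + a *: u) == 0].
have E'P s : cmod (s - 0) < (q + 1) / 2 -> s \notin E' -> vmod (z + s *: u - z0) < r /\
    delta (z + s *: u) != 0.
  move=> hs sE; split; first by apply: inb => //; rewrite subr0 in hs; lra.
  by apply: contra sE => /eqP h; rewrite mem_filter h eqxx HE // ltW.
have [s hs sE|s hs sE|G hG GE] := @riemann_fin _ 0 ((q + 1) / 2) E' (fun s => F (z + s *: u)) M.
- by have [h1 h2] := E'P _ hs sE; apply/hol1_line; exact: (hF _ h1 h2).1.
- by have [h1 h2] := E'P _ hs sE; exact: (hF _ h1 h2).2.
have qq : 0 < q < (q + 1) / 2 by lra.
rewrite -[RHS](_ : G 0 = _).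
  rewrite -(mean_value hG qq); apply: eq_avg => t _.
  have hc := circ_dist 0 t (ltW q0).
  rewrite GE ?hc; [by []|lra|].
  by rewrite mem_filter (negPf (nz _ hc)).
rewrite GE; first by rewrite scale0r addr0.
  by rewrite subrr cmod0; lra.
by rewrite mem_filter scale0r addr0 (negPf dz).
Qed.

End RiemannSeveral.

(** * Analytic sets along a family of lines *)

Section Branches.
Variable R : realType.
Local Notation C := R[i].
Local Notation "x %:C" := (real_complex R x) : ring_scope.
Variable V : normedModType C.
Implicit Types (f g : V -> C) (c s : C) (x y z u b : V) (r e d t M q : R).

Lemma seq_eps (T : eqType) (l : seq T) (P : T -> R -> Prop) :
  (forall a e e', P a e -> 0 < e' -> e' <= e -> P a e') ->
  (forall a, a \in l -> exists2 e, 0 < e & P a e) ->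
  exists2 e, 0 < e & forall a, a \in l -> P a e.
Proof.
move=> mono; elim: l => [_|a l IH H]; first by exists 1.
have [b bl|e e0 He] := IH; first by apply: H; rewrite inE bl orbT.
have [e' e'0 He'] := H a (mem_head _ _).
have [m [m0 m1 m2]] := lt_both e0 e'0; exists m => // b; rewrite inE => /orP[/eqP->|/He h].
  by apply: mono He' _ _ => //; exact: ltW.
by apply: mono h _ _ => //; exact: ltW.
Qed.

Lemma near_seq (T : eqType) (l : seq T) (z : V) (Q : T -> V -> Prop) :
  (forall a, a \in l -> \forall y \near z, Q a y) ->
  \forall y \near z, forall a, a \in l -> Q a y.
Proof.
elim: l => [_|a l IH H]; first exact: nearW.
have h1 := H a (mem_head _ _).
have h2 : \forall y \near z, forall a, a \in l -> Q a y.
  by apply: IH => b bl; apply: H; rewrite inE bl orbT.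
by apply: filterS2 h1 h2 => y h1 h2 b; rewrite inE => /orP[/eqP->|/h2].
Qed.

Lemma seq_sep (l : seq C) c q : (forall a, a \in l -> cmod (a - c) < q) ->
  exists2 e, 0 < e & forall a, a \in l -> cmod (a - c) + 2 * e <= q /\
    forall a', a' \in l -> a' != a -> 4 * e <= cmod (a' - a).
Proof.
move=> H; apply: seq_eps => [a e e' [h1 h2] e'0 ee'|a al].
  by split=> [|a' a'l a'a]; [lra|have := h2 _ a'l a'a; lra].
have [d d0 Hd] : exists2 d, 0 < d & forall a' : C, a' \in [seq x <- l | x != a] ->
    d <= cmod (a' - a).
  by apply: fin_sep; rewrite mem_filter eqxx.
have h : 0 < q - cmod (a - c) by rewrite subr_gt0 H.
have [m [m0 m1 m2]] := lt_both d0 h; exists (m / 4); first by rewrite divr_gt0.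
split=> [|a' a'l a'a]; first lra.
by have := Hd a'; rewrite mem_filter a'a a'l => /(_ isT); lra.
Qed.

(* Off the zero set of delta the zeros of f on the lines z + s b are given by
   finitely many holomorphic functions of z: delta is the Hankel determinant,
   of size the maximal number of distinct zeros, of their power sums. *)
Lemma local_branches b f z0 c q r0 : 0 < q < r0 ->
  (forall s, cmod (s - c) < r0 -> nhol f (z0 + s *: b)) ->
  (forall s, cmod (s - c) = q -> f (z0 + s *: b) != 0) ->
  exists r (delta : V -> C), [/\ 0 < r, forall z, vmod (z - z0) < r -> hol1 delta z,
    exists2 z, vmod (z - z0) < r & delta z != 0,
    forall z, vmod (z - z0) < r -> (forall s, cmod (s - c) = q -> f (z + s *: b) != 0) /\
      exists rs : seq C, forall a, (a \in rs) = (cmod (a - c) < q) && (f (z + a *: b) == 0) &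
    forall z1, vmod (z1 - z0) < r -> delta z1 != 0 ->
      exists (t : seq C) (e : R) (w : C -> V -> C), [/\ uniq t, 0 < e,
        forall a, a \in t -> cmod (a - c) + 2 * e <= q /\
          forall a', a' \in t -> a' != a -> 4 * e <= cmod (a' - a) &
        \forall z \near z1, (forall a, a \in t -> [/\ cmod (w a z - a) < e,
            f (z + w a z *: b) = 0 & hol1 (w a) z]) /\
          forall s, cmod (s - c) < q -> f (z + s *: b) = 0 -> exists2 a, a \in t & s = w a z]].
Proof.
move=> hq hf nz; have /andP[q0 qr0] := hq.
have N := near_roots hq hf nz.
have N1 : \forall z \near z0, forall s, cmod (s - c) = q -> f (z + s *: b) != 0.
  apply: near_circ_neq0 => // s hs; split; last exact: nz.
  by apply: (nhol_hol1 (hf s _)).1; rewrite hs.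
have [_ [/(_ 0%N)/nhol_hol1[c0 _] [rs0 [hr0 hp0]]]] := nbhs_singleton N.
have /contCP/(_ _ ltr01) N2 := c0.
pose spec z (rs : seq C) :=
  (forall a, (a \in rs) = (cmod (a - c) < q) && (f (z + a *: b) == 0)) /\
  (forall k, vpsum b f z c q k = \sum_(a <- rs) a ^+ k).
pose good z := [/\ forall s, cmod (s - c) <= q -> nhol f (z + s *: b),
  forall k, nhol (fun z => vpsum b f z c q k) z,
  forall s, cmod (s - c) = q -> f (z + s *: b) != 0 &
  exists2 rs, spec z rs & size rs = size rs0].
have : \forall z \near z0, good z.
  apply: filterS3 N N1 N2 => z [h1 [h2 [rs [h3 h4]]]] h5 h6; split=> //; exists rs => //.
  by move: h6; rewrite hp0 h4 !sum_expr0 => /cmod_natB.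
move=> /nbhsVP[r r0' Hr].
have zz0 : vmod (z0 - z0) < r by rewrite subrr vmod0.
pose P n := `[< exists z rs, [/\ vmod (z - z0) < r, spec z rs & size (undup rs) = n] >].
have exP : exists n, P n.
  by exists (size (undup rs0)); apply/asboolP; exists z0, rs0.
have bndP n : P n -> (n <= size rs0)%N.
  move=> /asboolP[z [rs [hz [hr _] <-]]]; have [_ _ _ [rs' [hr' _] <-]] := Hr z hz.
  suff -> : size (undup rs) = size (undup rs') by exact: size_undup.
  apply: perm_size; apply: uniq_perm; rewrite ?undup_uniq // => a.
  by rewrite !mem_undup hr hr'.
case: (ex_maxnP exP bndP) => n Pn nmax {exP bndP}.
pose delta z := \det (hankel n (vpsum b f z c q)).
have deltaE z rs : vmod (z - z0) < r -> spec z rs -> (delta z != 0) = (size (undup rs) == n).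
  move=> hz sp; rewrite /delta (_ : vpsum b f z c q = fun k => \sum_(a <- rs) a ^+ k).
    by apply: det_hankel; apply: nmax; apply/asboolP; exists z, rs.
  by apply/funext => k; rewrite sp.2.
exists r, delta; split; first exact: r0'.
- move=> z hz; apply: hol1_det => i j; rewrite (_ : (fun y => _) = fun y =>
    vpsum b f y c q (i + j)).
    by have [_ h _ _] := Hr z hz; exact: nhol_hol1.
  by apply/funext => y; rewrite mxE.
- move/asboolP: Pn => [z [rs [hz sp /eqP E]]]; exists z => //.
  by rewrite (deltaE _ _ hz sp).
- move=> z hz; have [_ _ h [rs [hr _] _]] := Hr z hz; split=> //.
  by exists rs.
move=> z1 hz1 dz1; have [g1 _ g3 [rs1 sp1 _]] := Hr z1 hz1.
have := dz1; rewrite (deltaE _ _ hz1 sp1) => /eqP szt.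
pose t := undup rs1; rewrite -/t in szt.
have tP a : (a \in t) = (cmod (a - c) < q) && (f (z1 + a *: b) == 0).
  by rewrite mem_undup sp1.1.
have [e e0 He] : exists2 e, 0 < e & forall a, a \in t -> cmod (a - c) + 2 * e <= q /\
    forall a', a' \in t -> a' != a -> 4 * e <= cmod (a' - a).
  by apply: seq_sep => a; rewrite tP => /andP[].
(* For z near z1 the disc about a contains a single, possibly multiple, zero, which is therefore the
   first power sum over the zeroth. *)
pose w a z := vpsum b f z a e 1 / vpsum b f z a e 0.
exists t, e, w; split; [exact: undup_uniq|exact: e0|exact: He|].
have N3 : \forall z \near z1, forall a, a \in t ->
   (forall k, nhol (fun z => vpsum b f z a e k) z) /\
   (exists2 s, cmod (s - a) < e & f (z + s *: b) = 0) /\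
   exists rs : seq C, (forall a', (a' \in rs) = (cmod (a' - a) < e) && (f (z + a' *: b) == 0)) /\
    forall k, vpsum b f z a e k = \sum_(a' <- rs) a' ^+ k.
  apply: near_seq => a at'; have [ha1 ha2] := He a at'.
  have he : 0 < e < 2 * e by rewrite e0 /=; lra.
  have hfa s : cmod (s - a) < 2 * e -> nhol f (z1 + s *: b).
    by move=> hs; apply: g1; have := cmod_triB s a c; lra.
  have nza s : cmod (s - a) = e -> f (z1 + s *: b) != 0.
    move=> hs; apply/eqP => fs; have st : s \in t.
      by rewrite tP fs eqxx andbT; have := cmod_triB s a c; lra.
    have sa : s != a by rewrite -subr_eq0 -cmod_gt0 hs.
    by have := ha2 _ st sa; lra.
  have M1 := near_roots he hfa nza.
  have M2 : \forall z \near z1, exists2 s, cmod (s - a) < e & f (z + s *: b) = 0.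
    apply: (hurwitz he hfa nza); exists a; first by rewrite subrr cmod0.
    by move: at'; rewrite tP => /andP[_ /eqP].
  by apply: filterS2 M1 M2 => z [_ [h1 h2]] h3.
apply: filterS2 N3 (in_ball_near hz1) => z H hz.
have [_ _ _ [rs sp _]] := Hr z hz.
have /choice[v Hv] : forall a, exists s, a \in t -> cmod (s - a) < e /\ f (z + s *: b) = 0.
  move=> a; have [at'|] := boolP (a \in t); last by exists 0.
  by have [_ [[s h1 h2] _]] := H a at'; exists s.
have vinj : {in t &, forall a a', cmod (v a - a') < e -> a = a'}.
  move=> a a' at' at'' h; apply/eqP; apply: contraT => ne.
  have [_ /(_ _ at' ne)] := He a' at''; have := (Hv a at').1.
  rewrite cmod_subC => h2; have := cmod_triB a (v a) a'; lra.
have vq a : a \in t -> cmod (v a - c) < q.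
  by move=> at'; have [h1 _] := He a at'; have := (Hv a at').1; have := cmod_triB (v a) a c; lra.
have us : uniq [seq v a | a <- t].
  rewrite map_inj_in_uniq ?undup_uniq // => a a' at' at'' vv.
  by apply: vinj => //; rewrite vv; exact: (Hv a' at'').1.
have sub : {subset [seq v a | a <- t] <= undup rs}.
  by move=> _ /mapP[a at' ->]; rewrite mem_undup sp.1 vq // (Hv a at').2 eqxx.
(* The discs about the points of t are disjoint, so the zeros [v a] are distinct; by maximality of n
   there is no further one. *)
have szr : (size (undup rs) <= size [seq v a | a <- t])%N.
  by rewrite size_map szt; apply: nmax; apply/asboolP; exists z, rs.
have [_ memE] := uniq_min_size us sub szr.
have rootE s : cmod (s - c) < q -> f (z + s *: b) = 0 -> exists2 a, a \in t & s = v a.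
  move=> h1 h2; have : s \in undup rs by rewrite mem_undup sp.1 h1 h2 eqxx.
  by rewrite -memE => /mapP[a at' ->]; exists a.
have wv a : a \in t -> w a z = v a /\ hol1 (w a) z.
  move=> at'; have [hn [[s hs fs] [rsa [hra hpa]]]] := H a at'.
  have all_v a' : a' \in rsa -> a' = v a.
    rewrite hra => /andP[h1 /eqP h2].
    have [|a2 a2t E] := rootE a' _ h2.
      by have [h3 _] := He a at'; have := cmod_triB a' a c; lra.
    by rewrite E; congr v; apply: vinj => //; rewrite -E.
  have sz0 : (0 < size rsa)%N.
    have : s \in rsa by rewrite hra hs fs eqxx.
    by case: (rsa).
  have p0 : vpsum b f z a e 0 = (size rsa)%:R by rewrite hpa sum_expr0.
  have p1 : vpsum b f z a e 1 = (size rsa)%:R * v a.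
    rewrite hpa big_seq (eq_bigr (fun a' => v a)); last by move=> a' /all_v->.
    rewrite -big_seq; elim: (rsa) => [|x l IH]; first by rewrite big_nil mul0r.
    by rewrite big_cons IH /= -natr1 mulrDl mul1r addrC.
  have nz0 : (size rsa)%:R != 0 :> C by rewrite pnatr_eq0 -lt0n.
  split; first by rewrite /w p0 p1 mulrAC divff // mul1r.
  have q1 := nhol_hol1 (hn 1%N); have q2 := nhol_hol1 (hn 0%N).
  by apply: (hol1M q1 (hol1V q2 _)); rewrite p0.
split=> [a at'|s hs fs].
  by have [-> ?] := wv a at'; have [? ?] := Hv a at'.
by have [a at' E] := rootE s hs fs; exists a => //; rewrite (wv a at').1.
Qed.

End Branches.

Section LocalProduct.
Variable R : realType.
Local Notation C := R[i].
Local Notation "x %:C" := (real_complex R x) : ring_scope.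
Variable V : normedModType C.
Implicit Types (f g : V -> C) (c s : C) (x y z u b : V) (r e d t M q : R).

Definition analytic_at (X : set V) x := exists (k : nat) (f : 'I_k -> V -> C),
  \forall y \near x, (forall i, differentiable (f i) y) /\ (X y <-> forall i, f i y = 0).

Definition hyper_at (X : set V) x := exists g : V -> C,
  \forall y \near x, differentiable g y /\ (X y <-> g y = 0).

(** The form in which codimension one is used: regular points are dense in X, and near one of them a
    chart coordinate is an equation of X. *)
Definition hyper_dense (X : set V) := forall x, X x -> forall P : V -> Prop,
  (\forall y \near x, P y) -> exists y, [/\ P y, X y & hyper_at X y].

Lemma hyper_nhol (X : set V) g x : (\forall y \near x, differentiable g y /\ (X y <-> g y = 0)) ->
  nhol g x.
Proof. by apply: filterS => y [h _]; exact: diff_hol1. Qed.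

Lemma diff_line z u s : differentiable (fun h : C => z + h *: u) s.
Proof.
apply: differentiableD; first exact: differentiable_cst.
by apply: differentiableZl; exact: did.
Qed.

(** Hurwitz's theorem for the single local equation; a set needing several equations could disappear
    from the neighbouring lines. *)
Lemma hyper_persist (X : set V) b z0 s0 d : hyper_at X (z0 + s0 *: b) ->
  X (z0 + s0 *: b) -> 0 < d ->
  (forall s, 0 < cmod (s - s0) < d -> ~ X (z0 + s *: b)) ->
  \forall z \near z0, exists2 s, cmod (s - s0) < d & X (z + s *: b).
Proof.
move=> [g Hg] Xx d0 iso.
have := near_pair (near_join Hg) => /near_fix[d1 d10 N1].
have [r [r0 rd rd1]] := lt_both d0 d10.
have hq : 0 < r / 2 < r by rewrite divr_gt0 //=; lra.
have H1 := nbhs_singleton N1; rewrite /= in H1.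
have hn s : cmod (s - s0) < r -> nhol g (z0 + s *: b).
  by move=> hs; apply: hyper_nhol (H1 s _); lra.
have nz s : cmod (s - s0) = r / 2 -> g (z0 + s *: b) != 0.
  move=> hs; apply/eqP => gs; apply: (iso s); first by rewrite hs; lra.
  by have [_ [_ ]] := nbhs_singleton (H1 s ltac:(rewrite hs; lra)); apply.
have g0 : g (z0 + s0 *: b) = 0 by have [_ [h _]] := nbhs_singleton Hg; exact: h.
have ex : exists2 s, cmod (s - s0) < r / 2 & g (z0 + s *: b) = 0.
  by exists s0 => //; rewrite subrr cmod0 divr_gt0.
apply: filterS2 N1 (hurwitz hq hn nz ex) => z N1 [s hs gs].
exists s; first lra.
have sd : cmod (s - s0) < d1 by lra.
by have [_ [_ ]] := nbhs_singleton (N1 s sd); apply.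
Qed.

(** One of the functions defining X has an isolated zero on the line. Off a discriminant its zeros
    form holomorphic branches, each contained in X entirely or not at all, so the product of those
    in X is holomorphic. *)
Lemma local_product (X : set V) b z0 s0 qmax : analytic_at X (z0 + s0 *: b) ->
  hyper_dense X -> X (z0 + s0 *: b) ->
  (exists2 d, 0 < d & forall s, 0 < cmod (s - s0) < d -> ~ X (z0 + s *: b)) -> 0 < qmax ->
  exists q r (delta : V -> C), [/\ 0 < q < qmax, 0 < r,
    (forall z, vmod (z - z0) < r -> hol1 delta z) /\
    exists2 z, vmod (z - z0) < r & delta z != 0,
    forall z, vmod (z - z0) < r -> (forall s, cmod (s - s0) = q -> ~ X (z + s *: b)) /\
      exists2 l : seq C, uniq l & forall a, a \in l <-> cmod (a - s0) < q /\ X (z + a *: b) &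
    forall z, vmod (z - z0) < r -> delta z != 0 ->
      hol1 (fun z => prodset [set s | cmod (s - s0) < q /\ X (z + s *: b)]) z].
Proof.
move=> [k [F HF]] hyp Xx0 [d d0 iso] qm0.
pose D y := (forall i, differentiable (F i) y) /\ (X y <-> forall i, F i y = 0).
have {}HF : \forall y \near (z0 + s0 *: b), D y by [].
have [d1 d10 HD1] := near_line b (near_join HF).
have {}HD1 s : cmod (s - s0) < d1 -> \forall y \near (z0 + s *: b), D y.
  by move=> /HD1; rewrite -addrA -scalerDl [s0 + _]addrC subrK.
have hFl i : hol s0 d1 (fun s => F i (z0 + s *: b)).
  by move=> s /HD1/nbhs_singleton[/(_ i) h _]; apply/hol1_line/diff_hol1.
(* Otherwise all the defining functions would vanish on the line near s0, against the isolation of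
   s0 in X. *)
have [i [d2 d20 Hi]] : exists i, exists2 d, 0 < d & forall s, 0 < cmod (s - s0) < d ->
    F i (z0 + s *: b) != 0.
  apply: contrapT => H.
  have [e e0 He] : exists2 e, 0 < e & forall i, i \in enum 'I_k ->
      forall s, cmod (s - s0) < e -> F i (z0 + s *: b) = 0.
    apply: seq_eps => [j e e' h e'0 ee' s hs|j _]; first by apply: h; lra.
    have [e e0 [He|He]] := zero_dich d10 (hFl j); first by exists e.
    by exfalso; apply: H; exists j, e.
  have [m1 [m10 m1e m1d]] := lt_both e0 d0.
  have [m [m0 mm1 md1]] := lt_both m10 d10.
  have hm : cmod (s0 + m%:C - s0) = m by rewrite addrC addKr cmodC gtr0_norm.
  apply: (iso (s0 + m%:C)); first by rewrite hm m0 /=; lra.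
  have [_ [_ ]] := nbhs_singleton (HD1 (s0 + m%:C) ltac:(rewrite hm; lra)); apply=> j.
  by apply: He; rewrite ?mem_enum ?hm //; lra.
have [q1 [q10 q1d1 q1d2]] := lt_both d10 d20.
have [q [q0 qq1 qqm]] : exists q, [/\ 0 < q, q < q1 / 2 & q < qmax].
  by apply: lt_both => //; rewrite divr_gt0.
pose f := F i.
have hq : 0 < q < q1 by rewrite q0 /=; lra.
have hf s : cmod (s - s0) < q1 -> nhol f (z0 + s *: b).
  by move=> hs; apply: filterS (HD1 s _); [move=> y [/(_ i) h _]; exact: diff_hol1|lra].
have nz s : cmod (s - s0) = q -> f (z0 + s *: b) != 0.
  by move=> hs; apply: Hi; rewrite hs q0 /=; lra.
have [r1 [delta [r10 hd dnz H1 H2]]] := local_branches hq hf nz.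
have : \forall z \near z0, forall s, cmod (s - s0) <= q -> \forall y \near (z + s *: b), D y.
  by apply: tube => // s hs; apply: (near_pair (near_join (HD1 s _))); lra.
move=> /nbhsVP[r2 r20 HD].
have [r [r0 rr1 rr2]] := lt_both r10 r20.
have zz r' : 0 < r' -> vmod (z0 - z0) < r' by rewrite subrr vmod0.
exists q, r, delta; split; [by rewrite q0| exact: r0 | | |].
- split=> [z hz|]; first by apply: hd; lra.
  have [y1 h1 h2] := dnz.
  exact: (dense_nz hd h1 h2 (zz _ r10) (P := fun y =>
      vmod (y - z0) < r) (in_ball_near (zz _ r0))).
- move=> z hz; have hz1 : vmod (z - z0) < r1 by lra.
  have hz2 : vmod (z - z0) < r2 by lra.
  have [nzz [rs hrs]] := H1 z hz1.
  have Xf s : cmod (s - s0) <= q -> X (z + s *: b) -> f (z + s *: b) = 0.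
    by move=> hs Xs; have [_ [h _]] := nbhs_singleton (HD z hz2 s hs); exact: h.
  split=> [s hs Xs|]; first by case/negP: (nzz s hs); apply/eqP/Xf; rewrite ?hs.
  exists [seq a <- undup rs | `[< X (z + a *: b) >]]; first by rewrite filter_uniq ?undup_uniq.
  move=> a; rewrite mem_filter mem_undup hrs; split=> [/andP[/asboolP ? /andP[? _]]//|[ha Xa]].
  by rewrite ha Xf //= ?eqxx ?andbT; [apply/asboolP|exact: ltW].
move=> z1 hz1 dz1.
have [|t [e [w [ut e0 He Hw]]]] := H2 z1 _ dz1; first lra.
pose good z := [/\ vmod (z - z0) < r2, forall a, a \in t -> [/\ cmod (w a z - a) < e,
            f (z + w a z *: b) = 0 & hol1 (w a) z] &
          forall s, cmod (s - s0) < q -> f (z + s *: b) = 0 -> exists2 a, a \in t & s = w a z].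
have : \forall z \near z1, good z.
  by apply: filterS2 Hw (in_ball_near hz1) => z [h1 h2] h3; split=> //; lra.
move=> /nbhsVP[r3 r30 Hg].
have wsep a a' (s : C) : a \in t -> a' \in t -> cmod (s - a) < e -> cmod (s - a') < e -> a = a'.
  move=> at1 at2 h1 h2; apply/eqP; apply: contraT => ne.
  have [_ /(_ _ at1 ne)] := He a' at2; have := cmod_triB a s a'.
  by rewrite [cmod (a - s)]cmod_subC; move: e0 h1 h2; clear; lra.
have wq a z : a \in t -> good z -> cmod (w a z - s0) < q.
  move=> at1 [_ /(_ a at1)[h1 _ _] _]; have [h2 _] := He a at1.
  by move: (cmod_triB (w a z) a s0) h1 h2 e0; clear; lra.
have DX z s : good z -> cmod (s - s0) < q -> D (z + s *: b).
  by move=> [hz _ _] hs; exact: nbhs_singleton (HD z hz s (ltW hs)).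
have XwE z s a : good z -> a \in t -> cmod (s - a) < e -> X (z + s *: b) -> s = w a z.
  move=> gz at1 hs Xs; have [h2 _] := He a at1.
  have sq : cmod (s - s0) < q by move: (cmod_triB s a s0) hs h2 e0; clear; lra.
  have [_ [/(_ Xs i) fs _]] := DX z s gz sq; have [_ gw gs] := gz.
  have [a' at2 E] := gs s sq fs.
  by rewrite {1}E (wsep a a' s) //; have [h _ _] := gw a' at2; rewrite E.
(* Near a point of X on the branch there is one with a single equation, necessarily on the same
   branch, and X persists around it. The identity theorem for each defining function, restricted to
   the branch over a segment, then reaches z3. *)
have const a z2 z3 : a \in t -> vmod (z2 - z1) < r3 -> vmod (z3 - z1) < r3 ->
    X (z2 + w a z2 *: b) -> X (z3 + w a z3 *: b).
  move=> at1 hz2 hz3 Xz2; have g2 := Hg _ hz2.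
  have Np : \forall y \near (z2 + w a z2 *: b), vmod (y - w a z2 *: b - z1) < r3.
    have N0 : \forall y \near z2, vmod (y - z1) < r3 by exact: in_ball_near.
    have c0 : {for z2 + w a z2 *: b, continuous (fun y => y - w a z2 *: b)}.
      by apply: cvgB; [exact: cvg_id|exact: cvg_cst].
    by apply: (c0 [set y | vmod (y - z1) < r3]); rewrite /= addrK.
  have [y [hy Xy hyp_y]] := hyp _ Xz2 _ Np.
  pose z4 := y - w a z2 *: b; have g4 : good z4 by exact: Hg.
  have yE : y = z4 + w a z2 *: b by rewrite /z4 subrK.
  have [_ gw2 _] := g2; have [wa2 _ _] := gw2 a at1.
  have s2E : w a z2 = w a z4 by apply: XwE => //; rewrite -yE.
  have e1 : 0 < e - cmod (w a z4 - a) by rewrite -s2E subr_gt0.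
  rewrite yE in Xy hyp_y.
  have iso4 s : 0 < cmod (s - w a z2) < e - cmod (w a z4 - a) -> ~ X (z4 + s *: b).
    move=> /andP[s0p hs] Xs; have sE : s = w a z4.
      by apply: XwE => //; move: hs (cmod_triB s (w a z2) a); rewrite s2E; clear; lra.
    by move: s0p; rewrite sE s2E subrr cmod0 ltxx.
  have Nz4 : \forall z \near z4, vmod (z - z1) < r3 /\ X (z + w a z *: b).
    have := hyper_persist hyp_y Xy e1 iso4.
    apply: filterS2 (in_ball_near (hy : vmod (z4 - z1) < r3)) => z hz [s hs Xs].
    split; first exact: hz.
    rewrite -(XwE z s a) //; first exact: Hg.
    by move: hs (cmod_triB s (w a z2) a); rewrite s2E; clear; lra.
  have [_ [_ ]] := DX z3 (w a z3) (Hg _ hz3) (wq _ _ at1 (Hg _ hz3)); apply => j.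
  have [d3 d30 Hd3] := near_line (z3 - z4) Nz4.
  pose G (h : C) := F j (z4 + h *: (z3 - z4) + w a (z4 + h *: (z3 - z4)) *: b).
  have := @ident_seg _ G 0 1; case.
  - move=> t0 ht0; rewrite subr0 mulr1 add0r.
    have hp := seg_inV (hy : vmod (z4 - z1) < r3) hz3 ht0.
    have [d4 d40 Hd4] := near_line (z3 - z4) (in_ball_near hp).
    exists d4; first exact: d40.
    move=> s hs.
    have hs3 : vmod (z4 + s *: (z3 - z4) - z1) < r3.
      by have := Hd4 _ hs; rewrite -(addrA z4) -scalerDl [t0%:C + _]addrC subrK.
    have gs := Hg _ hs3; have [_ gws _] := gs; have [_ _ hw1] := gws a at1.
    have [dF _] := DX _ _ gs (wq _ _ at1 gs).
    apply: (@differentiable_comp _ _ _ _ (fun h : C =>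
        z4 + h *: (z3 - z4) + w a (z4 + h *: (z3 - z4)) *: b) (F j)); last exact: dF.
    apply: differentiableD; last first.
      by apply: differentiableZl; exact: (hol1_line hw1).
    exact: diff_line.
  - exists d3; first exact: d30.
    move=> h; rewrite subr0 => hh.
    have [hh3 Xh] := Hd3 h hh; have gh := Hg _ hh3.
    by have [_ [/(_ Xh j)]] := DX _ _ gh (wq _ _ at1 gh).
  move=> d5 d50 Hd5; have := Hd5 1; rewrite subrr cmod0 /G scale1r [z4 + _]addrC subrK.
  by move=> /(_ d50).
(* By [const], the same branches lie in X over every z near z1. *)
pose S := [seq a <- t | `[< X (z1 + w a z1 *: b) >]].
have z1r3 : vmod (z1 - z1) < r3 by rewrite subrr vmod0.
have St a : a \in S -> a \in t by rewrite mem_filter => /andP[].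
apply: (@eq_hol1 _ _ (fun z => \prod_(a <- S | a \in S) w a z)); last first.
  apply: hol1_prod => a /St at1; have [_ gw _] := Hg z1 z1r3.
  by have [_ _] := gw a at1.
apply: filterS (in_ball_near z1r3) => z hz; have gz := Hg z hz.
rewrite -big_seq; apply/esym; rewrite -(big_map (w^~ z) xpredT id); apply: prodsetE.
  rewrite map_inj_in_uniq ?filter_uniq // => a a' /St at1 /St at2 E.
  have [_ gw _] := gz; have [h1 _ _] := gw a at1; have [h2 _ _] := gw a' at2.
  by apply: (wsep _ _ (w a z)) => //; rewrite E.
move=> s /=; split=> [/mapP[a aS ->]|[hs Xs]].
  have at1 := St a aS; split; first exact: wq.
  apply: (const a z1) => //.
  by move: aS; rewrite mem_filter => /andP[/asboolP].
have [_ [/(_ Xs i) fs _]] := DX z s gz hs; have [_ _ gs] := gz.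
have [a at1 E] := gs s hs fs; apply/mapP; exists a => //.
rewrite mem_filter at1 andbT; apply/asboolP; apply: (const a z) => //.
by rewrite -E.
Qed.

End LocalProduct.

(** * Properties valid on a dense open set *)

Section Generic.
Variable R : realType.
Local Notation C := R[i].
Local Notation "x %:C" := (real_complex R x) : ring_scope.
Variable V : normedModType C.
Implicit Types (f g : V -> C) (c s : C) (x y z u b : V) (r e d t M q : R).

(* Q holds on an open dense subset of a neighbourhood of z. *)
Definition generic (Q : V -> Prop) z := \forall y \near z, forall P : V -> Prop,
  (\forall w \near y, P w) -> exists2 w, P w & \forall v \near w, Q v.

Lemma generic_near Q z : generic Q z -> \forall y \near z, generic Q y.
Proof. exact: near_join. Qed.

Lemma genericP Q z (P : V -> Prop) : generic Q z -> (\forall y \near z, P y) ->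
  exists2 w : V, \forall v \near w, P v & \forall v \near w, Q v.
Proof.
by move=> /nbhs_singleton h hP; have [w h1 h2] := h _ (near_join hP); exists w.
Qed.

Lemma genericI Q Q' z : generic Q z -> generic Q' z -> generic (fun y => Q y /\ Q' y) z.
Proof.
move=> /near_join h /near_join h'; apply: filterS2 h h' => y h h' P NP.
have [w Pw Qw] := genericP h (filterI NP h').
have h'w : generic Q' w by apply: filterS (near_join Pw) => v /nbhs_singleton[].
have NPQ : \forall v \near w, P v /\ Q v.
  by apply: filterS2 Pw Qw => v [].
have [v Pv Qv] := genericP h'w NPQ; exists v; first by have [] := nbhs_singleton Pv.
by apply: filterS2 Pv Qv => v' [].
Qed.

Lemma genericS (Q Q' : V -> Prop) z : (\forall y \near z, Q y -> Q' y) -> generic Q z ->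
    generic Q' z.
Proof.
move=> /near_join S /near_join h; apply: filterS2 S h => y S h P NP.
have [w Pw Qw] := genericP h (filterI NP S); exists w; first by have [] := nbhs_singleton Pw.
by apply: filterS2 Pw Qw => v [_ SQ]; exact: SQ.
Qed.

Lemma generic_trans (Q Q' : V -> Prop) z : (\forall y \near z, Q y -> generic Q' y) ->
  generic Q z -> generic Q' z.
Proof.
move=> /near_join S /near_join h; apply: filterS2 S h => y S h P NP.
have [w Pw Qw] := genericP h (filterI NP S).
have gw : generic Q' w.
  by have [_ /(_ (nbhs_singleton Qw))] := nbhs_singleton Pw.
have NP' : \forall v \near w, P v by apply: filterS Pw => v [].
have [v Pv Qv] := genericP gw NP'; exists v => //; exact: nbhs_singleton Pv.
Qed.

Lemma generic_nz f z0 r : 0 < r -> (forall y, vmod (y - z0) < r -> hol1 f y) ->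
  (exists2 y, vmod (y - z0) < r & f y != 0) -> generic (fun y => f y != 0) z0.
Proof.
move=> r0 hf [y1 h1 f1]; apply/nbhsVP; exists r => // y hy P NP.
have [w [Pw hw] fw] := dense_nz hf h1 f1 hy (P := fun w => P w /\ vmod (w - z0) < r)
  (filterI NP (in_ball_near hy)).
by exists w => //; apply: near_cont_neq0 => //; exact: (hf w hw).1.
Qed.

Lemma generic_eq f g h z : {for z, continuous f} -> {for z, continuous g} ->
  generic (fun y => f y = h y) z -> generic (fun y => g y = h y) z -> f z = g z.
Proof.
move=> cf cg gf gg; apply/eqP; rewrite -subr_eq0; apply: contraT => nz.
have cfg : {for z, continuous (fun y => f y - g y)} by apply: cvgB; [exact: cf|exact: cg].
have := near_cont_neq0 cfg nz => N.
have [w /nbhs_singleton Pw /nbhs_singleton[E1 E2]] := genericP (genericI gf gg) N.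
by move: Pw; rewrite E1 E2 subrr eqxx.
Qed.

Lemma generic_bound f h z M : {for z, continuous f} -> generic (fun y => f y = h y /\
    cmod (h y) <= M) z ->
  cmod (f z) <= M.
Proof.
move=> cf gf; rewrite leNgt; apply/negP => lt.
have e0 : 0 < cmod (f z) - M by rewrite subr_gt0.
have /contCP/(_ _ e0) N := cf.
have [w /nbhs_singleton Pw /nbhs_singleton[E1 E2]] := genericP gf N.
by have := cmod_leB (f z) (f w); rewrite cmod_subC E1 in Pw *; lra.
Qed.

Lemma prod_nz (T : Type) (l : seq T) (F : T -> V -> C) z0 r : 0 < r ->
  (forall a y, vmod (y - z0) < r -> hol1 (F a) y) ->
  (forall a, exists2 y, vmod (y - z0) < r & F a y != 0) ->
  exists2 y, vmod (y - z0) < r & \prod_(a <- l) F a y != 0.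
Proof.
move=> r0 hF nzF; elim: l => [|a l [y hy fy]].
  by exists z0; rewrite ?subrr ?vmod0 // big_nil oner_eq0.
have hp : hol1 (fun y => \prod_(a <- l) F a y) y by apply: hol1_prod => a' _; exact: hF.
have N : \forall w \near y, \prod_(a <- l) F a w != 0 /\ vmod (w - z0) < r.
  by apply: filterS2 (near_cont_neq0 hp.1 fy) (in_ball_near hy) => w.
have [y1 h1 f1] := nzF a.
have [w [Pw hw] fw] := dense_nz (hF a) h1 f1 hy (P := fun w => \prod_(a <- l) F a w != 0 /\
    vmod (w - z0) < r) N.
by exists w => //; rewrite big_cons mulf_neq0.
Qed.

Lemma notX_near (X : set V) y : analytic_at X y -> ~ X y -> \forall w \near y, ~ X w.
Proof.
move=> [k [F HF]] nX; have [dF XF] := nbhs_singleton HF.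
have [i Fi] : exists i, F i y != 0.
  by apply: contrapT => H; apply/nX/XF => i; apply: contrapT => Fi; apply: H; exists i; exact/eqP.
have := near_cont_neq0 (differentiable_continuous (dF i)) Fi.
by apply: filterS2 HF => w [_ XFw] Fiw Xw; move: Fiw; rewrite XFw.1 ?eqxx.
Qed.

Lemma slice_dich (X : set V) z s0 b : analytic_at X (z + s0 *: b) -> exists2 d, 0 < d &
  (forall s, cmod (s - s0) < d -> X (z + s *: b)) \/
  (forall s, 0 < cmod (s - s0) < d -> ~ X (z + s *: b)).
Proof.
move=> [k [F HF]].
have [d1 d10 HD1] := near_line b HF.
have {}HD1 s : cmod (s - s0) < d1 -> (forall i, differentiable (F i) (z + s *: b)) /\
    (X (z + s *: b) <-> forall i, F i (z + s *: b) = 0).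
  by move=> /HD1; rewrite -addrA -scalerDl [s0 + _]addrC subrK.
have hFl i : hol s0 d1 (fun s => F i (z + s *: b)).
  by move=> s /HD1[/(_ i) h _]; apply/hol1_line/diff_hol1.
have [[i [e e0 He]]|H] := pselect (exists i, exists2 d, 0 < d & forall s,
    0 < cmod (s - s0) < d -> F i (z + s *: b) != 0).
  have [m [m0 m1 m2]] := lt_both d10 e0; exists m => //; right=> s /andP[s1 s2] Xs.
  have [_ [/(_ Xs i) Fi _]] := HD1 s (lt_trans s2 m1).
  by have := He s; rewrite s1 (lt_trans s2 m2) Fi eqxx => /(_ isT).
have [e e0 He] : exists2 e, 0 < e & forall i, i \in enum 'I_k ->
    forall s, cmod (s - s0) < e -> F i (z + s *: b) = 0.
  apply: seq_eps => [j e e' h e'0 ee' s hs|j _]; first by apply: h; lra.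
  have [e e0 [He|He]] := zero_dich d10 (hFl j); first by exists e.
  by exfalso; apply: H; exists j, e.
have [m [m0 m1 m2]] := lt_both d10 e0; exists m => //; left=> s hs.
have [_ [_ ]] := HD1 s (lt_trans hs m1); apply=> i.
by apply: He; rewrite ?mem_enum //; exact: lt_trans m2.
Qed.

End Generic.

Section Detour.
Variable R : realType.
Local Notation C := R[i].
Local Notation "x %:C" := (real_complex R x) : ring_scope.
Implicit Types (p q a : C) (E : seq C).

(** The midpoint is pushed a small amount u along the perpendicular bisector. In the coordinate (x -
    p) / (q - p) the first leg lies on the line through 0 and 1 / 2 + i u, so each x excludes at
    most one positive u; the second leg is symmetric. *)
Lemma detour E p q (e : R) : p != q -> p \notin E -> q \notin E -> 0 < e ->
  exists2 a, cmod (a - (p + q) / 2) < e & forall (t : R) x, x \in E ->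
    x != p + t%:C * (a - p) /\ x != a + t%:C * (q - a).
Proof.
move=> pq pE qE e0; pose w1 x := (x - p) / (q - p); pose w2 x := (x - q) / (p - q).
have pq0 : q - p != 0 by rewrite subr_eq0 eq_sym.
have qp0 : p - q != 0 by rewrite subr_eq0.
have D0 : 0 < cmod (q - p) by rewrite cmod_gt0.
(* This says that u is below every positive value excluded by x. A vanishing real part makes the
   quotient 0, hence gives no condition. *)
pose bad x (u : R) := (0 < complex.Im (w1 x) / (2 * complex.Re (w1 x)) ->
    u < complex.Im (w1 x) / (2 * complex.Re (w1 x))) /\
   (0 < - complex.Im (w2 x) / (2 * complex.Re (w2 x)) ->
       u < - complex.Im (w2 x) / (2 * complex.Re (w2 x))).
have [u0 u00 Hu] : exists2 u, 0 < u & forall x, x \in E -> bad x u.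
  apply: seq_eps => [x u u' [h1 h2] u'0 uu'|x _].
    by split=> h; [exact: le_lt_trans (h1 h)|exact: le_lt_trans (h2 h)].
  have aux (v : R) : exists2 u : R, 0 < u & (0 < v -> u < v).
    have [v0|v0] := ltP 0 v; last by exists 1 => //; rewrite ltNge v0.
    by exists (v / 2) => [|_]; lra.
  have [v1 v10 h1] := aux (complex.Im (w1 x) / (2 * complex.Re (w1 x))).
  have [v2 v20 h2] := aux (- complex.Im (w2 x) / (2 * complex.Re (w2 x))).
  have [u [h3 h4 h5]] := lt_both v10 v20; exists u => //.
  by split=> h; [exact: lt_trans (h1 h)|exact: lt_trans (h2 h)].
have [u [up uu0 ue]] := lt_both u00 (divr_gt0 e0 D0).
pose a : C := p + (q - p) * (1 / 2 + Complex 0 u).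
have half : (Complex (1 / 2) 0 : C) = 1 / 2.
  by rewrite complexr0 rmorphM rmorph1 fmorphV rmorph_nat.
exists a.
  have -> : a - (p + q) / 2 = (q - p) * Complex 0 u.
    by rewrite /a; field.
  rewrite cmodM mulrC -ltr_pdivlMr //; apply: le_lt_trans (cmod_le_ReIm _) _.
  by rewrite /= normr0 add0r gtr0_norm.
move=> t x xE; have [h1 h2] := Hu x xE; split; apply/eqP => E1.
  have w1E : w1 x = Complex (t / 2) (t * u).
    rewrite /w1 E1 /a.
    have -> : p + t%:C * (p + (q - p) * (1 / 2 + Complex 0 u) - p) - p =
        t%:C * (1 / 2 + Complex 0 u) * (q - p) by ring.
    rewrite mulfK //.
    by rewrite -half; apply/eqP; rewrite eq_complex /=; apply/andP; split; apply/eqP; ring.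
  have t0 : t != 0 by apply: contraNneq pE => t0; rewrite E1 t0 rmorph0 mul0r addr0 in xE.
  move: h1; rewrite w1E /= (_ : t * u / _ = u); last by field.
  by move=> /(_ up); lra.
have w2E : w2 x = Complex ((1 - t) / 2) (- ((1 - t) * u)).
  rewrite /w2 E1.
  have -> : a + t%:C * (q - a) - q = (1 - t)%:C * (a - q) by rewrite rmorphB rmorph1 /=; ring.
  have -> : a - q = (p - q) * (1 / 2 - Complex 0 u).
    by rewrite /a; field.
  rewrite (mulrC (p - q)) mulrA mulfK //.
  by rewrite -half; apply/eqP; rewrite eq_complex /=; apply/andP; split; apply/eqP; ring.
have t0 : 1 - t != 0.
  apply: contraNneq qE => t0; have t1 : t = 1 by lra.
  by rewrite E1 t1 rmorph1 mul1r addrC subrK in xE.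
move: h2; rewrite w2E /= opprK (_ : (1 - t) * u / _ = u); last by field.
by move=> /(_ up); lra.
Qed.

End Detour.

Section Slices.
Variable R : realType.
Local Notation C := R[i].
Local Notation "x %:C" := (real_complex R x) : ring_scope.
Variable V : normedModType C.
Implicit Types (f g : V -> C) (c s : C) (x y z u b : V) (r e d t M q : R).

Lemma slice_full_dich (X : set V) z p b : analytic_at X (z + p *: b) ->
  let Z p := exists2 d, 0 < d & forall s, cmod (s - p) < d -> X (z + s *: b) in
  exists2 d, 0 < d & (forall s, cmod (s - p) < d -> Z s) \/ (forall s, cmod (s - p) < d -> ~ Z s).
Proof.
move=> aX Z; have [d d0 Hd] := slice_dich aX; exists d => //; case: Hd => Hd; [left|right] =>
    s hs.
  exists (d - cmod (s - p)) => [|u hu]; first by rewrite subr_gt0.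
  by apply: Hd; have := cmod_triB u s p; lra.
move=> [d' d'0 Hd'].
have [m [m0 m1 m2]] : exists m, [/\ 0 < m, m < d' & m < d - cmod (s - p)].
  by apply: lt_both => //; rewrite subr_gt0.
have [sp|sp] := eqVneq s p.
  have E : cmod (p + m%:C - p) = m by rewrite addrC addKr cmodC gtr0_norm.
  apply: (Hd (p + m%:C)); first by rewrite E m0 /=; move: m2; rewrite sp subrr cmod0 subr0.
  by apply: Hd'; rewrite sp E.
apply: (Hd s); first by rewrite cmod_gt0 subr_eq0 sp.
by apply: Hd'; rewrite subrr cmod0.
Qed.

Lemma disc_seg (p q : C) r t : cmod p <= r -> cmod q <= r -> 0 <= t <= 1 ->
    cmod (p + t%:C * (q - p)) <= r.
Proof.
move=> hp hq /andP[t0 t1].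
have -> : p + t%:C * (q - p) = (1 - t)%:C * p + t%:C * q by rewrite rmorphB rmorph1 /=; ring.
apply: le_trans (cmodD _ _) _; rewrite !cmodM !cmodC !ger0_norm ?subr_ge0 //.
have t1' : 0 <= 1 - t by rewrite subr_ge0.
by have := ler_wpM2l t1' hp; have := ler_wpM2l t0 hq; lra.
Qed.

(** The line may leave U at finitely many points. A broken segment from s0 to s1 around them carries
    the property that X contains a neighbourhood in the line, which holds near each point throughout
    or nowhere. *)
Lemma slice_full (X U : set V) b z r (E : seq C) s0 s1 :
  (forall y, U y -> analytic_at X y) ->
  (forall s, cmod s <= r -> s \notin E -> U (z + s *: b)) ->
  cmod s0 < r -> cmod s1 <= r -> U (z + s0 *: b) -> U (z + s1 *: b) ->
  (exists2 d, 0 < d & forall s, cmod (s - s0) < d -> X (z + s *: b)) ->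
  X (z + s1 *: b).
Proof.
move=> aX HU h0 h1 U0 U1 Z0.
have [<-|s01] := eqVneq s0 s1.
  by have [d d0 Hd] := Z0; apply: Hd; rewrite subrr cmod0.
pose E' := [seq x <- E | `[< ~ U (z + x *: b) >]].
have HU' s : cmod s <= r -> s \notin E' -> U (z + s *: b).
  move=> hs sE; have [sE0|] := boolP (s \in E); last exact: HU.
  apply: contrapT => nU; move/negP: sE; apply; rewrite mem_filter sE0 andbT.
  exact/asboolP.
have nE s : U (z + s *: b) -> s \notin E'.
  by move=> Us; rewrite mem_filter negb_and; apply/orP; left; apply/asboolPn; apply.
have mid : cmod ((s0 + s1) / 2) < r.
  rewrite cmodM cmodV cmod_nat ltr_pdivrMr //.
  by have := cmodD s0 s1; lra.
have e0 : 0 < r - cmod ((s0 + s1) / 2) by rewrite subr_gt0.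
have [a ha Ha] := detour s01 (nE _ U0) (nE _ U1) e0.
have ar : cmod a <= r.
  by have := cmodD (a - (s0 + s1) / 2) ((s0 + s1) / 2); rewrite subrK; lra.
have step (p q : C) : cmod p <= r -> cmod q <= r ->
    (forall t (x : C), x \in E' -> x != p + t%:C * (q - p)) ->
    (exists2 d, 0 < d & forall s, cmod (s - p) < d -> X (z + s *: b)) ->
    exists2 d, 0 < d & forall s, cmod (s - q) < d -> X (z + s *: b).
  move=> hp hq av; apply: (@seg_conn _ (fun p => exists2 d, 0 < d & forall s,
      cmod (s - p) < d -> X (z + s *: b))).
  move=> t ht; apply: slice_full_dich; apply/aX/HU'; first exact: disc_seg.
  by apply/negP => /(av t); rewrite eqxx.
have [d d0 Hd] : exists2 d, 0 < d & forall s, cmod (s - s1) < d -> X (z + s *: b).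
  apply: (step a s1) => // [t x xE|]; first by have [] := Ha t x xE.
  by apply: (step s0 a) => // [|t x xE]; [exact: ltW|have [] := Ha t x xE].
by apply: Hd; rewrite subrr cmod0.
Qed.

Lemma slice_iso (X U : set V) b z r (E : seq C) s0 s1 :
  (forall y, U y -> analytic_at X y) ->
  (forall s, cmod s <= r -> s \notin E -> U (z + s *: b)) ->
  cmod s0 < r -> cmod s1 <= r -> U (z + s0 *: b) -> U (z + s1 *: b) -> ~ X (z + s1 *: b) ->
  exists2 d, 0 < d & forall s, 0 < cmod (s - s0) < d -> ~ X (z + s *: b).
Proof.
move=> aX HU h0 h1 U0 U1 nX; have [d d0 [Hd|Hd]] := slice_dich (aX _ U0); last by exists d.
by case: nX; apply: (slice_full aX HU h0 h1 U0 U1); exists d.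
Qed.

End Slices.

(** * An equation for X near the origin *)

Section GlobalProduct.
Variable R : realType.
Local Notation C := R[i].
Local Notation "x %:C" := (real_complex R x) : ring_scope.
Variable V : normedModType C.
Implicit Types (f g : V -> C) (c s : C) (x y z u b : V) (r e d t M q : R).

(** X is studied near 0 on the discs of radius r in direction b, whose boundary circles lie in U and
    miss X. In the disc over z, U can be left only at points of E z; where delta0 z is nonzero the
    whole disc lies in U, so X meets it in a finite set. The point 0 itself need not be in U. *)
Variables (X U : set V) (b : V) (r eps : R) (E : V -> seq C) (delta0 : V -> C).
Hypothesis aX : forall y, U y -> analytic_at X y.
Hypothesis hX : hyper_dense X.
Hypothesis XU : X `<=` U.
Hypothesis nwX : forall x, X x -> forall P : V -> Prop, (\forall y \near x, P y) -> exists2 y,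
    P y & ~ X y.
Hypothesis r01 : 0 < r <= 1.
Hypothesis eps0 : 0 < eps.
Hypothesis circX : forall z s, vmod (z - 0) < eps -> cmod s = r -> U (z + s *: b) /\
    ~ X (z + s *: b).
Hypothesis EU : forall z s, vmod (z - 0) < eps -> cmod s <= r -> s \notin E z -> U (z + s *: b).
Hypothesis dU : forall z s, vmod (z - 0) < eps -> delta0 z != 0 -> cmod s <= r -> U (z + s *: b).
Hypothesis hdelta0 : forall z, vmod (z - 0) < eps -> hol1 delta0 z.
Hypothesis nzdelta0 : exists2 z, vmod (z - 0) < eps & delta0 z != 0.

Let r0 : 0 < r. Proof. by case/andP: r01. Qed.
Let cr : cmod r%:C = r. Proof. by rewrite cmodC gtr0_norm. Qed.

Let iso z s0 : vmod (z - 0) < eps -> cmod s0 < r -> U (z + s0 *: b) ->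
  exists2 d, 0 < d & forall s, 0 < cmod (s - s0) < d -> ~ X (z + s *: b).
Proof.
move=> hz hs Us; have [U1 X1] := circX hz cr.
by apply: (slice_iso aX _ hs _ Us U1 X1) => [s|]; [exact: EU|rewrite cr].
Qed.

Let Y z := [set s | cmod s < r /\ X (z + s *: b)].
Let F z := prodset (Y z).

Let finY z : vmod (z - 0) < eps -> delta0 z != 0 ->
  exists2 l : seq C, uniq l & forall a, a \in l <-> Y z a.
Proof.
move=> hz dz.
have [l0 Hl0] : exists l : seq C, forall s, cmod (s - 0) <= r -> X (z + s *: b) -> s \in l.
  apply: (@disc_cover _ 0 r (fun S => exists l : seq C, forall s, S s -> X (z + s *: b) ->
      s \in l)) => //.
  - by move=> S S' SS' [l Hl]; exists l => s /SS'; exact: Hl.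
  - move=> S S' [l Hl] [l' Hl']; exists (l ++ l') => s [] Ss Xs; rewrite mem_cat.
      by rewrite Hl.
    by rewrite Hl' ?orbT.
  move=> p; rewrite subr0 => hp; have Up := dU hz dz hp.
  have [pr|pr] := ltP (cmod p) r; last first.
    have [_ nX] := circX hz (le_anti (introT andP (conj hp pr))).
    have [d d0 Hd] := near_line b (notX_near (aX Up) nX).
    exists d => //; exists [::] => s /= /Hd; rewrite -addrA -scalerDl [p + _]addrC subrK.
    by [].
  have [d d0 Hd] := iso hz pr Up; exists d => //; exists [:: p] => s /= hs Xs.
  rewrite inE; apply/negPn; apply/negP => sp; apply: (Hd s) => //.
  by rewrite hs cmod_gt0 subr_eq0 sp.
exists [seq a <- undup l0 | `[< Y z a >]]; first by rewrite filter_uniq ?undup_uniq.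
move=> a; rewrite mem_filter mem_undup; split=> [/andP[/asboolP]//|Ya].
rewrite Hl0 ?andbT; [exact/asboolP|rewrite subr0|].
  by case: Ya => /ltW.
by case: Ya.
Qed.

Let boundF z : vmod (z - 0) < eps -> delta0 z != 0 -> cmod (F z) <= 1.
Proof.
move=> hz dz; have [l ul hl] := finY hz dz; rewrite /F (prodsetE ul hl) cmod_prod.
rewrite big_seq; apply: prodr_ile1 => a /hl[h _]; rewrite cmod_ge0 /=.
by case/andP: r01 => _; exact/le_trans/ltW.
Qed.

Let smallF z s : vmod (z - 0) < eps -> delta0 z != 0 -> Y z s -> cmod (F z) <= cmod s.
Proof.
move=> hz dz Ys; have [l ul hl] := finY hz dz; rewrite /F (prodsetE ul hl) cmod_prod.
rewrite (bigD1_seq s) /=; [|exact/hl|exact: ul].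
rewrite ler_piMr ?cmod_ge0 // big_seq_cond; apply: prodr_ile1 => a /andP[/hl[h _] _];
    rewrite cmod_ge0 /=.
by case/andP: r01 => _; exact/le_trans/ltW.
Qed.

Let nzF z : vmod (z - 0) < eps -> delta0 z != 0 -> ~ X z -> F z != 0.
Proof.
move=> hz dz nX; have [l ul hl] := finY hz dz; rewrite /F (prodsetE ul hl).
rewrite prodf_seq_neq0; apply/allP => a /hl[_ Xa] /=; apply: contra_notN nX => /eqP a0.
by rewrite a0 scale0r addr0 in Xa.
Qed.

(** The points of X on the line over z0 get disjoint small discs, and near z0 the product [F] splits
    into their local products. It is holomorphic where none of the local discriminants vanishes, and
    its bound 1 lets [riemannV] extend it. *)
Let locF z0 : vmod (z0 - 0) < eps -> delta0 z0 != 0 ->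
  exists2 Fe : V -> C, nhol Fe z0 & generic (fun z => Fe z = F z) z0.
Proof.
move=> hz0 dz0; have [l ul hl] := finY hz0 dz0.
have lr a : a \in l -> cmod (a - 0) < r by move=> /hl[]; rewrite subr0.
have [e e0 He] := seq_sep lr.
have /choice[q Hq] : forall a, exists q : R, exists (ra : R) (da : V -> C), a \in l ->
   [/\ 0 < q < e, 0 < ra,
    (forall z, vmod (z - z0) < ra -> hol1 da z) /\
    exists2 z, vmod (z - z0) < ra & da z != 0,
    forall z, vmod (z - z0) < ra -> (forall s, cmod (s - a) = q -> ~ X (z + s *: b)) /\
      exists2 l : seq C, uniq l & forall s, s \in l <-> cmod (s - a) < q /\ X (z + s *: b) &
    forall z, vmod (z - z0) < ra -> da z != 0 ->
      hol1 (fun z => prodset [set s | cmod (s - a) < q /\ X (z + s *: b)]) z].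
  move=> a; have [al|] := boolP (a \in l); last by exists 0, 0, (fun=> 0).
  have [ar Xa] := (hl a).1 al.
  have [q [ra [da H]]] := local_product (aX (XU Xa)) hX Xa (iso hz0 ar (XU Xa)) e0.
  by exists q, ra, da.
have /choice[ra Hra] := Hq; have /choice[da Hda] := Hra => {Hq Hra}.
have [r1 r10 Hr1] : exists2 r1, 0 < r1 & forall a, a \in l -> r1 <= ra a.
  apply: seq_eps => [a e1 e2 h _ /le_trans|a /Hda[_ h _ _ _]]; first exact.
  by exists (ra a).
have Nd : \forall z \near z0, delta0 z != 0 by apply: near_cont_neq0 => //;
    exact: (hdelta0 hz0).1.
(* Over nearby z no point of X in the closed disc escapes the small discs. *)
have : \forall z \near z0, forall s, cmod (s - 0) <= r -> (exists2 a, a \in l &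
    cmod (s - a) < q a) \/ ~ X (z + s *: b).
  apply: tube => // s; rewrite subr0 => hs.
  have [[a al sa]|nl] := pselect (exists2 a, a \in l & cmod (s - a) < q a).
    have sa' : 0 < q a - cmod (s - a) by rewrite subr_gt0.
    have : \forall p \near (z0, s), cmod (p.2 - s) < q a - cmod (s - a).
      apply: (near_snd z0 (P := fun s' => cmod (s' - s) < q a - cmod (s - a))).
      by apply/nbhsCP; exists (q a - cmod (s - a)).
    apply: filterS => p hp; left; exists a => //.
    by have := cmod_triB p.2 s a; lra.
  have nX : ~ X (z0 + s *: b).
    have [sr|sr] := ltP (cmod s) r; last by apply: (circX hz0 _).2; apply/eqP; rewrite eq_le hs.
    move=> Xs; apply: nl; exists s; first by apply/hl.
    have sl : s \in l by apply/hl.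
    by rewrite subrr cmod0; have [/andP[]] := Hda s sl.
  by have := near_pair (notX_near (aX (dU hz0 dz0 hs)) nX); apply: filterS => p; right.
move=> Ntube.
have : \forall z \near z0, [/\ vmod (z - 0) < eps, delta0 z != 0 &
   forall s, cmod (s - 0) <= r -> (exists2 a, a \in l & cmod (s - a) < q a) \/ ~ X (z + s *: b)].
  by apply: filterS3 (in_ball_near hz0) Nd Ntube.
move=> /nbhsVP[r2 r20 Hr2].
have [r3 [r30 r31 r32]] := lt_both r10 r20.
pose Fa a z := prodset [set s | cmod (s - a) < q a /\ X (z + s *: b)].
have FE z : vmod (z - z0) < r3 -> F z = \prod_(a <- l) Fa a z.
  move=> hz; have hz2 : vmod (z - z0) < r2 by lra.
  have [_ _ Hz] := Hr2 z hz2.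
  have /choice[L HL] : forall a, exists La : seq C, a \in l ->
      uniq La /\ forall s, s \in La <-> cmod (s - a) < q a /\ X (z + s *: b).
    move=> a; have [al|] := boolP (a \in l); last by exists [::].
    have [_ _ _ /(_ z)H _] := Hda a al; have := Hr1 a al => h1.
    have [|_ [La u1 h2]] := H; first lra.
    by exists La.
  have qe a : a \in l -> q a < e by move=> /Hda[/andP[_ h] _ _ _ _].
  have LY s : s \in flatten [seq L a | a <- l] <-> Y z s.
    split=> [/flattenP[_ /mapP[a al ->]] /(HL a al).2[h1 h2]|[h1 h2]].
      split=> //; have [h3 _] := He a al; have := qe a al.
      by have := cmodD (s - a) a; rewrite subrK; rewrite subr0 in h3; lra.
    have [|[a al sa]|//] := Hz s; first by rewrite subr0 ltW.
    apply/flattenP; exists (L a); first by apply/mapP; exists a.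
    exact/(HL a al).2.
  have uL : uniq (flatten [seq L a | a <- l]).
    have : forall l', {subset l' <= l} -> uniq l' -> uniq (flatten [seq L a | a <- l']).
      elim=> [//|a l' IH] sub /= /andP[al' ul']; rewrite cat_uniq.
      have al : a \in l by apply: sub; rewrite inE eqxx.
      rewrite (HL a al).1 IH ?andbT //=; last by move=> x xl; apply: sub; rewrite inE xl orbT.
      apply/hasPn => s /flattenP[_ /mapP[a' a'l' ->]] => sL'.
      have a'l : a' \in l by apply: sub; rewrite inE a'l' orbT.
      apply/negP => sL; have [h1 _] := (HL a al).2 s; have [{}h1 _] := h1 sL.
      have [h2 _] := (HL a' a'l).2 s; have [{}h2 _] := h2 sL'.
      have ne : a' != a by apply: contraNneq al' => <-.
      have [_ /(_ _ a'l ne)] := He a al; have := qe a al; have := qe a' a'l.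
      by have := cmod_triB a' s a; rewrite [cmod (a' - s)]cmod_subC; lra.
    by apply.
  rewrite /F (prodsetE uL LY) big_flatten big_map big_seq [RHS]big_seq.
  by apply: eq_bigr => a al; rewrite /Fa (prodsetE (HL a al).1 (HL a al).2).
pose d z := \prod_(a <- l | a \in l) da a z.
have hd z : vmod (z - z0) < r3 -> hol1 d z.
  move=> hz; apply: hol1_prod => a al; have [_ _ [h _] _ _] := Hda a al; apply: h.
  by have := Hr1 a al; lra.
have zz r' : 0 < r' -> vmod (z0 - z0) < r' by rewrite subrr vmod0.
have nzd : exists2 z, vmod (z - z0) < r3 & d z != 0.
  (* The discriminants are set to 1 outside [l], so that [prod_nz] applies to all indices. *)
  pose da' a z := if a \in l then da a z else 1.
  have [y hy dy] : exists2 y, vmod (y - z0) < r3 & \prod_(a <- l) da' a y != 0.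
    apply: prod_nz => // [a y hy|a].
      rewrite /da'; have [al|_] := boolP (a \in l); last exact: hol1_cst.
      have [_ _ [h _] _ _] := Hda a al; apply: h.
      by have := Hr1 a al; lra.
    rewrite /da'; have [al|_] := boolP (a \in l); last by exists z0; [exact: zz|exact: oner_neq0].
    have [_ ra0 [h [y h1 h2]] _ _] := Hda a al.
    exact: (dense_nz h h1 h2 (zz _ ra0) (P := fun y =>
        vmod (y - z0) < r3) (in_ball_near (zz _ r30))).
  exists y => //; rewrite /d -big_seq (eq_big_seq (fun a => da' a y)) //.
  by move=> a al; rewrite /da' al.
have [y hy dy|Fe hFe HFe] := @riemannV _ _ d F z0 r3 1 r30 hd nzd.
  split; last by have [h1 h2 _] := Hr2 y (lt_trans hy r32); exact: boundF.
  apply: (@eq_hol1 _ _ (fun z => \prod_(a <- l | a \in l) Fa a z)).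
    by apply: filterS (in_ball_near hy) => z hz; rewrite FE // -big_seq.
  apply: hol1_prod => a al; have [_ _ _ _ h] := Hda a al; apply: h.
    by have := Hr1 a al; lra.
  move: dy; rewrite /d -big_seq prodf_seq_neq0 => /allP/(_ a al) /=.
  by [].
by exists Fe => //; apply: genericS HFe (generic_nz r30 hd nzd).
Qed.

(** The local extensions agree with [F] generically, hence with each other, and glue to a function
    bounded by 1 off the zeros of delta0, which extends to 0. *)
Lemma global_product : exists2 G : V -> C, nhol G 0 &
  (\forall x \near 0, X x -> G x = 0) /\
  forall P : V -> Prop, (\forall y \near 0, P y) -> exists2 y, P y & G y != 0.
Proof.
have /choice[H HH] : forall z, exists Fe : V -> C, vmod (z - 0) < eps -> delta0 z != 0 ->
    nhol Fe z /\ generic (fun y => Fe y = F y) z.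
  move=> z; have [[h1 h2]|n] := pselect (vmod (z - 0) < eps /\ delta0 z != 0).
    by have [Fe h3 h4] := locF h1 h2; exists Fe.
  by exists (fun=> 0) => h1 h2; case: n.
(* Each local extension is evaluated at its own centre; near z this agrees with [H z]. *)
pose G0 z := H z z.
have z00 : vmod (0 - 0 : V) < eps by rewrite subrr vmod0.
have zin z : vmod (z - 0) < eps -> delta0 z != 0 -> \forall y \near z, vmod (y - 0) < eps /\
    delta0 y != 0.
  move=> hz dz; apply: filterS2 (in_ball_near hz) (near_cont_neq0 (hdelta0 hz).1 dz) => y; by [].
have G0E z : vmod (z - 0) < eps -> delta0 z != 0 -> \forall y \near z, H z y = G0 y.
  move=> hz dz; have [h1 h2] := HH z hz dz.
  apply: filterS3 (zin z hz dz) h1 (generic_near h2) => y [hy dy] h1y h2y.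
  have [h3 h4] := HH y hy dy.
  exact: (generic_eq h1y.1 (nhol_hol1 h3).1 h2y h4).
have hG0 z : vmod (z - 0) < eps -> delta0 z != 0 -> hol1 G0 z /\ generic (fun y => G0 y = F y) z.
  move=> hz dz; have [h1 h2] := HH z hz dz; have h3 := G0E z hz dz; split.
    exact: eq_hol1 h3 (nhol_hol1 h1).
  by apply: genericS h2; apply: filterS h3 => y ->.
have bG0 z : vmod (z - 0) < eps -> delta0 z != 0 -> cmod (G0 z) <= 1.
  move=> hz dz; have [h1 h2] := hG0 z hz dz; apply: (generic_bound h1.1 (h := F)).
  by apply: genericS h2; apply: filterS (zin z hz dz) => y [hy dy] ->; split=> //; exact: boundF.
have [y hy dy|G hG HG] := @riemannV _ _ delta0 G0 0 eps 1 eps0 hdelta0 nzdelta0.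
  by split; [exact: (hG0 y hy dy).1|exact: bG0].
have g0 := generic_nz eps0 hdelta0 nzdelta0.
have gen : generic (fun y => [/\ G y = F y, vmod (y - 0) < eps & delta0 y != 0]) 0.
  apply: generic_trans g0.
  apply: filterS2 (in_ball_near z00) (near_join HG) => y hy NG dy.
  have [_ h2] := hG0 y hy dy; apply: genericS h2.
  by apply: filterS2 NG (zin y hy dy) => w h [hw dw] <-; split=> //; exact: h.
exists G => //; split.
  (* If G x were nonzero, G would stay above k in modulus near x. Lines near a hypersurface point of
     X close to x carry a point of X with parameter of modulus below k, and [smallF] bounds [F],
     generically equal to G, by that modulus. *)
  apply: filterS3 (near_join hG) (generic_near gen) (in_ball_near z00) => x hGx genx hx Xx.
  apply/eqP; apply: contraT => Gx.
  pose k := cmod (G x) / 2.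
  have k0 : 0 < k by rewrite divr_gt0 // cmod_gt0.
  have Nk : \forall y \near x, k < cmod (G y).
    have /contCP/(_ _ k0) := (nhol_hol1 hGx).1; apply: filterS => y h.
    by have := cmod_leB (G x) (G y); rewrite cmod_subC /k in h *; lra.
  have N1 : \forall y \near x, (k < cmod (G y) /\ generic (fun y => [/\ G y = F y,
      vmod (y - 0) < eps & delta0 y != 0]) y) /\ vmod (y - 0) < eps.
    by apply: filterS3 Nk (generic_near genx) (in_ball_near hx).
  have [y [Py Xy hy]] := hX Xx (near_join N1).
  have [[ky geny] ey] := nbhs_singleton Py.
  have Y0 : y + 0 *: b = y by rewrite scale0r addr0.
  have c0 : cmod (0 : C) < r by rewrite cmod0.
  have Uy0 : U (y + 0 *: b) by rewrite Y0; exact: XU.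
  have [d d0 Hd] := iso ey c0 Uy0.
  have [m [m0 md mk]] := lt_both d0 k0; have [m' [m'0 mm mr]] := lt_both m0 r0.
  have per : \forall z \near y, exists2 s, cmod (s - 0) < m' & X (z + s *: b).
    apply: hyper_persist; rewrite ?Y0 //.
    by move=> s /andP[s1 s2]; apply: Hd; rewrite s1 /=; lra.
  have [w Pw Qw] := genericP geny (filterI per (near_join Py : \forall z \near y,
      \forall z' \near z, _)).
  have [[s hs Xs] N2] := nbhs_singleton Pw.
  have [E1 hw dw] := nbhs_singleton Qw.
  have [[kw _] _] := nbhs_singleton N2.
  have := @smallF w s hw dw; rewrite -E1 => /(_ _)h.
  rewrite subr0 in hs.
  have Ys : Y w s by split=> //; lra.
  by have := h Ys; lra.
move=> P NP; have [w Pw Qw] := genericP gen NP.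
have [y [Py [E1 hy dy]] nX] : exists2 y, P y /\ [/\ G y = F y, vmod (y - 0) < eps &
    delta0 y != 0] & ~ X y.
  have [Xw|nXw] := pselect (X w); last first.
    by exists w => //; split; [exact: nbhs_singleton Pw|exact: nbhs_singleton Qw].
  have NPQ : \forall y \near w, P y /\ [/\ G y = F y, vmod (y - 0) < eps & delta0 y != 0].
    by apply: filterS2 Pw Qw.
  by have [y h1 h2] := nwX Xw NPQ; exists y.
by exists y => //; rewrite E1; exact: nzF.
Qed.

End GlobalProduct.

(** * Lowest-order terms and contractions *)

Section NearNorm.
Variables (R : realType) (V : normedModType R[i]).
Local Notation C := R[i].
Implicit Types (F G : V -> C) (z : V).

Lemma near_and z (P Q S : V -> Prop) : (\forall y \near z, P y) -> (\forall y \near z, Q y) ->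
  (forall y, P y -> Q y -> S y) -> \forall y \near z, S y.
Proof. by move=> h h' H; apply: filterS2 h h'. Qed.

Lemma near_imp z (P S : V -> Prop) : (\forall y \near z, P y) -> (forall y, P y -> S y) ->
    \forall y \near z, S y.
Proof. by move=> h H; apply: filterS h. Qed.

Lemma near_all z (S : V -> Prop) : (forall y, S y) -> \forall y \near z, S y.
Proof. by move=> H; apply: nearW. Qed.

Lemma near_and_pair (z : V * C) (P Q S : V * C -> Prop) :
  (\forall y \near z, P y) -> (\forall y \near z, Q y) ->
  (forall y, P y -> Q y -> S y) -> \forall y \near z, S y.
Proof. by move=> h h' H; apply: filterS2 h h'. Qed.

Lemma nholM F G z : nhol F z -> nhol G z -> nhol (fun y => F y * G y) z.
Proof. by move=> h h'; apply: near_and h h' _ => y; exact: hol1M. Qed.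

Lemma nholD F G z : nhol F z -> nhol G z -> nhol (fun y => F y + G y) z.
Proof. by move=> h h'; apply: near_and h h' _ => y; exact: hol1D. Qed.

End NearNorm.

Section Taylor.
Variable R : realType.
Local Notation C := R[i].
Local Notation "x %:C" := (real_complex R x) : ring_scope.
Variable m : nat.
Local Notation V := 'rV[C]_m.
Implicit Types (F : V -> C) (z : V) (i j : 'I_m) (l : seq 'I_m).

(** A function of the variables outside l is represented by composing with [kill l], without
    changing the space. *)
Definition kill l z : V := \row_j (if j \in l then 0 else z 0 j).

Lemma kill_nil z : kill [::] z = z.
Proof. by apply/rowP => j; rewrite mxE. Qed.

Lemma kill_cons i l z : kill [:: i] (kill l z) = kill (i :: l) z.
Proof. by apply/rowP => j; rewrite !mxE !inE; case: (j == i); case: (j \in l). Qed.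

Lemma kill0 l : kill l 0 = 0.
Proof. by apply/rowP => j; rewrite !mxE if_same. Qed.

Lemma kill_lin l z (s : C) (u : V) : kill l (z + s *: u) = kill l z + s *: kill l u.
Proof. by apply/rowP => j; rewrite !mxE; case: ifP => _ //; rewrite mulr0 addr0. Qed.

Lemma vmod_coord z (e : R) : 0 < e -> (forall j, cmod (z 0 j) < e) -> vmod z < e.
Proof.
move=> e0 H; rewrite -ltcR -vmodE.
have -> : `|z| = mx_norm z by [].
have [->|/mx_norm_neq0[[i j] ->]] := eqVneq (mx_norm z) 0; first by rewrite ltcR.
by rewrite cmodE ltcR /= ord1.
Qed.

Lemma coord_vmod z j : cmod (z 0 j) <= vmod z.
Proof.
rewrite -lecR -cmodE -vmodE.
have -> : `|z| = mx_norm z by [].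
rewrite mx_normE -[leLHS]nngE num_le.
exact: (le_bigmax _ (fun ij : 'I_1 * 'I_m => `|z ij.1 ij.2|%:nng) (0, j)).
Qed.

Lemma nbhsCV z (U : set V) : nbhs z U <->
  exists2 d : R, 0 < d & forall y : V, (forall j, cmod (y 0 j - z 0 j) < d) -> U y.
Proof.
split=> [/nbhsVP|] [d d0 H].
  exists d => // y hy; apply: H; apply: vmod_coord => // j.
  by have := hy j; rewrite !mxE.
apply/nbhsVP; exists d => // y hy; apply: H => j; apply: le_lt_trans hy.
by have := coord_vmod (y - z) j; rewrite !mxE.
Qed.

Lemma coord_hol1 j z : hol1 (fun z : V => z 0 j) z.
Proof.
split; first exact: coord_continuous.
move=> u; rewrite (_ : (fun h => _) = fun h : C => z 0 j + h * u 0 j).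
  by apply: dD (dcst _ _) _; apply: dM (did _) (dcst _ _).
by apply/funext => h; rewrite !mxE.
Qed.

Lemma kill_cont l : continuous (kill l).
Proof.
move=> z U /= /nbhsCV[d d0 H]; apply/nbhsCV; exists d => // y hy; apply: H => j.
by rewrite !mxE; case: ifP => _ //; rewrite subrr cmod0.
Qed.

Lemma near_kline l z (s : C) (u : V) (P : V -> Prop) : (\forall y \near (kill l z + s *: u),
    P y) ->
  \forall p \near (z, s), P (kill l p.1 + p.2 *: u).
Proof.
move=> /near_pair[[A B] /= [hA hB] AB]; exists (kill l @^-1` A, B); last first.
  by move=> [y t] [/= h1 h2]; exact: (AB (kill l y, t)).
by split; [exact: (@kill_cont l z)|exact: hB].
Qed.

Lemma cont_shift (w z : V) : {for z, continuous (fun y : V => y + w)}.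
Proof.
move=> U /= /nbhsCV[d d0 H]; apply/nbhsCV; exists d => // y hy; apply: H => j.
by rewrite !mxE opprD addrACA subrr addr0.
Qed.

Lemma hol1_kill l F z (w : V) : hol1 F (kill l z + w) -> hol1 (fun y => F (kill l y + w)) z.
Proof.
move=> [cf df]; split.
  move=> U hU; have h1 : nbhs (kill l z + w) (F @^-1` U) by exact: (cf U hU).
  have h2 := @cont_shift w (kill l z) _ h1; exact: (@kill_cont l z _ h2).
move=> u; rewrite (_ : (fun h => _) = fun h => F (kill l z + w + h *: kill l u)); first exact: df.
by apply/funext => h; rewrite kill_lin addrAC.
Qed.

Lemma near_kill l z (P : V -> Prop) : (\forall y \near kill l z, P y) -> \forall y \near z,
    P (kill l y).
Proof. by move=> h; exact: (@kill_cont l z). Qed.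

Lemma nhol_kill l F : nhol F 0 -> nhol (fun y => F (kill l y)) 0.
Proof.
rewrite -{1}(kill0 l) => /near_kill h0; apply: near_imp h0 _ => y h.
have : hol1 F (kill l y + 0) by rewrite addr0.
move=> /hol1_kill; rewrite (_ : (fun y => F (kill l y + 0)) = fun y => F (kill l y)) //.
by apply/funext => x; rewrite addr0.
Qed.

Lemma nhol_cst (k : C) z : nhol (fun=> k : C) z.
Proof. by apply: near_all => y; exact: hol1_cst. Qed.

Lemma kill1E i z : kill [:: i] z = z - z 0 i *: delta_mx 0 i.
Proof.
apply/rowP => j; rewrite !mxE inE /=; case: eqVneq => [->|_]; first by rewrite mulr1 subrr.
by rewrite mulr0 subr0.
Qed.

(** The Cauchy kernels for z_i and for 0 differ by z_i / (s - z_i), so Q is the Cauchy integral with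
    kernel 1 / (s - z_i). *)
Lemma divide i F : nhol F 0 -> exists2 Q, nhol Q 0 &
  \forall z \near (0 : V), F z = F (kill [:: i] z) + z 0 i * Q z.
Proof.
move=> hF; pose e : V := delta_mx 0 i.
have : \forall p \near ((0 : V), (0 : C)), nhol F (p.1 + p.2 *: e).
  by apply: near_pair; rewrite scale0r addr0; exact: nhol_near.
move=> /near_fix[d d0 Hd]; pose q := d / 4.
have q0 : 0 < q by rewrite divr_gt0.
have Hk : \forall z \near (0 : V), forall s, cmod s < d -> nhol F (kill [:: i] z + s *: e).
  move: Hd; rewrite -{1}(kill0 [:: i]) => /near_kill h0; apply: near_imp h0 _ => z h s hs.
  by apply: (h s); rewrite subr0.
have Nz : nbhs (0 : V) (fun z : V => cmod (z 0 i) < q).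
  by apply/nbhsCV; exists q => // y /(_ i); rewrite mxE subr0.
pose g (z : V) (s : C) := F (kill [:: i] z + s *: e) / (s - z 0 i).
exists (fun z => avg (fun t => g z (circ 0 q t))).
  apply: avg_hol1 => // s; rewrite subr0 => hs.
  have sd : cmod s < d by rewrite hs /q; lra.
  have hh := nbhs_singleton Hk s sd.
  have s0 : s - (0 : V) 0 i != 0 by rewrite mxE subr0 -cmod_gt0 hs.
  have cz (p : V * C) : {for p, continuous (fun p : V * C => p.2 - (p.1 : V) 0 i)}.
    apply: cvgB; first exact: cvg_snd.
    by apply: (@continuous_comp _ _ _ (@fst V C) (fun z : V => z 0 i));
        [exact: cvg_fst|exact: coord_continuous].
  have N1 : \forall p \near ((0 : V), s), nhol F (kill [:: i] p.1 + p.2 *: e).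
    by apply: near_kline; exact: nhol_near.
  have N2 : \forall p \near ((0 : V), s), p.2 - (p.1 : V) 0 i != 0.
    have /contCP/(_ (cmod (s - (0 : V) 0 i))) := cz (0, s); rewrite cmod_gt0 => /(_ s0) h0.
    by apply: (near_and_pair h0 h0) => p _; apply: contraTneq => ->; rewrite sub0r cmodN ltxx.
  apply: near_and_pair N1 N2 _ => -[z s'] /= h1 h2 _; rewrite /g; split.
    apply: hol1M; first exact/hol1_kill/nhol_hol1.
    by apply: (hol1V (hol1B (hol1_cst _ _) (coord_hol1 _ _)) h2).
  apply: cvgM.
    by move=> U /((nhol_hol1 h1).1) hU; exact: (@near_kline _ z s' e _ hU).
  by apply: cvgV; [exact: h2|exact: (cz (z, s'))].
apply: near_and Hk Nz _ => z Hk hz.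
pose phi s := F (kill [:: i] z + s *: e).
have hphi : hol 0 d phi by move=> s; rewrite subr0 => hs; apply: hol1_line; exact/nhol_hol1/Hk.
have qd : q < d by rewrite /q; lra.
have z0q : cmod (z 0 i - 0) < q by rewrite subr0.
have c0q : cmod (0 - 0 : C) < q by rewrite subrr cmod0.
have -> : F z = phi (z 0 i) by rewrite /phi kill1E subrK.
have -> : F (kill [:: i] z) = phi 0 by rewrite /phi scale0r addr0.
have ip : icont (fun t => phi (circ 0 q t)).
  by apply: (icont_hol hphi); [exact: ltW|rewrite subrr cmod0 add0r].
have [i1 _] := avg_kernel z0q; have [i2 _] := avg_kernel c0q; have [i3 _] := avg_pole z0q.
rewrite (cauchy hphi qd z0q) (cauchy hphi qd c0q) -avgZ; last exact: icontM.
rewrite -avgD; [|exact: icontM|apply: icontM; [exact: icont_cst|exact: icontM]].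
apply: eq_avg => t _; rewrite /g /= -/e -/(phi _).
have cn0 : circ 0 q t != 0 by rewrite -cmod_gt0 -(subr0 (circ 0 q t)) circ_dist // ltW.
have czn : circ 0 q t - z 0 i != 0.
  rewrite subr_eq0; apply: contraTneq z0q => <-; by rewrite circ_dist ?ltxx // ltW.
by rewrite !subr0; field; rewrite cn0 czn.
Qed.

Lemma taylor_i i F D : nhol F 0 -> exists (c : nat -> V -> C) (Q : V -> C),
  [/\ forall k, nhol (c k) 0, nhol Q 0 & \forall z \near (0 : V),
    F z = \sum_(k < D) z 0 i ^+ k * c k (kill [:: i] z) + z 0 i ^+ D * Q z].
Proof.
move=> hF; elim: D => [|D [c [Q [hc hQ E]]]].
  exists (fun _ _ => 0), F; split; [by move=> k; exact: nhol_cst|exact: hF|].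
  by apply: near_all => z; rewrite big_ord0 add0r expr0 mul1r.
have [Q' hQ' E'] := divide i hQ.
exists (fun k => if k == D then Q else c k), Q'; split=> [k||].
- by case: ifP => _; [exact: hQ|exact: hc].
- exact: hQ'.
apply: near_and E E' _ => z -> ->; rewrite big_ord_recr /= eqxx mulrDr addrA exprSr mulrA.
congr (_ + _ + _); apply: eq_bigr => k _.
by rewrite ltn_eqF.
Qed.

Definition mon (al : {ffun 'I_m -> nat}) z : C := \prod_j z 0 j ^+ al j.

Lemma nhol_mon al z : nhol (mon al) z.
Proof.
apply: near_all => y; apply: hol1_prod => j _; elim: (al j) => [|k IH].
  by under eq_fun do rewrite expr0; exact: hol1_cst.
by under eq_fun do rewrite exprS; apply: hol1M (coord_hol1 _ _) IH.
Qed.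

Lemma taylor_list D l F : uniq l -> nhol F 0 ->
  exists (L : seq ({ffun 'I_m -> nat} * (V -> C))) (G : 'I_m -> V -> C),
  [/\ forall x, List.In x L -> nhol x.2 0, forall j, nhol (G j) 0 & \forall z \near (0 : V),
    F z = \sum_(x <- L) mon x.1 z * x.2 (kill l z) + \sum_j z 0 j ^+ D * G j z].
Proof.
move=> ul hF; elim: l ul => [_|i l IH /= /andP[il ul]].
  exists [:: ([ffun=> 0%N], F)], (fun _ _ => 0); split.
  - by move=> x [<-|[]].
  - by move=> j; exact: nhol_cst.
  apply: near_all => z; rewrite big_seq1 /= kill_nil [X in _ + X]big1 ?addr0.
    by rewrite /mon big1 ?mul1r // => j _; rewrite ffunE expr0.
  by move=> j _; rewrite mulr0.
have [L [G [hL hG E]]] := IH ul.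
suff [L' [G' [hL' hG' E']]] : exists (L' : seq ({ffun 'I_m -> nat} * (V -> C))) (G' : V -> C),
  [/\ forall x, List.In x L' -> nhol x.2 0, nhol G' 0 & \forall z \near (0 : V),
    \sum_(x <- L) mon x.1 z * x.2 (kill l z) =
    \sum_(x <- L') mon x.1 z * x.2 (kill (i :: l) z) + z 0 i ^+ D * G' z].
  exists L', (fun j z => G j z + (if j == i then G' z else 0)); split=> [//|j|].
    apply: nholD; first exact: hG.
    by case: (j == i); [exact: hG'|exact: nhol_cst].
  apply: near_and E E' _ => z -> ->; rewrite -addrA; congr (_ + _).
  have -> : \sum_j z 0 j ^+ D * (G j z + (if j == i then G' z else 0)) =
      \sum_j z 0 j ^+ D * G j z + \sum_j z 0 j ^+ D * (if j == i then G' z else 0).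
    by rewrite -big_split; apply: eq_bigr => j _; rewrite mulrDr.
  rewrite addrC; congr (_ + _).
  rewrite [RHS](bigD1 i) //= eqxx big1 ?addr0 // => j ji.
  by rewrite (negPf ji) mulr0.
elim: L hL {E} => [_|[al c] L IHL hL].
  exists [::], (fun=> 0); split; [by []|exact: nhol_cst|].
  by apply: near_all => z; rewrite !big_nil mulr0 addr0.
have [L' [G' [hL' hG' E']]] := IHL (fun x xL => hL x (or_intror xL)).
have hc : nhol c 0 := hL (al, c) (or_introl erefl).
have [ck [Q [hck hQ EQ]]] := taylor_i i D hc.
pose al' k : {ffun 'I_m -> nat} := [ffun j => (al j + (j == i) * k)%N].
exists ([seq (al' (nat_of_ord k), ck (nat_of_ord k)) | k <- enum 'I_D] ++ L'), (fun z =>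
    mon al z * Q (kill l z) + G' z).
split.
- move=> x /(@List.in_app_or _ _ _ _)[|/hL' //].
  by elim: (enum 'I_D) => [//|k s IHs] /= [<- /=|/IHs //]; exact: hck.
- by apply: nholD hG'; apply: nholM (nhol_mon _ _) _; exact: nhol_kill.
have EQ' : \forall z \near (0 : V),
    c (kill l z) = \sum_(k < D) z 0 i ^+ k * ck k (kill (i :: l) z) + z 0 i ^+ D * Q (kill l z).
  move: EQ; rewrite -{1}(kill0 l) => /near_kill h0; apply: near_imp h0 _ => z ->.
  rewrite !mxE (negPf il); congr (_ + _); apply: eq_bigr => k _.
  by rewrite kill_cons.
apply: near_and E' EQ' _ => z E1 E2; rewrite big_cons /= E1 E2 big_cat /= mulrDr mulrDr mulrCA.
rewrite [RHS]addrACA; congr (_ + _ + (_ + _)).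
rewrite big_map big_enum /= mulr_sumr; apply: eq_bigr => k _ /=.
rewrite mulrA; congr (_ * _).
rewrite /mon [RHS](eq_bigr (fun j => z 0 j ^+ al j * z 0 j ^+ ((j == i) * k))); last first.
  by move=> j _; rewrite ffunE exprD.
rewrite big_split /=; congr (_ * _).
rewrite (bigD1 i) //= eqxx mul1n big1 ?mulr1 // => j ji.
by rewrite (negPf ji) mul0n expr0.
Qed.

(** The remainder is sorted by pure powers z_j^D rather than by total degree; under a contraction
    each such power has a decay rate that D makes as large as wanted. *)
Lemma taylor D F : nhol F 0 ->
  exists (S : seq {ffun 'I_m -> nat}) (k : {ffun 'I_m -> nat} -> C) (G : 'I_m -> V -> C),
  [/\ uniq S, forall al, al \in S -> k al != 0, forall j, nhol (G j) 0 & \forall z \near (0 : V),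
    F z = \sum_(al <- S) k al * mon al z + \sum_j z 0 j ^+ D * G j z].
Proof.
move=> hF; have [L [G [_ hG E]]] := taylor_list D (enum_uniq 'I_m) hF.
pose k al := \sum_(x <- L | x.1 == al) x.2 0.
exists [seq al <- undup (map fst L) | k al != 0], k, G; split.
- by rewrite filter_uniq ?undup_uniq.
- by move=> al; rewrite mem_filter => /andP[].
- exact: hG.
apply: near_imp E _ => z ->; congr (_ + _).
have -> : kill (enum 'I_m) z = 0 by apply/rowP => j; rewrite !mxE mem_enum.
rewrite big_filter [RHS]big_mkcond /=.
rewrite [RHS](eq_bigr (fun al => \sum_(x <- L | x.1 == al) mon x.1 z * x.2 0)); last first.
  move=> al _; have -> : \sum_(x <- L | x.1 == al) mon x.1 z * x.2 0 = k al * mon al z.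
    by rewrite mulrC mulr_sumr; apply: eq_bigr => x /eqP->.
  by have [->|_] := eqVneq (k al) 0; rewrite ?mul0r.
rewrite (exchange_big_dep xpredT) //=; apply: eq_big_seq => x xL.
rewrite -big_filter (_ : [seq al <- _ | _] = [:: x.1]) ?big_seq1 //.
rewrite -(filter_pred1_uniq (undup_uniq (map fst L))) ?mem_undup ?map_f //.
by apply: eq_filter => al /=; rewrite eq_sym.
Qed.

End Taylor.

Section LowestTerm.
Variable R : realType.
Local Notation C := R[i].
Local Notation "x %:C" := (real_complex R x) : ring_scope.
Variable m : nat.
Local Notation V := 'rV[C]_m.
Implicit Types (F : V -> C) (z : V) (i j : 'I_m) (al : {ffun 'I_m -> nat}).

Definition mdeg al := (\sum_j al j)%N.

Lemma mon_scale al (s : C) z : mon al (s *: z) = s ^+ mdeg al * mon al z.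
Proof.
rewrite /mon /mdeg expr_sum -big_split /=; apply: eq_bigr => j _.
by rewrite mxE exprMn.
Qed.

Lemma small_term (A e : R) : 0 < e -> exists2 d, 0 < d & d * A < e.
Proof.
move=> e0; have A1 : 0 < `|A| + 1 by rewrite ltr_wpDl.
exists (e / (`|A| + 1)); first by rewrite divr_gt0.
by rewrite mulrAC ltr_pdivrMr // ltr_pM2l // (le_lt_trans (ler_norm A)) // ltrDl.
Qed.

(** n is the order at 0 of [F] on a line where it is not identically zero; terms all of degree above
    n would give a higher order there. It is found before D, so that D may be chosen in terms of
    it. *)
Lemma lowest_order F : nhol F 0 ->
  (forall P : V -> Prop, (\forall y \near (0 : V), P y) -> exists2 y, P y & F y != 0) ->
  exists n, forall D (S : seq {ffun 'I_m -> nat}) (k : {ffun 'I_m -> nat} -> C) (G : 'I_m ->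
      V -> C),
    (n < D)%N -> (forall j, nhol (G j) 0) ->
    (\forall z \near (0 : V), F z = \sum_(al <- S) k al * mon al z + \sum_j z 0 j ^+ D * G j z) ->
    exists2 al, al \in S & (mdeg al <= n)%N.
Proof.
move=> hF nF; have [e e0 He] := (nbhsVP _ _).1 hF.
have e20 : 0 < e / 2 by rewrite divr_gt0.
have [y hy Fy] : exists2 y, vmod (y - 0) < e / 2 & F y != 0.
  by apply: nF; apply: in_ball_near; rewrite subrr vmod0.
pose f s := F (0 + s *: y).
have hf : hol 0 2 f.
  move=> s; rewrite subr0 => hs; apply: hol1_line; apply: He.
  rewrite add0r subr0 vmodZ; apply: le_lt_trans (_ : 2 * vmod y < _).
    by rewrite ler_wpM2r ?vmod_ge0 // ltW.
  by move: hy; rewrite subr0 ltr_pdivlMr // mulrC.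
have [/(_ 1)|[n [g [hg g0 fE]]]] := factor (ltr0Sn R 1) hf.
  rewrite subr0 /f cmod1 scale1r add0r => /(_ _) h; exfalso; apply/negP: Fy; rewrite negbK h //.
  by rewrite ltrDl.
exists n => D S k G nD hG E; apply: contrapT => nS.
have hS al : al \in S -> (n < mdeg al)%N.
  by move=> alS; rewrite ltnNge; apply/negP => h; apply: nS; exists al.
pose a := cmod (g 0); have a0 : 0 < a by rewrite cmod_gt0.
have h2 : cmod (0 - 0 : C) < 2 by rewrite subrr cmod0.
have cg : {for (0 : C), continuous g} by exact/differentiable_continuous/(hg 0 2 h2 hf).
have a20 : 0 < a / 2 by rewrite divr_gt0.
have [d1 d10 Hd1] := (cont1P g 0).1 cg _ a20.
pose M j := cmod (G j 0) + 1.
have cG j : exists2 d, 0 < d & forall s, cmod s < d -> cmod (G j (s *: y)) <= M j.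
  have := near_line y (hG j) => -[d d0 Hd].
  have cj : {for (0:C), continuous (fun s : C => G j (0 + s *: y))}.
    apply/differentiable_continuous/hol1_line; apply: Hd; by rewrite cmod0.
  have [d' d'0 Hd'] := cont_bound cj; exists d' => // s hs.
  by have := Hd' s; rewrite subr0 add0r scale0r addr0 /M => /(_ hs).
have [d2 d20 Hd2] : exists2 d, 0 < d & forall j s, cmod s < d -> cmod (G j (s *: y)) <= M j.
  suff [d d0 Hd] : exists2 d, 0 < d & forall j, j \in enum 'I_m -> forall s, cmod s < d ->
      cmod (G j (s *: y)) <= M j.
    by exists d => // j; apply: Hd; rewrite mem_enum.
  elim: (enum 'I_m) => [|j l [d d0 Hd]]; first by exists 1.
  have [d' d'0 Hd'] := cG j; have [t [t0 td td']] := lt_both d0 d'0.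
  exists t => // j'; rewrite inE => /orP[/eqP->|jl] s hs; first exact/Hd'/(lt_trans hs).
  by apply: (Hd _ jl); exact: lt_trans hs td.
have [d3 d30 Hd3] := near_line y E.
pose A := \sum_(al <- S) cmod (k al * mon al y) + \sum_j cmod (y 0 j ^+ D) * M j.
have [d4 d40 Hd4] := small_term A a20.
have [t1 [t10 t1a t1b]] := lt_both d10 d20.
have [t2 [t20 t2a t2b]] := lt_both d30 d40.
have [t3 [t30 t3a t3b]] := lt_both t10 t20.
have [t [t0 ta tb]] := lt_both t30 (ltr01 : 0 < 1 :> R).
have ct : cmod t%:C = t by rewrite cmodC gtr0_norm.
have tn0 : (t%:C : C) != 0 by rewrite -cmod_gt0 ct.
have low : a / 2 < cmod (g t%:C).
  have := Hd1 t%:C; rewrite subr0 ct cmod_subC => /(_ (lt_trans ta (lt_trans t3a t1a))).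
  by have := cmodD (g 0 - g t%:C) (g t%:C); rewrite subrK -/a; clear; lra.
have Ft := Hd3 t%:C; rewrite ct add0r in Ft; have {}Ft := Ft (lt_trans ta (lt_trans t3b t2a)).
have F1 : F (t%:C *: y) = t%:C ^+ n * g t%:C by rewrite -(add0r (_ *: y)) -/(f _) fE subr0.
have tn : 0 < t ^+ n by rewrite exprn_gt0.
have pw (p : nat) : (n < p)%N -> cmod ((t%:C : C) ^+ p) <= t ^+ n * t.
  move=> np; rewrite cmodX ct -exprSr; apply: ler_wiXn2l => //; [exact: ltW|exact: ltW].
have up : t ^+ n * cmod (g t%:C) <= t ^+ n * (t * A).
  rewrite -{1}ct -cmodX -cmodM -F1 Ft; apply: le_trans (cmodD _ _) _.
  rewrite /A mulrDr mulrDr; apply: lerD.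
    apply: le_trans (cmod_sum _ _ _) _; rewrite mulrA mulr_sumr.
    rewrite big_seq [leRHS]big_seq; apply: ler_sum => al alS.
    rewrite mon_scale mulrCA [cmod (t%:C ^+ _ * _)]cmodM; apply: ler_wpM2r; first exact: cmod_ge0.
    exact/pw/hS.
  apply: le_trans (cmod_sum _ _ _) _; rewrite mulrA mulr_sumr.
  apply: ler_sum => j _; rewrite mxE exprMn -[X in cmod X <= _]mulrA cmodM; apply: ler_pM;
      rewrite ?cmod_ge0 //.
    exact: pw.
  rewrite cmodM; apply: ler_wpM2l; first exact: cmod_ge0.
  apply: Hd2; rewrite ct; exact: lt_trans ta (lt_trans t3a t1b).
move: up; rewrite ler_pM2l // => up.
have A0 : 0 <= A.
  apply: addr_ge0; apply: sumr_ge0 => *; rewrite ?cmod_ge0 //.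
  by apply: mulr_ge0; rewrite ?cmod_ge0 // addr_ge0 ?cmod_ge0.
have : t * A <= d4 * A by rewrite ler_wpM2r // ltW // (lt_trans ta) // (lt_trans t3b).
by move: up low Hd4; clear; lra.
Qed.

End LowestTerm.

Section Contraction.
Variable R : realType.
Local Notation C := R[i].
Local Notation "x %:C" := (real_complex R x) : ring_scope.
Variable m : nat.
Local Notation V := 'rV[C]_m.
Variable h : {vspace 'rV[C]_m}.
Implicit Types (F : V -> C) (i j : 'I_m) (al be : {ffun 'I_m -> nat}).

Lemma perturb_neq0 (T : eqType) (s : seq T) (f f' : T -> R) : {in s, forall g, f g != 0} ->
  exists2 d, 0 < d & forall t, 0 < t < d -> {in s, forall g, f g + t * f' g != 0}.
Proof.
elim: s => [|g s IH] H; first by exists 1.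
have [|d d0 Hd] := IH; first by move=> x xs; apply: H; rewrite inE xs orbT.
have g0 : 0 < `|f g| by rewrite normr_gt0 H ?mem_head.
have [d' d'0 Hd'] := small_term `|f' g| g0; have [e [e0 ed ed']] := lt_both d0 d'0.
exists e => // t /andP[t0 te] x; rewrite inE => /orP[/eqP->|xs]; last first.
  by apply: Hd => //; rewrite t0 (lt_trans te).
rewrite addr_eq0; apply: contraTneq Hd' => ->; rewrite normrN normrM gtr0_norm // -leNgt.
by rewrite ler_wpM2r // ltW // (lt_trans te).
Qed.

Definition ipair (g : 'rV[int]_m) (v : 'rV[R]_m) : R := \sum_(j < m) (g 0 j)%:~R * v 0 j.

Lemma ipairD g v w (t : R) : ipair g (v + t *: w) = ipair g v + t * ipair g w.
Proof.
rewrite /ipair mulr_sumr -big_split /=; apply: eq_bigr => j _.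
by rewrite !mxE; ring.
Qed.

(** A nonzero integer vector is nonzero at some w of p(h); a small step along w makes it nonzero at
    the new vector without spoiling the finitely many conditions already achieved. *)
Lemma generic_vec (s : seq 'rV[int]_m) : no_character_vanishes h -> {in s, forall g, g != 0} ->
  forall (v0 : 'rV[R]_m) (e : R), v0 \in ph h -> 0 < e -> exists v : 'rV[R]_m,
  [/\ v \in ph h, forall j, `|v 0 j - v0 0 j| < e & {in s, forall g, ipair g v != 0}].
Proof.
move=> nc; elim: s => [|g s IH] H v0 e v0h e0.
  by exists v0; split=> // j; rewrite subrr normr0.
have e20 : 0 < e / 2 by rewrite divr_gt0.
have [|v [vh ve vs]] := IH _ v0 (e / 2) v0h e20; first by move=> x xs; apply: H;
    rewrite inE xs orbT.
have [w wh gw] : exists2 w : 'rV[R]_m, w \in ph h & ipair g w != 0.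
  apply: contrapT => nw; have /negP := H g (mem_head _ _); apply; apply/eqP/nc => x xh.
  by apply: contrapT => /eqP hx; apply: nw; exists x.
have [d d0 Hd] := perturb_neq0 (fun g => ipair g w) vs.
have [d1 d10 Hd1] : exists2 d1 : R, 0 < d1 & forall t, 0 < t < d1 ->
    ipair g v + t * ipair g w != 0.
  have [gv|gv] := eqVneq (ipair g v) 0.
    by exists 1 => // t /andP[t0 _]; rewrite gv add0r; apply: mulf_neq0 => //; rewrite gt_eqF.
  have [|d1 d10 Hd1] := @perturb_neq0 _ [:: g] (fun=> ipair g v) (fun=> ipair g w).
    by move=> x _.
  by exists d1 => // t ht; apply: (Hd1 t ht g); rewrite mem_head.
have [d2 d20 Hd2] := small_term (\sum_j `|w 0 j|) e20.
have [t1 [t10 t1a t1b]] := lt_both d0 d10; have [t [t0 ta tb]] := lt_both t10 d20.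
exists (v + t *: w); split.
- by rewrite rpredD // rpredZ.
- move=> j; rewrite !mxE addrAC; apply: le_lt_trans (ler_normD _ _) _.
  rewrite normrM gtr0_norm //; have := ve j.
  have : t * `|w 0 j| <= d2 * \sum_j `|w 0 j|.
    rewrite ler_pM ?normr_ge0 //; [exact: ltW|exact: ltW|].
    by rewrite (bigD1 j) //= lerDl sumr_ge0.
  by lra.
move=> x; rewrite ipairD inE => /orP[/eqP->|xs].
  by apply: Hd1; rewrite t0 (lt_trans ta).
by apply: Hd => //; rewrite t0 (lt_trans ta).
Qed.

Lemma cexpMn (z : C) (k : nat) : cexp (z *+ k) = cexp z ^+ k.
Proof. by elim: k => [|k IH]; rewrite ?cexp0 // mulrS cexpD IH exprS. Qed.

(** As h is a complex subspace it contains i w for a lift w of v, and 2 pi i times i w has real part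
    - 2 pi v. *)
Lemma contraction (v : 'rV[R]_m) : v \in ph h -> exists2 x, x \in h &
  forall j, cmod (texp x 0 j) = expR (- (2 * pi) * v 0 j).
Proof.
move=> /asboolP[w wh ->]; exists ('i%C *: w); first by rewrite rpredZ.
move=> j; rewrite !mxE; case: (w 0 j) => a b; rewrite -(cmod_cexp _ (2 * pi * - b)).
by congr (cmod (cexp _)); apply/eqP; rewrite eq_complex /=; apply/andP; split; apply/eqP; ring.
Qed.

Lemma texp_iter (x : V) (k : nat) j : texp (x *+ k) 0 j = texp x 0 j ^+ k.
Proof. by rewrite !mxE -cexpMn; congr cexp; rewrite mulmxnE mulrnAr. Qed.


Lemma seq_argmin (T : eqType) (s : seq T) (f : T -> R) x : x \in s ->
  exists2 x0, x0 \in s & {in s, forall y, f x0 <= f y}.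
Proof.
elim: s x => // y s IH x _; case: s IH => [|z s] IH.
  by exists y; rewrite ?mem_head // => t; rewrite inE => /eqP->.
have [x0 x0s Hx0] := IH z (mem_head _ _); have [xy|yx] := leP (f x0) (f y).
  exists x0 => [|t]; first by rewrite inE x0s orbT.
  by rewrite inE => /orP[/eqP->|/Hx0].
exists y => [|t]; first exact: mem_head.
rewrite inE => /orP[/eqP->//|/Hx0].
exact/le_trans/ltW.
Qed.

Lemma pow_small (rho M e : R) : 0 <= rho < 1 -> 0 < e ->
  exists N, forall k, (N <= k)%N -> M * rho ^+ k < e.
Proof.
move=> /andP[r0 r1] e0; have [d d0 Hd] := small_term `|M| e0.
have /cvgr0_norm_lt/(_ d d0)[N _ HN] := cvg_expr (z := rho) (eq_ind_r (fun x =>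
    is_true (x < 1)) r1 (ger0_norm r0)).
exists N => k /HN /= hk; apply: le_lt_trans Hd.
apply: le_trans (ler_norm _) _; rewrite normrM mulrC ler_wpM2r //; exact: ltW.
Qed.

Lemma ev_all (T : eqType) (s : seq T) (P : T -> nat -> Prop) :
  (forall x, x \in s -> exists N, forall k, (N <= k)%N -> P x k) ->
  exists N, forall k x, (N <= k)%N -> x \in s -> P x k.
Proof.
elim: s => [|x s IH] H; first by exists 0%N.
have [|N HN] := IH; first by move=> y ys; apply: H; rewrite inE ys orbT.
have [N' HN'] := H x (mem_head _ _); exists (maxn N N') => k y.
by rewrite geq_max inE => /andP[kN kN'] /orP[/eqP->|ys]; [exact: HN'|exact: HN].
Qed.

Lemma mon_act al (t a : V) : mon al (torus_act t a) = mon al t * mon al a.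
Proof. by rewrite /mon -big_split; apply: eq_bigr => j _; rewrite mxE exprMn. Qed.

(** The decay rate, up to the factor 2 pi, of the monomial al under the contraction attached to
    v. *)
Definition wt (v : 'rV[R]_m) al : R := \sum_j v 0 j *+ al j.

Lemma cmod_mon (v : 'rV[R]_m) (x : V) al : (forall j,
    cmod (texp x 0 j) = expR (- (2 * pi) * v 0 j)) ->
  cmod (mon al (texp x)) = expR (- (2 * pi) * wt v al).
Proof.
move=> H; rewrite /mon cmod_prod /wt mulr_sumr expR_sum; apply: eq_bigr => j _.
by rewrite cmodX H -expRM_natl -[v 0 j *+ _]mulr_natl; congr expR; ring.
Qed.

Lemma mon_iter al (x : V) (k : nat) : mon al (texp (x *+ k)) = mon al (texp x) ^+ k.
Proof.
by rewrite /mon -prodrXl; apply: eq_bigr => j _; rewrite texp_iter -!exprM mulnC.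
Qed.

Definition idiff al be : 'rV[int]_m := \row_j ((al j)%:Z - (be j)%:Z).

Lemma idiff_neq0 al be : al != be -> idiff al be != 0.
Proof.
apply: contra_neq => /rowP H; apply/ffunP => j; have := H j; rewrite !mxE => /eqP.
by rewrite subr_eq0 => /eqP[].
Qed.

Lemma ipair_idiff al be v : ipair (idiff al be) v = wt v al - wt v be.
Proof.
rewrite /ipair /wt -sumrB; apply: eq_bigr => j _.
by rewrite mxE rmorphB /= mulrBl !pmulrn !mulr_natl.
Qed.

(** The points exp(p x) a stay in X and tend to 0, so [F] vanishes at them for large p. Yet the
    monomial of least weight dominates all other terms of the expansion by a geometric factor, and
    it is nonzero at a. *)
Lemma toric_lowest (X : set V) F (v0 : 'rV[R]_m) a : no_character_vanishes h ->
  v0 \in ph h -> (forall j, 0 < v0 0 j) -> nhol F 0 ->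
  (forall P : V -> Prop, (\forall y \near (0 : V), P y) -> exists2 y, P y & F y != 0) ->
  (\forall y \near (0 : V), X y -> F y = 0) ->
  (forall x z, x \in h -> X z -> X (torus_act (texp x) z)) ->
  X a -> (forall j, a 0 j != 0) -> False.
Proof.
move=> nc v0h v0pos hF nF FX HX Xa a0.
have [n Hn] := lowest_order hF nF.
have [c [c0 Hc]] : exists c, 0 < c /\ forall j, c <= v0 0 j.
  suff [c c0 Hc] : exists2 c, 0 < c & {in enum 'I_m, forall j, c <= v0 0 j}.
    by exists c; split=> // j; apply: Hc; rewrite mem_enum.
  elim: (enum 'I_m) => [|j s [c c0 Hc]]; first by exists 1.
  have [e [e0 ec ej]] := lt_both c0 (v0pos j).
  exists e => // i; rewrite inE => /orP[/eqP->|/Hc]; first exact: ltW.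
  exact/le_trans/ltW.
(* Every v_j will lie between c / 2 and [B]: c is a lower bound of the entries of v0, and they are
   moved by less than c / 2. *)
pose B := \sum_j v0 0 j + c / 2.
have c20 : 0 < c / 2 by rewrite divr_gt0.
(* A monomial of degree at most n then has weight at most n B, less than the weight D v_j of any
   remainder term. *)
have [D nD DB] : exists2 D, (n < D)%N & n%:R * B < D%:R * (c / 2).
  pose b := n%:R * B / (c / 2).
  exists (n + 1 + Num.bound b)%N; first by rewrite addn1 addSn ltnS leq_addr.
  rewrite -ltr_pdivrMr //; apply: le_lt_trans (ler_norm _) _.
  apply: lt_le_trans (archi_boundP (normr_ge0 _)) _; rewrite ler_nat.
  by rewrite /Num.bound normr_id leq_addl.
have [S [k [G [uS kS hG E]]]] := taylor D hF.
have [as_ asS asn] := Hn D S k G nD hG E.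
(* If v is nonzero on all these differences, the exponents in S have distinct weights and the least
   one is attained once. *)
pose Ga := [seq idiff p.1 p.2 | p <- [seq (al, be) | al <- S, be <- S] & p.1 != p.2].
have [|v [vh vv0 vGa]] := @generic_vec Ga nc _ v0 (c / 2) v0h c20.
  by move=> g /mapP[p]; rewrite mem_filter => /andP[pp _] ->; exact: idiff_neq0.
have [al0 al0S al0m] := seq_argmin (wt v) asS.
have al0lt al : al \in S -> al != al0 -> wt v al0 < wt v al.
  move=> alS ne; rewrite lt_neqAle al0m // andbT eq_sym -subr_eq0 -ipair_idiff; apply: vGa.
  by apply/mapP; exists (al, al0) => //; rewrite mem_filter ne /=; apply/allpairsP; exists (al,
      al0).
have vB j : c / 2 <= v 0 j <= B.
  have : v0 0 j <= \sum_j v0 0 j.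
    by rewrite (bigD1 j) //= lerDl sumr_ge0 // => i _; apply: ltW.
  by have := vv0 j; have := Hc j; rewrite /B ltr_norml => ? /andP[? ?] ?; apply/andP; split; lra.
have wD j : wt v al0 < D%:R * v 0 j.
  apply: le_lt_trans (al0m _ asS) _; apply: le_lt_trans (_ : n%:R * B < _); last first.
    by apply: lt_le_trans DB _; rewrite ler_wpM2l //; case/andP: (vB j).
  have B0 : 0 <= B by case/andP: (vB j) => ? ?; lra.
  apply: le_trans (_ : (mdeg as_)%:R * B <= _); last by rewrite ler_wpM2r // ler_nat.
  rewrite /wt /mdeg natr_sum mulr_suml; apply: ler_sum => i _.
  by rewrite mulr_natl lerMn2r; case/andP: (vB i) => _ ->; rewrite orbT.
have [x xh Hx] := contraction vh.
have pi2 : 0 < 2 * pi :> R by rewrite mulr_gt0 // pi_gt0.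
pose y p := torus_act (texp (x *+ p)) a.
have Xy p : X (y p) by apply: HX => //; rewrite rpredMn.
have y0 (P : V -> Prop) : (\forall z \near (0 : V), P z) -> exists N, forall p, (N <= p)%N ->
    P (y p).
  move=> /nbhsCV[d d0 Hd].
  have [|N HN] := @ev_all _ (enum 'I_m) (fun j p => cmod (y p 0 j - (0 : V) 0 j) < d).
    move=> j _; have [|N HN] := @pow_small (cmod (texp x 0 j)) (cmod (a 0 j)) d _ d0.
      rewrite cmod_ge0 /= Hx expR_lt1 mulNr oppr_lt0 mulr_gt0 //.
      by case/andP: (vB j) => ? _; apply: lt_le_trans c20 _.
    by exists N => p /HN; rewrite -cmodX mulrC -cmodM -texp_iter !mxE subr0.
  by exists N => p Np; apply: Hd => j; apply: HN => //; rewrite mem_enum.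
pose mu := expR (- (2 * pi) * wt v al0).
pose q := cmod (k al0 * mon al0 a).
have q0 : 0 < q.
  rewrite cmod_gt0; apply: mulf_neq0; first exact: kS.
  by apply/prodf_neq0 => j _; rewrite expf_neq0.
(* At most |S| + m further terms, each at most e mu^p, cannot balance the leading term q mu^p. *)
pose e := q / (size S + m + 1)%:R.
have nz : 0 < (size S + m + 1)%:R :> R by rewrite ltr0n addn1.
have e0 : 0 < e by rewrite divr_gt0.
have rho (w K : R) : wt v al0 < w -> exists N, forall p, (N <= p)%N ->
    K * expR (- (2 * pi) * w) ^+ p <= e * mu ^+ p.
  move=> hw; have [|N HN] := @pow_small (expR (- (2 * pi) * (w - wt v al0))) K e _ e0.
    by rewrite expR_ge0 /= expR_lt1 mulNr oppr_lt0 mulr_gt0 // subr_gt0.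
  exists N => p /HN hp; rewrite (_ : - _ * w = - (2 * pi) * (w - wt v al0) + - (2 * pi) * wt v al0); last by ring.
  rewrite expRD exprMn mulrA -/mu ler_wpM2r ?exprn_ge0 ?expR_ge0 //; exact: ltW.
have [N1 HN1] : exists N, forall p al, (N <= p)%N -> al \in S -> al != al0 ->
    cmod (k al * mon al (y p)) <= e * mu ^+ p.
  apply: ev_all => al alS; have [->|ne] := eqVneq al al0; first by exists 0%N.
  have [N HN] := rho _ (cmod (k al * mon al a)) (al0lt _ alS ne).
  exists N => p /HN; rewrite -(cmod_mon _ Hx) -cmodX -cmodM -mon_iter mon_act.
  by move=> hp _; rewrite mulrCA mulrC.
have [N2 HN2] : exists N, forall p j, (N <= p)%N -> j \in enum 'I_m ->
    cmod (y p 0 j ^+ D * G j (y p)) <= e * mu ^+ p.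
  apply: ev_all => j _; pose M := cmod (G j 0) + 1.
  have [N HN] := rho _ (M * cmod (a 0 j) ^+ D) (wD j).
  have /y0[N' HN'] : \forall z \near (0 : V), cmod (G j z) < M.
    have /contCP/(_ _ ltr01) cG := (nhol_hol1 (hG j)).1.
    apply: near_imp cG _ => z /= hz; have := cmod_subC (G j z) (G j 0).
    by have := cmodD (G j z - G j 0) (G j 0); move: hz; rewrite subrK /M; clear; lra.
  exists (maxn N N') => p; rewrite geq_max => /andP[/HN h1 /HN' h2].
  apply: le_trans h1.
  have -> : expR (- (2 * pi) * (D%:R * v 0 j)) = cmod (texp x 0 j) ^+ D.
    by rewrite Hx -expRM_natl; congr expR; ring.
  rewrite -mulrA -exprM mulnC exprM -exprMn cmodM cmodX mulrC.
  have -> : cmod (y p 0 j) = cmod (a 0 j) * cmod (texp x 0 j) ^+ p.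
    by rewrite /y mxE texp_iter cmodM cmodX mulrC.
  by apply: ler_wpM2r; [rewrite exprn_ge0 // mulr_ge0 ?exprn_ge0 ?cmod_ge0|exact: ltW].
have [N3 HN3] := y0 _ FX; have [N4 HN4] := y0 _ E.
pose p := maxn (maxn N1 N2) (maxn N3 N4).
have [p1 p2 p3 p4] : [/\ N1 <= p, N2 <= p, N3 <= p & N4 <= p]%N.
  by rewrite /p; split; rewrite !leq_max leqnn ?orbT.
have := HN4 p p4; rewrite (HN3 p p3 (Xy p)) (bigD1_seq al0) //= -addrA => /esym/eqP.
rewrite addr_eq0 => /eqP; rewrite -[X in _ = - X]opprK opprK => Ek.
have mu0 : 0 < mu ^+ p by rewrite exprn_gt0 ?expR_gt0.
have : q * mu ^+ p <= e * mu ^+ p *+ (size S + m).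
  have -> : q * mu ^+ p = cmod (k al0 * mon al0 (y p)).
    by rewrite /q /mu -(cmod_mon _ Hx) -cmodX -cmodM -mon_iter -mulrA [mon _ a * _]mulrC -mon_act.
  rewrite Ek cmodN mulrnDr; apply: le_trans (cmodD _ _) _; apply: lerD.
    apply: le_trans (cmod_sum _ _ _) _.
    rewrite -iter_addr_0 -(count_predT S) -big_const_seq big_mkcond /= big_seq [leRHS]big_seq.
    apply: ler_sum => al alS; case: ifP => ne; first exact: HN1.
    by rewrite mulr_ge0 // ltW.
  apply: le_trans (cmod_sum _ _ _) _.
  rewrite -[m in leRHS]card_ord -sumr_const; apply: ler_sum => j _.
  by apply: HN2 => //; rewrite mem_enum.
rewrite -mulrnAl ler_pM2r // /e -mulr_natr mulrAC ler_pdivlMr // ler_pM2l // ler_nat.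
by rewrite addn1 ltnn.
Qed.

End Contraction.

(** * X does not meet the torus *)

Section TorusPart.
Variable R : realType.
Local Notation C := R[i].
Local Notation "x %:C" := (real_complex R x) : ring_scope.
Variable m : nat.
Local Notation V := 'rV[C]_m.
Variable h : {vspace 'rV[C]_m}.
Implicit Types (i j : 'I_m).

Lemma fin_avoid (s : seq R) (a b : R) : a < b -> exists2 r, a < r < b & r \notin s.
Proof.
elim: s a b => [|x s IH] a b ab; first by exists ((a + b) / 2) => //; apply/andP; split; lra.
have am : a < (a + b) / 2 by lra.
have mb : (a + b) / 2 < b by lra.
have [xm|mx] := ltP x ((a + b) / 2).
  have [r /andP[r1 r2] rs] := IH _ _ mb; exists r; first by apply/andP; split; lra.
  by rewrite inE negb_or rs andbT; apply/eqP; lra.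
have [r /andP[r1 r2] rs] := IH _ _ am; exists r; first by apply/andP; split; lra.
by rewrite inE negb_or rs andbT; apply/eqP; lra.
Qed.

Lemma near_coords_neq0 (z : V) : (forall j, z 0 j != 0) -> nbhs z (fun y : V => forall j,
    y 0 j != 0).
Proof.
move=> z0; suff : nbhs (z : V) (fun y : V => forall j, j \in enum 'I_m -> y 0 j != 0).
  by move=> N; apply: near_imp N _ => y H j; apply: H; rewrite mem_enum.
elim: (enum 'I_m) => [|j s IH]; first by apply: (@near_all R V z (fun y : V => forall j,
    j \in [::] -> y 0 j != 0)).
have N : nbhs (z : V) (fun y : V => y 0 j != 0).
  apply/nbhsCV; exists (cmod (z 0 j)) => [|y /(_ j)]; first by rewrite cmod_gt0.
  by apply: contraTneq => ->; rewrite sub0r cmodN ltxx.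
by apply: near_and N IH _ => y yj ys i; rewrite inE => /orP[/eqP->|/ys].
Qed.

(** The lines for [global_product] run in a direction b of the torus off X: each leaves the torus at
    finitely many points or nowhere along generic z, and over general z never meets a point with two
    zero coordinates. *)
Lemma torus_disjoint (X U : set V) (v0 : 'rV[R]_m) a : no_character_vanishes h ->
  v0 \in ph h -> (forall j, 0 < v0 0 j) ->
  (forall x z, x \in h -> X z -> X (torus_act (texp x) z)) ->
  (forall y, U y -> analytic_at X y) -> hyper_dense X -> X `<=` U ->
  (forall x, X x -> forall P : V -> Prop, (\forall y \near x, P y) -> exists2 y, P y & ~ X y) ->
  (forall z : V, (forall i j, z 0 i = 0 -> z 0 j = 0 -> i = j) -> U z) ->
  X a -> (forall j, a 0 j != 0) -> False.
Proof.
move=> nc v0h v0pos HX aX hX XU nwX U2 Xa a0.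
have U1 (z : V) : (forall j, z 0 j != 0) -> U z.
  by move=> z0; apply: U2 => i j zi; have /eqP := z0 i; rewrite zi.
have [b b0 nXb] := nwX a Xa _ (near_coords_neq0 a0).
have sb0 (s : C) : s != 0 -> forall j, (0 + s *: b) 0 j != 0.
  by move=> s0 j; rewrite !mxE add0r mulf_neq0.
(* Off s = 0 the line C b lies in the torus and meets X in isolated points, because b is not in X.
   The bound 1 / 2 keeps away from 0, where they might accumulate. *)
have [l Hl] : exists l : seq C, forall s, cmod (s - 0) <= 1 -> 2^-1 <= cmod s ->
    X (0 + s *: b) -> s \in l.
  apply: (@disc_cover _ 0 1 (fun S => exists l : seq C, forall s, S s -> 2^-1 <= cmod s ->
      X (0 + s *: b) -> s \in l)) => //.
  - by move=> S S' SS' [l Hl]; exists l => s /SS'; exact: Hl.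
  - move=> S S' [l Hl] [l' Hl']; exists (l ++ l') => s [] Ss s2 Xs; rewrite mem_cat.
      by rewrite Hl.
    by rewrite Hl' ?orbT.
  move=> p; rewrite subr0 => hp; have [->|p0] := eqVneq p 0.
    by exists 2^-1; [rewrite invr_gt0|exists [::] => s /=; rewrite subr0 => ? ?; lra].
  have [||||||d d0 Hd] := @slice_iso R V X U b 0 2 [:: 0] p 1 aX.
  - by move=> s _; rewrite inE => s0; apply/U1/sb0.
  - by apply: le_lt_trans hp _; rewrite ltr1n.
  - by rewrite cmod1 ler1n.
  - exact/U1/sb0.
  - by apply/U1/sb0; exact: oner_neq0.
  - by rewrite add0r scale1r.
  exists d => //; exists [:: p] => s /= sd _ Xs; rewrite inE; apply: contrapT => /negP sp.
  by apply: (Hd s) => //; rewrite sd andbT cmod_gt0 subr_eq0.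
have [|r /andP[r2 r1] rl] := @fin_avoid (map (@cmod R) l) 2^-1 1;
    first by rewrite invf_lt1 // ltr1n.
have r0 : 0 < r by apply: lt_trans r2; rewrite invr_gt0.
have nXr s : cmod s = r -> ~ X (0 + s *: b).
  move=> hs Xs; move/negP: rl; apply; rewrite -hs; apply: map_f; apply: Hl => //.
    by rewrite subr0 hs ltW.
  by rewrite hs ltW.
have sn0 (s : C) : cmod s = r -> s != 0 by move=> hs; rewrite -cmod_gt0 hs.
have : \forall z \near (0 : V), forall s, cmod (s - 0) = r -> U (z + s *: b) /\ ~ X (z + s *: b).
  apply: tube_circ => // s; rewrite subr0 => hs.
  have N1 := near_coords_neq0 (sb0 s (sn0 s hs)).
  have N2 := notX_near (aX _ (U1 _ (sb0 s (sn0 s hs)))) (nXr s hs).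
  have N3 : \forall y \near (0 : V) + s *: b, U y /\ ~ X y.
    by apply: near_and N1 N2 _ => y y0 Xy; split; [exact: U1|].
  by have := near_pair N3; apply: filterS => -[y t].
move=> /nbhsVP[eps eps0 circX].
pose E (z : V) := [seq - (z 0 j / b 0 j) | j <- enum 'I_m].
(* A factor vanishes when coordinates i and j of z + s b are zero for the same s. *)
pose delta0 (z : V) := \prod_(p : 'I_m * 'I_m | p.1 != p.2) (z 0 p.1 * b 0 p.2 - z 0 p.2 * b 0 p.1).
have EU z s : s \notin E z -> U (z + s *: b).
  move=> sE; apply: U1 => j; rewrite !mxE; apply: contraNneq sE => H.
  apply/mapP; exists j; rewrite ?mem_enum //; move/eqP: H; rewrite addrC addr_eq0 => /eqP H.
  by apply: (mulIf (b0 j)); rewrite H mulNr mulfVK.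
have dU z s : delta0 z != 0 -> U (z + s *: b).
  move=> /prodf_neq0 dz; apply: U2 => i j; rewrite !mxE => Hi Hj; apply/eqP; apply: contrapT =>
      /negP ij.
  have /eqP := dz (i, j) ij; apply => /=.
  have -> : z 0 i = - (s * b 0 i) by apply/eqP; rewrite -addr_eq0 Hi.
  have -> : z 0 j = - (s * b 0 j) by apply/eqP; rewrite -addr_eq0 Hj.
  by ring.
have hd z : hol1 delta0 z.
  apply: hol1_prod => p _; apply: hol1B; apply: hol1M;
      [exact: coord_hol1|exact: hol1_cst|exact: coord_hol1|exact: hol1_cst].
have nzd : exists2 z, vmod (z - 0) < eps & delta0 z != 0.
  (* With these coordinates the factor for (i, j) is b_i b_j (i - j), up to the scalar t. *)
  pose u : V := \row_j (b 0 j * (j : nat)%:R);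
  have [t t0 ht] := small_term (vmod u) eps0; exists (t%:C *: u).
    by rewrite subr0 vmodZ cmodC gtr0_norm.
  apply/prodf_neq0 => -[i j] /= ij; rewrite !mxE.
  rewrite (_ : _ - _ = t%:C * b 0 i * b 0 j * ((i : nat)%:R - (j : nat)%:R)); last by ring.
  rewrite !mulf_neq0 //; first by rewrite -cmod_gt0 cmodC gtr0_norm.
  by rewrite subr_eq0 eqr_nat.
have [||||||G hG [GX nG]] := @global_product R V X U b r eps E delta0 aX hX XU nwX _ eps0.
- by rewrite r0 ltW.
- by move=> z s hz hs; apply: circX => //; rewrite subr0.
- by move=> z s _ _; exact: EU.
- by move=> z s _ dz _; exact: dU.
- by move=> z _; exact: hd.
- exact: nzd.
exact: (toric_lowest nc v0h v0pos hG nG GX HX Xa a0).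
Qed.

End TorusPart.

(** * Coordinate hyperplanes *)

Section CoordinateDivisors.
Variable R : realType.
Local Notation C := R[i].
Local Notation "x %:C" := (real_complex R x) : ring_scope.
Variable m : nat.
Local Notation V := 'rV[C]_m.

Lemma not_near (W : normedModType C) (y : W) (A P : W -> Prop) : ~ (\forall z \near y, A z) ->
  (\forall z \near y, P z) -> exists2 z, P z & ~ A z.
Proof.
move=> nA hP; apply: contrapT => H; apply: nA; apply: near_imp hP _ => z Pz.
by apply: contrapT => nAz; apply: H; exists z.
Qed.

(** Finitely many relatively closed sets cover a neighbourhood. If the first does not fill it, a
    smaller open set misses the first and is covered by the others. *)
Lemma finite_baire (W : normedModType C) (I : eqType) (s : seq I) (A : I -> W -> Prop) (P : W ->
    Prop) (y : W) :
  (\forall z \near y, P z) -> (\forall z \near y, exists2 i : I, i \in s & A i z) ->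
  (\forall z \near y, forall i : I, i \in s -> ~ A i z -> \forall w \near z, ~ A i w) ->
  exists i w, [/\ i \in s, P w & \forall z \near w, A i z].
Proof.
elim: s y => [|i s IH] y hP hA hO; first by have [] := nbhs_singleton hA.
have [hi|hi] := pselect (\forall z \near y, A i z).
  by exists i, y; split; [exact: mem_head|exact: nbhs_singleton hP|].
have N : \forall z \near y, [/\ P z, exists2 j, j \in i :: s & A j z &
    forall j, j \in i :: s -> ~ A j z -> \forall w \near z, ~ A j w].
  by apply: filterS3 hP hA hO.
have [z Pz nAz] := not_near hi (near_join N); have [_ _ HO] := nbhs_singleton Pz.
have nAi := HO i (mem_head _ _) nAz.
have [|||j [w [js Pw Aw]]] := IH z.
- by apply: near_imp Pz _ => w [].
- apply: near_and Pz nAi _ => w [_ [j]] js Aj _ nA; exists j => //.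
  by move: js; rewrite inE => /orP[/eqP ji|//]; case: nA; rewrite -ji.
- by apply: near_imp Pz _ => w [_ _ H] j js; apply: H; rewrite inE js orbT.
by exists j, w; split=> //; rewrite inE js orbT.
Qed.

Lemma support_line (w b : V) (s : C) i : s \notin [seq - (w 0 i / b 0 i) | i <- enum 'I_m] ->
  (w + s *: b) 0 i = 0 -> w 0 i = 0.
Proof.
move=> sE; rewrite !mxE => H; apply: contrapT => /eqP wi; move/negP: sE; apply.
apply/mapP; exists i; rewrite ?mem_enum //; have [b0|b0] := eqVneq (b 0 i) 0.
  by move: H; rewrite b0 mulr0 addr0 => /eqP; rewrite (negPf wi).
by apply: (mulIf b0); rewrite mulNr mulfVK //; apply/eqP; rewrite -addr_eq0 addrC H.
Qed.

Implicit Types (i j : 'I_m).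

Lemma near_support (z : V) : nbhs z (fun y : V => forall j, y 0 j = 0 -> z 0 j = 0).
Proof.
suff N : nbhs z (fun y : V => forall j, j \in enum 'I_m -> y 0 j = 0 -> z 0 j = 0).
  by apply: near_imp N _ => y H j; apply: H; rewrite mem_enum.
elim: (enum 'I_m) => [|j s IH].
  by apply: (@near_all R V z (fun y : V => forall j, j \in [::] -> y 0 j = 0 -> z 0 j = 0)).
have N : nbhs z (fun y : V => y 0 j = 0 -> z 0 j = 0).
  have [zj|zj] := eqVneq (z 0 j) 0; first exact: (@near_all R V z (fun y : V => y 0 j = 0 ->
      z 0 j = 0)).
  apply/nbhsCV; exists (cmod (z 0 j)) => [|y /(_ j)]; first by rewrite cmod_gt0.
  by move=> hy yj; move: hy; rewrite yj sub0r cmodN ltxx.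
by apply: near_and N IH _ => y yj ys i; rewrite inE => /orP[/eqP->|/ys].
Qed.

(** At a hypersurface point near x, projecting along a transverse direction shows that X contains an
    open part of one hyperplane z_j = 0; lines inside that hyperplane spread it over U. Staying near
    x ensures that x_j = 0. *)
Lemma coord_union (X U : set V) :
  (forall y, U y -> analytic_at X y) -> hyper_dense X -> X `<=` U ->
  (forall z y : V, U z -> (forall j, y 0 j = 0 -> z 0 j = 0) -> U y) ->
  (forall z, X z -> exists j, z 0 j = 0) ->
  forall x, X x <-> U x /\ exists2 j, x 0 j = 0 & forall z, U z -> z 0 j = 0 -> X z.
Proof.
move=> aX hX XU hU X0 x; split=> [Xx|[Ux [j xj H]]]; last exact: H.
split; first exact: XU.
have [y [ysupp Xy hy]] := hX x Xx _ (near_join (near_support x)).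
have yx := nbhs_singleton ysupp.
(* A direction transverse to every coordinate hyperplane, so that the line through y meets X,
   contained in their union, in an isolated point. *)
pose one : V := const_mx 1.
have Uy := XU _ Xy.
have nU : \forall z \near y, U z by apply: near_imp (near_support y) _ => z; exact: hU.
pose Q w := [/\ U w, forall j, w 0 j = 0 -> x 0 j = 0 & forall j, w 0 j = 0 -> y 0 j = 0].
have NQ : \forall w \near y, Q w by apply: filterS3 nU ysupp (near_support y).
have [d [d0 Hd]] : exists d, 0 < d /\ forall s, 0 < cmod s < d -> ~ X (y + s *: one).
  suff [d d0 Hd] : exists2 d, 0 < d & forall j, j \in enum 'I_m -> forall s, 0 < cmod s < d ->
      (y + s *: one) 0 j != 0.
    exists d; split=> // s hs /X0[j /eqP]; apply/negP; apply: Hd => //; by rewrite mem_enum.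
  elim: (enum 'I_m) => [|j s [d d0 Hd]]; first by exists 1.
  have [yj|yj] := eqVneq (y 0 j) 0.
    exists d => // i; rewrite inE => /orP[/eqP->|]; last exact: Hd.
    by move=> t /andP[t0 _]; rewrite !mxE yj add0r mulr1 -cmod_gt0.
  have yj0 : 0 < cmod (y 0 j) by rewrite cmod_gt0.
  have [e [e0 ed ey]] := lt_both d0 yj0; exists e => // i; rewrite inE =>
      /orP[/eqP->|si] t /andP[t0 te].
    rewrite !mxE mulr1 addr_eq0; apply: contraTneq te => H; rewrite -(cmodN t) -H -leNgt;
        exact: ltW.
  by apply: Hd => //; rewrite t0 (lt_trans te).
have Y0 : y + 0 *: one = y by rewrite scale0r addr0.
have [e [e0 ed Qe]] : exists e, [/\ 0 < e, e <= d & \forall z \near y, forall s, cmod s < e ->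
    Q (z + s *: one)].
  have : \forall p \near (y, (0 : C)), Q (p.1 + p.2 *: one) by apply: near_pair; rewrite Y0.
  move=> /near_fix[e' e'0 N]; have [e [e0 ed ee]] := lt_both d0 e'0; exists e; split=> //;
      first exact: ltW.
  by apply: near_imp N _ => z H s hs; apply: H; rewrite subr0; apply: lt_trans ee.
have per : \forall z \near y, exists2 s, cmod (s - 0) < e & X (z + s *: one).
  apply: hyper_persist; rewrite ?Y0 // => s /andP[s0 se].
  by rewrite subr0 in s0 se; apply: Hd; rewrite s0 (lt_le_trans se).
pose I := [seq j <- enum 'I_m | y 0 j == 0].
(* A point z + s [one] of X has some zero coordinate j, hence s = - z_j; persistence of X thus
   becomes a cover by finitely many closed conditions. *)
pose A j (z : V) := X (z + (- z 0 j) *: one).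
have NA : \forall z \near y, exists2 j, j \in I & A j z.
  apply: near_and per Qe _ => z [s hs Xs] Qz; have [j zj] := X0 _ Xs; rewrite subr0 in hs.
  have E : s = - z 0 j by apply/eqP; rewrite -addr_eq0 addrC; move: zj; rewrite !mxE mulr1 => ->.
  have [_ _ yj] := Qz s hs.
  exists j; first by rewrite mem_filter mem_enum yj ?eqxx.
  by rewrite /A -E.
have Ne : nbhs y (fun z : V => forall j, j \in I -> cmod (- z 0 j) < e).
  apply/nbhsCV; exists e => // z hz j; rewrite mem_filter => /andP[/eqP yj _].
  by have := hz j; rewrite yj subr0 cmodN.
have cj j (z : V) : {for z, continuous (fun z : V => z + (- z 0 j) *: one)}.
  move=> P /= /nbhsCV[r r0 Hr]; apply/nbhsCV; exists (r / 2); first by rewrite divr_gt0.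
  move=> w hw; apply: Hr => i; rewrite !mxE !mulr1.
  rewrite (_ : _ - _ = (w 0 i - z 0 i) - (w 0 j - z 0 j)); last by ring.
  by apply: le_lt_trans (cmodD _ _) _; rewrite cmodN; have := hw i; have := hw j; lra.
have NP : \forall z \near y, (forall s, cmod s < e -> Q (z + s *: one)) /\ (forall j, j \in I ->
    cmod (- z 0 j) < e).
  by apply: near_and Qe Ne _ => z.
have [|j [w [jI [Qw we] Aw]]] := @finite_baire V _ I A _ y NP NA.
  apply: near_imp NP _ => z [Qz ze] j jI nX.
  have [Uz _ _] := Qz _ (ze j jI).
  have := cj j z _ (notX_near (aX _ Uz) nX); rewrite nbhs_simpl /= => N.
  by apply: near_imp N _ => v h.
pose w' := w + (- w 0 j) *: one.
have w'j : w' 0 j = 0 by rewrite !mxE mulr1 subrr.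
have [Uw' Qw' _] : Q w' by apply: Qw; exact: we.
exists j => [|z Uz zj]; first exact: Qw'.
(* Moving inside the hyperplane does not change w_j, so [Aw] puts a neighbourhood of w' on the line
   to z into X, and [slice_full] continues it to z. *)
have -> : z = w' + 1 *: (z - w') by rewrite scale1r addrC subrK.
have [c c0 Hc] : exists2 d, 0 < d & forall s, cmod (s - 0) < d -> X (w' + s *: (z - w')).
  have [c c0 Hc] := near_line (z - w') Aw; exists c => // s; rewrite subr0 => /Hc; rewrite /A.
  have bj : (z - w') 0 j = 0 by rewrite mxE [X in _ + X]mxE zj w'j oppr0 addr0.
  have -> : (w + s *: (z - w')) 0 j = w 0 j by rewrite mxE [X in _ + X]mxE bj mulr0 addr0.
  by rewrite addrAC.
apply: (@slice_full R V X U (z - w') w' 2 [seq - (w' 0 i / (z - w') 0 i) | i <- enum 'I_m] 0 1 aX).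
- by move=> s _ sE; apply: (hU w' _ Uw') => i; exact: support_line.
- by rewrite cmod0.
- by rewrite cmod1 ler1n.
- by rewrite scale0r addr0.
- by rewrite scale1r addrC subrK.
by exists c.
Qed.

End CoordinateDivisors.

(** * The quotient by H *)

Section Glue.
Variables (R : realType) (m : nat) (K : {set {set 'I_m}}).
Local Notation C := R[i].
Local Notation "x %:C" := (real_complex R x) : ring_scope.
Local Notation V := 'rV[C]_m.
Variable h : {vspace 'rV[C]_m}.
Local Notation U := (UK (R := R) K).
Local Notation Q := (UKH K h).
Local Notation pU := (@UKH_pi R m K h).
Implicit Types (z y : V) (u : U) (A D : set Q).

Lemma UK_supp z y : U z -> (forall j, y 0 j = 0 -> z 0 j = 0) -> U y.
Proof. by move=> Uz zy [J JK yJ]; apply: Uz; exists J => // j /yJ /zy. Qed.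

Lemma UK_near z : U z -> \forall y \near z, U y.
Proof. by move=> Uz; apply: near_imp (near_support z) _ => y; exact: UK_supp. Qed.

Lemma UK_val z : U z -> exists u, val u = z.
Proof. by move=> Uz; exists (SigSub (mem_set Uz)). Qed.

Lemma val_UK u : U (val u).
Proof. exact/set_mem/valP. Qed.
Arguments val_UK : clear implicits.

Lemma piP u u' : pU u = pU u' <-> exists2 x, x \in h & val u' = torus_act (texp x) (val u).
Proof.
split=> [/eqmodP/asboolP[_ [x xh <-] E]|[x xh E]]; first by exists x.
by apply/eqmodP/asboolP; exists (texp x) => //; exists x.
Qed.

Lemma act_cont (t : V) : continuous (torus_act t).
Proof.
move=> z P /= /nbhsCV[d d0 Hd].
have [e e0 He] := small_term (\sum_j cmod (t 0 j)) d0.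
apply/nbhsCV; exists e => // y hy; apply: Hd => j; rewrite !mxE -mulrBr cmodM.
apply: le_lt_trans He; rewrite mulrC; apply: ler_pM; rewrite ?cmod_ge0 //; first exact/ltW/hy.
by rewrite (bigD1 j) //= lerDl sumr_ge0 // => i _; exact: cmod_ge0.
Qed.

Lemma act_supp (x z : V) : U z -> U (torus_act (texp x) z).
Proof.
move=> Uz; apply: UK_supp Uz _ => j; rewrite !mxE => /eqP; rewrite mulf_eq0 => /orP[|/eqP//].
by rewrite (negPf (cexp_neq0 _)).
Qed.

Arguments act_supp x {z} _ _.

Lemma open_lift D : open D -> exists B : set V, open B /\ forall u, D (pU u) <-> B (val u).
Proof.
case=> B oB E; exists B; split=> // u.
by have <- : B (val u) = D (pU u) by exact: (congr1 (fun S : set U => S u) E).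
Qed.

(** The saturation of B is the union of its preimages under the homeomorphisms given by H. *)
Lemma pi_open (B : set V) : open B -> open (pU @` (val @^-1` B)).
Proof.
move=> oB; pose B' := \bigcup_(x in [set x | x \in h]) (torus_act (texp x) @^-1` B).
exists B'; first by apply: bigcup_open => x _; apply: open_comp oB => z _; exact: act_cont.
apply/seteqP; split=> [u [x xh Bx]|u [u' Bu' E]].
  have [u' Eu'] := UK_val (act_supp x (val_UK u)).
  exists u'; first by rewrite /= Eu'.
  by apply/esym/piP; exists x.
have [x xh Eu] := (piP _ _).1 (esym E).
by exists x => //=; rewrite -Eu.
Qed.

Definition orbit_preimage A : set V := [set z | exists u, val u = z /\ A (pU u)].

Lemma liftE A u : orbit_preimage A (val u) <-> A (pU u).
Proof. by split=> [[u' [/val_inj ->]]|Au] //; exists u. Qed.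

Lemma lift_UK A : orbit_preimage A `<=` U.
Proof. by move=> _ [u [<- _]]; exact: val_UK. Qed.

Lemma lift_act A x z : x \in h -> orbit_preimage A z -> orbit_preimage A (torus_act (texp x) z).
Proof.
move=> xh [u [<- Au]]; have [u' Eu'] := UK_val (act_supp x (val_UK u)).
exists u'; split=> //; rewrite (_ : pU u' = pU u) //.
by apply/esym/piP; exists x.
Qed.

Lemma near_lift D u (P : V -> Prop) : open D -> D (pU u) ->
  (forall u', D (pU u') -> P (val u')) -> \forall y \near (val u), P y.
Proof.
move=> /open_lift[B [oB BD]] /BD Bu H.
have N : \forall y \near val u, B y by exact: open_nbhs_nbhs.
apply: near_and N (UK_near (val_UK u)) _ => y By /UK_val[u' E]; rewrite -E.
by apply/H/BD; rewrite E.
Qed.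

Lemma lift_analytic A z : analytic_subset (UKH_hol (K := K) (h := h)) A -> U z ->
    analytic_at (orbit_preimage A) z.
Proof.
move=> aA /UK_val[u <-]; have [D [k [f [oD Du hf Hf]]]] := aA (pU u).
have [g Hg] : exists g : 'I_k -> V -> C, forall i u, D (pU u) -> g i (val u) = f i (pU u) /\
    differentiable (g i) (val u).
  by have [g Hg] := choice hf; exists g.
exists k, g; apply: near_lift oD Du _ => u' Du'; split=> [i|].
  by have [_] := Hg i u' Du'.
by rewrite liftE Hf //; split=> H i; have := H i; have [-> _] := Hg i u' Du'.
Qed.

Lemma lift_regular A z (P : V ->
    Prop) : analytic_subset_of_codim_one (UKH_hol (K := K) (h := h)) A ->
  orbit_preimage A z -> (\forall y \near z, P y) -> exists u, [/\ P (val u), A (pU u) &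
    regular_point (UKH_hol (K := K) (h := h)) A 1 (pU u)].
Proof.
move=> [_ _ cA] [u [<- Au]] N; have : nbhs (val u) P := N.
rewrite nbhsE => -[B [oB Bu] BP].
have [W _] := cA _ Au; have oW := pi_open oB.
have [|y [u' Bu' <-] ry] := W (pU @` (val @^-1` B)).
  by apply: open_nbhs_nbhs; split=> //; exists u.
by exists u'; split=> //; [exact: BP|case: ry].
Qed.

(** At a regular point of codimension one the first chart coordinate is the equation, and its
    pullback to U(K) is holomorphic. *)
Lemma lift_hyper A : analytic_subset_of_codim_one (UKH_hol (K := K) (h := h)) A ->
    hyper_dense (orbit_preimage A).
Proof.
move=> cA z Az P hP; have [u [Pu Au [_ [n [D [phi [[oD injD oDW holD] Du n1 HD]]]]]]] := lift_regular cA Az hP.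
exists (val u); split=> //; first by apply/liftE.
pose i0 : 'I_n := Ordinal n1.
have : UKH_hol D (fun y : Q => phi y 0 i0).
  apply/(holD D _ oD) => //; exists (fun z : 'rV[C]_n => z 0 i0) => // w _.
  exact: differentiable_coord.
move=> [g Hg]; exists g; apply: near_lift oD Du _ => u' Du'.
have [E dg] := Hg u' Du'; split=> //; rewrite liftE HD // E; split=> [H|H i i1]; first exact: H.
by rewrite (_ : i = i0) //; apply: val_inj => /=; case: (nat_of_ord i) i1.
Qed.

(** If A filled an open set, moving along the first chart coordinate at a regular point would stay
    in A although that coordinate becomes nonzero. *)
Lemma lift_nowhere A : analytic_subset_of_codim_one (UKH_hol (K := K) (h := h)) A ->
  forall z, orbit_preimage A z -> forall P : V -> Prop, (\forall y \near z, P y) -> exists2 y,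
      P y & ~ orbit_preimage A y.
Proof.
move=> cA z Az P hP; apply: contrapT => nP.
have PA y : P y -> orbit_preimage A y by move=> Py; apply: contrapT => h'; apply: nP; exists y.
have [u [Pu Au [_ [n [D [phi [[oD injD oDW holD] Du n1 HD]]]]]]] := lift_regular cA Az (near_join hP).
pose i0 : 'I_n := Ordinal n1.
have : nbhs (val u) P := Pu.
rewrite nbhsE => -[B [oB Bu] BP].
pose W := D `&` (pU @` (val @^-1` B)).
have oW : open W by apply: openI => //; exact: pi_open.
have WD : W `<=` D by move=> y [].
have op : open (phi @` W) by apply/oDW.
have phiu : (phi @` W) (phi (pU u)) by exists (pU u) => //; split=> //; exists u.
have N : \forall y \near (phi (pU u)), (phi @` W) y by exact: open_nbhs_nbhs.
have [d d0 Hd] := near_line (delta_mx 0 i0) N.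
have dd : cmod (d / 2)%:C < d by rewrite cmodC gtr0_norm ?divr_gt0 //; lra.
have [y [Dy [u' Bu' E]] Ey] := Hd _ dd.
have Ay : A y by rewrite -E; apply/liftE/PA/BP.
have /HD/(_ i0 isT) := Ay; rewrite Ey => /(_ Dy).
have /HD/(_ i0 isT) := Au; move=> /(_ Du); rewrite !mxE => -> /=.
rewrite ?eqxx ?mulr1 ?add0r; move=> /(congr1 (@cmod R)); rewrite cmodC cmod0 gtr0_norm; lra.
Qed.

End Glue.

(** * Winding of a loop *)

Section Winding.
Variable R : realType.
Local Notation C := R[i].
Local Notation "x %:C" := (real_complex R x) : ring_scope.
Implicit Types (G : R -> R -> C).

(** The open sector of arguments between - pi / 4 and pi / 4: products of two elements have positive
    real part. *)
Definition sector (w : C) := `|complex.Im w| < complex.Re w.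

Lemma sector_sqrt (a : C) : cmod (a - 1) < 1 -> exists w, w ^+ 2 = a /\ sector w.
Proof.
move=> ha; have a0 : 0 < complex.Re a.
  have := le_lt_trans (normr_Re (a - 1)) ha; case: a {ha} => x y /=.
  by rewrite ltr_norml => /andP[]; lra.
pose w := sqrtC a; have ww : w ^+ 2 = a := sqrtCK a.
have S (z : C) : z ^+ 2 = a -> 0 <= complex.Re z -> sector z.
  move=> za z0; rewrite /sector -(ger0_norm z0) -ltr_sqr ?nnegrE //.
  rewrite !real_normK ?num_real //; move: a0; rewrite -za; case: (z) => x y /=.
  by rewrite subr_gt0 -!expr2.
have [w0|w0] := leP 0 (complex.Re w); first by exists w; split=> //; exact: S.
exists (- w); split; first by rewrite sqrrN.
apply: S; first by rewrite sqrrN.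
by case: (w) w0 => x y /= /ltW; rewrite oppr_ge0.
Qed.

(** Equal squares leave only a sign open, and both products have positive real part. *)
Lemma sector_uniq (a b c d : C) : sector a -> sector b -> sector c -> sector d ->
  (a * b) ^+ 2 = (c * d) ^+ 2 -> a * b = c * d.
Proof.
have P (x y : C) : sector x -> sector y -> 0 < complex.Re (x * y).
  case: x y => [x x'] [y y']; rewrite /sector /= !ltr_norml => /andP[h1 h2] /andP[h3 h4].
  nra.
move=> ha hb hc hd /eqP; rewrite eqf_sqr => /orP[/eqP//|/eqP E].
have := P _ _ ha hb; have := P _ _ hc hd; rewrite {}E => h1 h2; exfalso; move: h1 h2.
by case: (c * d) => x y /=; lra.
Qed.

(** Winding modulo 2, without logarithms: along a row of a fine grid, multiply the square roots in
    [sector] of the successive quotients. Crossing a row of cells changes the product only by the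
    contributions of the two sides, which agree; yet it is -1 on the bottom and 1 on the top. *)
Lemma no_unwinding G (d : R) : 0 < d ->
  (forall t s t' s', 0 <= t <= 1 -> 0 <= s <= 1 -> 0 <= t' <= 1 -> 0 <= s' <= 1 ->
     `|t - t'| < d -> `|s - s'| < d -> cmod (G t' s' - G t s) < cmod (G t s)) ->
  (forall t, 0 <= t <= 1 -> G t 0 = ee t) -> (forall t, 0 <= t <= 1 -> G t 1 = 1) ->
  (forall s, 0 <= s <= 1 -> G 0 s = 1 /\ G 1 s = 1) -> False.
Proof.
move=> d0 Gd Gbot Gtop Gside.
have G0 t s : 0 <= t <= 1 -> 0 <= s <= 1 -> G t s != 0.
  by move=> ht hs; have := Gd t s t s ht hs ht hs; rewrite !subrr normr0 cmod0 -cmod_gt0; apply.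
(* An even number of steps lets the roots be paired into squares, so that both products are computed
   without knowing the roots: the bottom one is [ee] at 1 / 2. *)
pose N := (Num.bound d^-1).+1; pose n := (N * 2)%N.
have N0 : 0 < N%:R :> R by rewrite ltr0n.
have n0 : 0 < n%:R :> R by rewrite ltr0n muln_gt0.
have nd : n%:R^-1 < d.
  have di : 0 <= d^-1 by rewrite invr_ge0 ltW.
  rewrite invf_plt ?posrE //; apply: lt_trans (archi_boundP di) _.
  by rewrite ltr_nat /n /N muln2 -addnn ltn_addr.
pose pt (i : nat) : R := i%:R / n%:R.
have pt01 i : (i <= n)%N -> 0 <= pt i <= 1.
  by move=> hi; rewrite divr_ge0 //= ler_pdivrMr // mul1r ler_nat.
have ptS i : `|pt i - pt i.+1| < d.
  by rewrite /pt -mulrBl -natr1 opprD addNKr mulN1r normrN gtr0_norm // invr_gt0.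
have pt0 i : `|pt i - pt i| < d by rewrite subrr normr0.
have ptn : pt n = 1 by rewrite /pt divff // gt_eqF.
have pt00 : pt 0%N = 0 by rewrite /pt mul0r.
pose g i k := G (pt i) (pt k).
have g0 i k : (i <= n)%N -> (k <= n)%N -> g i k != 0 by move=> hi hk; apply: G0; exact: pt01.
have /choice[psq Hpsq] : forall a : C, exists w, cmod (a - 1) < 1 -> w ^+ 2 = a /\ sector w.
  by move=> a; have [/sector_sqrt[w Hw]|_] := ltP (cmod (a - 1)) 1; [exists w|exists 0].
have near1 (a b : C) : a != 0 -> cmod (b - a) < cmod a -> cmod (b / a - 1) < 1.
  move=> a0 h; rewrite (_ : b / a - 1 = (b - a) / a); last by rewrite mulrBl divff.
  by rewrite cmodM cmodV ltr_pdivrMr ?cmod_gt0 // mul1r.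
pose q i k := psq (g i.+1 k / g i k); pose v i k := psq (g i k.+1 / g i k).
have Hq i k : (i < n)%N -> (k <= n)%N -> q i k ^+ 2 = g i.+1 k / g i k /\ sector (q i k).
  move=> hi hk; apply/Hpsq/near1; first by rewrite g0 // ltnW.
  by apply: Gd; rewrite ?pt01 // ltnW.
have Hv i k : (i <= n)%N -> (k < n)%N -> v i k ^+ 2 = g i k.+1 / g i k /\ sector (v i k).
  move=> hi hk; apply/Hpsq/near1; first by rewrite g0 // ltnW.
  by apply: Gd; rewrite ?pt01 // ltnW.
have sq i k : (i < n)%N -> (k < n)%N -> q i k.+1 * v i k = q i k * v i.+1 k.
  move=> hi hk; have [q1 s1] := Hq i k.+1 hi hk; have [q2 s2] := Hq i k hi (ltnW hk).
  have [q3 s3] := Hv i k (ltnW hi) hk; have [q4 s4] := Hv i.+1 k hi hk.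
  apply: sector_uniq => //; rewrite !exprMn q1 q2 q3 q4.
  by field; rewrite !g0 // ltnW.
have tel k j : (k < n)%N -> (j <= n)%N ->
    (\prod_(i < j) q i k.+1) * v 0%N k = (\prod_(i < j) q i k) * v j k.
  move=> hk; elim: j => [|j IH] hj; first by rewrite !big_ord0.
  rewrite !big_ord_recr /= mulrAC (IH (ltnW hj)) -!mulrA; congr (_ * _).
  by rewrite mulrC sq.
have vv k : (k < n)%N -> v 0%N k = v n k /\ v n k != 0.
  move=> hk; have h1 := Gside _ (pt01 _ (ltnW hk)); have h2 := Gside _ (pt01 _ hk).
  have E : v 0%N k = v n k by rewrite /v /g pt00 ptn h1.1 h1.2 h2.1 h2.2.
  split=> //; have [E2 _] := Hv n k (leqnn _) hk; apply/eqP => v0; move: E2; rewrite v0 expr0n /=.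
  by rewrite /g ptn h1.2 h2.2 divr1 => /esym/eqP; rewrite oner_eq0.
have const k : (k <= n)%N -> \prod_(i < n) q i k = \prod_(i < n) q i 0%N.
  elim: k => // k IH hk; rewrite -(IH (ltnW hk)); have [E v0] := vv k hk.
  by apply: (mulIf v0); rewrite -tel // E.
have top : \prod_(i < n) q i n = 1.
  rewrite (eq_bigr (fun=> psq 1)) => [|i _]; last first.
    by rewrite /q /g ptn !Gtop ?pt01 ?divr1 // ltnW.
  rewrite prodr_const card_ord /n mulnC exprM (Hpsq 1 _).1 ?expr1n //.
  by rewrite subrr cmod0.
have eeN : ee (R := R) (n%:R^-1) ^+ N = -1.
  have -> : forall p, ee (R := R) (n%:R^-1) ^+ p = ee (p%:R / n%:R).
    by elim=> [|p IH]; rewrite ?mul0r ?ee0 // exprS IH -eeD; congr ee; rewrite -natr1; ring.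
  rewrite (_ : N%:R / n%:R = 2^-1); last by rewrite /n natrM invfM mulrA divff ?mul1r // gt_eqF.
  rewrite /ee (_ : 2 * pi * 2^-1 = pi); last by rewrite mulrAC divff // mul1r.
  by rewrite /cexp /= expR0 mul1r cospi sinpi; apply/eqP; rewrite eq_complex /= oppr0 !eqxx.
have bot : \prod_(i < n) q i 0%N = -1.
  rewrite (eq_bigr (fun=> psq (ee n%:R^-1))) => [|i _]; last first.
    rewrite /q /g pt00 !Gbot ?pt01 //; last exact: ltnW.
    congr psq; apply: (mulIf (ee_neq0 (pt i))); rewrite mulfVK ?ee_neq0 // -eeD; congr ee.
    by rewrite /pt -natr1; ring.
  rewrite prodr_const card_ord -eeN (_ : psq _ ^+ n = (psq (ee n%:R^-1) ^+ 2) ^+ N); last first.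
    by rewrite -exprM mulnC.
  rewrite (Hpsq _ _).1 //.
  have g10 : g 1%N 0%N = ee n%:R^-1 by rewrite /g pt00 Gbot ?pt01 // /pt mul1r.
  have g00 : g 0%N 0%N = 1 by rewrite /g pt00 Gbot ?ee0 // lexx ler01.
  have hb : cmod (g 1%N 0%N - g 0%N 0%N) < cmod (g 0%N 0%N) by apply: Gd; rewrite ?pt01.
  by have := near1 _ _ (g0 0%N 0%N isT isT) hb; rewrite g10 g00 divr1.
have := const n (leqnn _); rewrite top bot => /eqP; rewrite -subr_eq0 opprK =>
    /eqP/(congr1 (@complex.Re R)) /=.
by move=> /eqP; rewrite -[1 + 1]/2%:R pnatr_eq0.
Qed.

End Winding.

(** * Singletons belong to K *)

Section Singletons.
Variables (R : realType) (m : nat) (K : {set {set 'I_m}}).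
Local Notation C := R[i].
Local Notation V := 'rV[C]_m.
Local Notation U := (UK (R := R) K).

(** By bisection, with only the first of the two points confined to the small square, so that the
    four constants combine by taking a minimum. *)
Lemma unif2 (G : R -> R -> C) :
  (forall t s, 0 <= t <= 1 -> 0 <= s <= 1 -> G t s != 0) ->
  (forall t0 s0 e, 0 <= t0 <= 1 -> 0 <= s0 <= 1 -> 0 < e -> exists2 d : R, 0 < d &
     forall t s, 0 <= t <= 1 -> 0 <= s <= 1 -> `|t - t0| < d -> `|s - s0| < d ->
         cmod (G t s - G t0 s0) < e) ->
  exists2 d : R, 0 < d & forall t s t' s', 0 <= t <= 1 -> 0 <= s <= 1 -> 0 <= t' <= 1 ->
      0 <= s' <= 1 ->
     `|t - t'| < d -> `|s - s'| < d -> cmod (G t' s' - G t s) < cmod (G t s).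
Proof.
move=> G0 cG.
pose P x y l := exists2 d : R, 0 < d & forall t s t' s', 0 <= t <= 1 -> 0 <= s <= 1 ->
    0 <= t' <= 1 -> 0 <= s' <= 1 ->
  x <= t <= x + l -> y <= s <= y + l ->
  `|t - t'| < d -> `|s - s'| < d -> cmod (G t' s' - G t s) < cmod (G t s).
suff [d d0 Hd] : P 0 0 1.
  by exists d => // t s t' s' ht hs ht' hs'; apply: Hd => //; rewrite add0r.
apply: bisect2.
  move=> x y l l0 [d1 d10 H1] [d2 d20 H2] [d3 d30 H3] [d4 d40 H4].
  have [e1 [e10 e1a e1b]] := lt_both d10 d20; have [e2 [e20 e2a e2b]] := lt_both d30 d40.
  have [e [e0 ea eb]] := lt_both e10 e20.
  exists e => // t s t' s' ht hs ht' hs' /andP[tx xt] /andP[sy ys] htt hss.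
  have w e' : e < e' -> `|t - t'| < e' /\ `|s - s'| < e'.
    by move=> ee'; split; [exact: lt_trans htt ee'|exact: lt_trans hss ee'].
  have [w1 w1'] := w _ (lt_trans ea e1a); have [w2 w2'] := w _ (lt_trans ea e1b).
  have [w3 w3'] := w _ (lt_trans eb e2a); have [w4 w4'] := w _ (lt_trans eb e2b).
  have [tl|lt] := leP t (x + l / 2); have [sl|ls] := leP s (y + l / 2).
  - by apply: H1; rewrite ?tx ?sy.
  - by apply: H3; rewrite ?tx // -addrA -splitr ys ltW.
  - by apply: H2; rewrite ?sy // -addrA -splitr xt ltW.
  - by apply: H4; rewrite // -addrA -splitr ?ys ?xt ltW.
move=> t0 s0 ht0 hs0; pose c := cmod (G t0 s0); have c0 : 0 < c by rewrite cmod_gt0 G0.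
have c3 : 0 < c / 3 by rewrite divr_gt0.
have [d d0 Hd] := cG t0 s0 _ ht0 hs0 c3.
exists (d / 2) => [|x y l l0 ld /andP[x1 x2] /andP[y1 y2] _ _ _ _]; first by rewrite divr_gt0.
exists (d / 2) => [|t s t' s' ht hs ht' hs' /andP[tx xt] /andP[sy ys]]; first by rewrite divr_gt0.
rewrite ltr_norml => /andP[h1 h2]; rewrite ltr_norml => /andP[h3 h4].
have A1 : cmod (G t s - G t0 s0) < c / 3.
  by apply: Hd => //; rewrite ltr_norml; apply/andP; split; lra.
have A2 : cmod (G t' s' - G t0 s0) < c / 3.
  by apply: Hd => //; rewrite ltr_norml; apply/andP; split; lra.
have := cmod_triB (G t' s') (G t0 s0) (G t s); have := cmod_subC (G t s) (G t0 s0).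
have := cmodD (G t0 s0 - G t s) (G t s); rewrite subrK -/c; lra.
Qed.

Lemma UK_torus (z : V) : finset.set0 \in K -> (forall j, z 0 j != 0) -> U z.
Proof.
move=> K0 z0 [J JK zJ]; have [J0|[j jJ]] := set_0Vmem J; first by move: JK; rewrite /= J0 K0.
by have /eqP := z0 j; apply; exact: zJ.
Qed.

Lemma UK_one_zero (z : V) : finset.set0 \in K -> (forall j, [set j] \in K)%SET ->
  (forall i j, z 0 i = 0 -> z 0 j = 0 -> i = j) -> U z.
Proof.
move=> K0 K1 z1 [J JK zJ]; have [J0|[j jJ]] := set_0Vmem J; first by move: JK; rewrite /= J0 K0.
suff E : J = [set j]%SET by move: JK; rewrite /= E K1.
apply/setP => i; rewrite inE; apply/idP/eqP => [iJ|->//].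
by apply: z1; exact: zJ.
Qed.

(** If {j} were not in K, the coordinate z_j would have no zero on U(K), and a null homotopy of the
    coordinate loop would unwind [ee] in the nonzero complex numbers. *)
Lemma singletons : finset.set0 \in K -> simply_connected R U -> forall j, [set j]%SET \in K.
Proof.
move=> K0 [_ _ sc] j; apply: contrapT => /negP Kj.
have U0 (u : U) : val u 0 j != 0.
  apply/eqP => uj; apply: (@val_UK R m K u); exists [set j]%SET => // i; rewrite inE => /eqP->.
  exact: uj.
pose w (t : R) : V := \row_k (if k == j then ee t else 1).
have Uw t : U (w t).
  by apply: UK_torus => // k; rewrite mxE; case: ifP => _; [exact: ee_neq0|exact: oner_neq0].
pose p t : U := SigSub (mem_set (Uw t)).
have cp : continuous p.
  apply: continuous_comp_initial => t P /= /nbhsCV[d d0 Hd].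
  have := @cont_ee R t; move/contCP => /(_ d d0); apply: filterS => s hs; apply: Hd => k.
  rewrite !mxE; case: ifP => _; [exact: hs|by rewrite subrr cmod0].
have p01 : p 0 = p 1.
  by apply/val_inj/rowP => k; rewrite /= !mxE ee0 ee1.
have [F [cF F0 F1 Fs]] := sc p (continuous_subspaceT cp) p01.
pose G t s := val (F (t, s)) 0 j.
have [|d d0 Hd] := @unif2 G (fun t s _ _ => U0 _).
  move=> t0 s0 e ht0 hs0 e0.
  have /subspace_continuousP/(_ (t0, s0)) cF' := cF.
  have A0 : (`[0, 1] `*` `[0, 1])%classic (t0, s0) by split; rewrite /= in_itv.
  have N : nbhs (F (t0, s0)) (fun u : U => cmod (val u 0 j - val (F (t0, s0)) 0 j) < e).
    have NV : nbhs (val (F (t0, s0))) (fun z : V => cmod (z 0 j - val (F (t0, s0)) 0 j) < e).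
      by apply/nbhsCV; exists e => // z; apply.
    exact: (@initial_continuous U V val _ _ NV).
  have [[P Q] [/= hP hQ] PQ] := cF' A0 _ N.
  have /nbhs_ballP[d1 /= d10 H1] := hP; have /nbhs_ballP[d2 /= d20 H2] := hQ.
  have [d [dd da db]] := lt_both d10 d20; exists d => // t s ht hs tt ss.
  apply: (PQ (t, s)).
    split; [apply: H1|apply: H2]; rewrite /ball /= distrC;
        [exact: lt_trans tt da|exact: lt_trans ss db].
  by split; rewrite /= in_itv.
have Fp t : 0 <= t <= 1 -> F (t, 0) = p t by move=> ht; apply: F0; rewrite in_itv.
have p0 : val (p 0) 0 j = 1 by rewrite /= mxE eqxx ee0.
apply: (@no_unwinding R G d d0 Hd) => t ht.
- by rewrite /G Fp // /= mxE eqxx.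
- by rewrite /G F1 ?in_itv.
by have [] := Fs t; rewrite ?in_itv // /G => -> ->.
Qed.

End Singletons.

(** By surjectivity on the cones, some vector with nonnegative coordinates is congruent to -(1, ...,
    1) modulo p(h); the difference has coordinates at least 1. *)
Lemma positive_ph (R : realType) (m : nat) (K : {set {set 'I_m}}) (h : {vspace 'rV[R[i]]_m}) :
  maps_onto_complete_fan K h -> exists2 v : 'rV[R]_m, v \in ph h & forall j, 0 < v 0 j.
Proof.
move=> [_ [_ _ /(_ (quot_ph h (- const_mx 1)) I)[x [s [J _ ->] [mu mu0 ->]] /eqP]]].
rewrite lquot_piE opprK => xh; exists (\sum_(i in J) mu i *: delta_mx 0 i + const_mx 1) => // j.
rewrite !mxE summxE ltr_wpDl // sumr_ge0 // => i _.
by rewrite !mxE mulr_ge0 // ler0n.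
Qed.

Theorem theorem5p10 (R : realType) (m : nat) (K : {set {set 'I_m}})
    (h : {vspace 'rV[R[i]]_m}) :
  simplicial_complex K ->
  meets_coord_subtori_trivially K h ->
  maps_onto_complete_fan K h ->
  simply_connected R (UK (R := R) K) ->
  no_character_vanishes h ->
  finite_set [set A : set (UKH K h) |
    analytic_subset_of_codim_one (UKH_hol (K := K) (h := h)) A].
Proof.
move=> [K0 _] _ mf sc nc; have [v vh v0] := positive_ph mf.
have K1 := singletons K0 sc.
(* Each A will be [div J] for J the set of those j whose hyperplane, inside U(K), is contained in
   the preimage of A; there are finitely many J. *)
pose div (J : {set 'I_m}) : set (UKH K h) :=
  [set UKH_pi h u | u in [set u : UK K | exists2 j, j \in J & val u 0 j = 0]].
apply: (@sub_finite_set _ _ (div @` setT)); last exact/finite_image/finite_finset.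
move=> A cA; have [aA _ _] := cA.
have aX y : UK K y -> analytic_at (orbit_preimage A) y by exact: lift_analytic.
have hX := lift_hyper cA.
have X0 z : orbit_preimage A z -> exists j, z 0 j = 0.
  move=> Az; apply: contrapT => nz.
  apply: (torus_disjoint nc vh v0 _ aX hX (@lift_UK _ _ _ _ A) (lift_nowhere cA) _ Az).
  - by move=> x y xh; exact: lift_act.
  - by move=> y; exact: UK_one_zero.
  - by move=> j; apply/eqP => zj; apply: nz; exists j.
have E := coord_union aX hX (@lift_UK _ _ _ _ A) (@UK_supp R m K) X0.
exists [set j | `[< forall z, UK K z -> z 0 j = 0 -> orbit_preimage A z >]]%SET => //.
apply/seteqP; split=> [y [u [j jJ uj] <-]|x Ax].
  by move: jJ; rewrite inE => /asboolP H; apply/liftE/H => //; exact: val_UK.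
have [u ux] : exists u : UK K, UKH_pi h u = x.
  by exists (repr x); exact: reprK.
rewrite -ux in Ax *; have /E[_ [j uj H]] := (liftE A u).2 Ax.
by exists u => //; exists j => //; rewrite inE; apply/asboolP.
Qed.
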